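(* Let $(M,\langle\cdot,\cdot\rangle)$ be a complete (connected) Riemannian manifold and let $0\le\psi\in Lip_{loc}(M)$ be a distributional solution of the differential inequality $$\psi\Delta\psi+a(x)\psi^{2}+A|\nabla\psi|^{2}\ge 0$$ on $M$, for some $0\le a(x)\in C^{0}(M)$ and some $A\in\mathbb{R}$. Assume that the bottom of the spectrum of the Schrödinger operator $\mathcal{L}_{H}=-\Delta-Ha(x)$ satisfies $\lambda_{1}(\mathcal{L}_{H})\ge 0$ for some $H\ge A+1>0$. Let $p_{0}\le H\le p_{1}$ be the solutions of $$q^{2}-2Hq+H(A+1)=0.$$ Suppose that, for some origin $o\in M$ and for some $p$ with $p_{0}\le p\le p_{1}$, $$\int_{B_{R}(o)}\psi^{2p}=o(R^{2})\quad\text{as }R\to+\infty.$$ Then the following hold. (i) If $H>A+1$ and $p_{0}<p<p_{1}$, then $\psi$ is constant on $M$. (ii) If $H=A+1$, then $\psi$ satisfies $\psi\Delta\psi+a(x)\psi^{2}+A|\nabla\psi|^{2}=0$ in the distributional sense on the open set $\Omega$ where $\psi^{A}>0$. In particular, equality holds on all of $M$ if $A\le 0$.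
   Context: Riemannian manifolds are connected. $B_R(o)$ is the geodesic ball of radius $R$ centered at $o$; $Lip_{loc}(M)$ (resp. $Lip_c(M)$) denotes locally Lipschitz (resp. compactly supported Lipschitz) functions. Distributional solution: $\psi$ satisfies the differential inequality if for every $0\le\eta\in Lip_c(M)$, $$\int_M a\,\eta\,\psi^{2}+\int_M A\,\eta\,|\nabla\psi|^{2}-\int_M\langle\nabla(\eta\psi),\nabla\psi\rangle\ \ge\ 0.$$ Equality on an open set $\Omega$ means that this expression vanishes for all such $\eta$ with compact support in $\Omega$. The condition $\lambda_1(\mathcal{L}_H)\ge 0$ means $\int_M|\nabla\phi|^{2}\ge\int_M Ha\,\phi^{2}$ for every $\phi\in Lip_c(M)$ (equivalently every $\phi\in C_c^\infty(M)$). Convention for $\Omega=\{\psi^{A}>0\}$: if $A>0$, then $\Omega=\{\psi>0\}$; if $A\le 0$, then $\Omega=M$ (with $\psi^{A}=+\infty$ where $\psi=0$ and $A<0$, and $\psi^0\equiv1$). *)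

(* Defs.v *)
From HB Require Import structures.
From mathcomp Require Import all_boot all_order all_algebra.
From mathcomp Require Import all_classical all_reals all_analysis.

Set Implicit Arguments.
Unset Strict Implicit.
Unset Printing Implicit Defensive.
Import Order.TTheory GRing.Theory Num.Theory.
Import numFieldNormedType.Exports.

Local Open Scope classical_set_scope.
Local Open Scope ring_scope.

(* Intended for open D: all iterated directional derivatives exist and are
   continuous on D, i.e. f is C^oo on D. *)
Definition smooth_on (R : realType) (V W : normedModType R) (D : set V)
    (f : V -> W) : Prop :=
  forall (s : seq V) (x : V), D x ->
    let h := foldr (fun v k => 'D_v k) f s in
    {for x, continuous h} /\ forall v, derivable h x v.

(* Iterated one-dimensional integrals; on nonnegative Borel functions this is
   the integral against n-dimensional Lebesgue measure, by Tonelli. *)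
Fixpoint lebesgue_integral_rV (R : realType) (n : nat) :
    ('rV[R]_n -> \bar R) -> \bar R :=
  match n with
  | 0 => fun f => f 0
  | k.+1 => fun f =>
      (\int[@lebesgue_measure R]_t
         lebesgue_integral_rV (fun y : 'rV[R]_k => f (row_mx t%:M y)))%E
  end.

(* A connected smooth Riemannian manifold of dimension n, given by a smooth
   atlas and the local expressions of its metric tensor.  Vectors are rows, so
   the change of coordinates acts on components by v |-> v *m J, where J is the
   jacobian.  [rm_chart_at] merely picks a chart around each point, in which
   tangent vectors at this point are written. *)
Record riemannian_manifold (R : realType) (n : nat) (M : topologicalType) :=
  RiemannianManifold {
  rm_index : Type ;
  rm_dom : rm_index -> set M ;
  rm_coord : rm_index -> M -> 'rV[R]_n ;
  rm_param : rm_index -> 'rV[R]_n -> M ;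
  rm_chart_at : M -> rm_index ;
  rm_metric : rm_index -> 'rV[R]_n -> 'M[R]_n ;
  rm_hausdorff : hausdorff_space M ;
  rm_second_countable : @second_countable M ;
  rm_connected : connected [set: M] ;
  rm_chart_atP : forall x, rm_dom (rm_chart_at x) x ;
  rm_dom_open : forall i, open (rm_dom i) ;
  rm_cod_open : forall i, open (rm_coord i @` rm_dom i) ;
  rm_coordK : forall i x, rm_dom i x -> rm_param i (rm_coord i x) = x ;
  rm_coord_continuous : forall i x, rm_dom i x ->
    {for x, continuous (rm_coord i)} ;
  rm_param_continuous : forall i y, (rm_coord i @` rm_dom i) y ->
    {for y, continuous (rm_param i)} ;
  rm_transition_smooth : forall i j,
    smooth_on (rm_coord i @` (rm_dom i `&` rm_dom j))
      (rm_coord j \o rm_param i) ;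
  rm_metric_smooth : forall i,
    smooth_on (rm_coord i @` rm_dom i) (rm_metric i) ;
  rm_metric_sym : forall i y, (rm_coord i @` rm_dom i) y ->
    (rm_metric i y)^T = rm_metric i y ;
  rm_metric_pos : forall i y, (rm_coord i @` rm_dom i) y ->
    forall v : 'rV[R]_n, v != 0 -> 0 < (v *m rm_metric i y *m v^T) 0 0 ;
  rm_metric_change : forall i j x, rm_dom i x -> rm_dom j x ->
    let J := jacobian (rm_coord j \o rm_param i) (rm_coord i x) in
    rm_metric i (rm_coord i x) = J *m rm_metric j (rm_coord j x) *m J^T
}.

Definition borelType (M : topologicalType) := g_sigma_algebraType (@open M).

Section RiemannianManifold.
Context {R : realType} {n : nat} {M : ptopologicalType}.
Variable g : riemannian_manifold R n M.

Definition arc_length (i : rm_index g) (c : R -> 'rV[R]_n) : R :=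
  \int[@lebesgue_measure R]_(t in `[0%R, 1%R])
    Num.sqrt ((derive1 c t *m rm_metric i (c t) *m (derive1 c t)^T) 0 0).

(* [piecewise_C1_curve x y l]: some piecewise C^1 curve from x to y has length
   l.  The curve is cut into finitely many C^1 arcs, each lying in the domain of
   one chart and written as c : [0, 1] -> R^n in this chart; any piecewise C^1
   curve can be so cut, by compactness of its parameter interval. *)
Inductive piecewise_C1_curve : M -> M -> R -> Prop :=
| curve_nil (x : M) : piecewise_C1_curve x x 0
| curve_cons (i : rm_index g) (c : R -> 'rV[R]_n) (y : M) (l : R) :
    (forall t, 0 <= t <= 1 -> (rm_coord i @` rm_dom i) (c t)) ->
    (forall t, 0 <= t <= 1 -> derivable c t 1) ->
    {within `[0%R, 1%R], continuous (derive1 c)} ->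
    piecewise_C1_curve (rm_param i (c 1)) y l ->
    piecewise_C1_curve (rm_param i (c 0)) y (arc_length i c + l).

Definition rdist (x y : M) : R := inf [set l | piecewise_C1_curve x y l].

Definition geodesic_ball (o : M) (r : R) : set M := [set x | rdist o x < r].

Definition rm_complete : Prop :=
  forall u : nat -> M,
    (forall e : R, 0 < e -> exists N : nat, forall m k : nat,
       (N <= m)%N -> (N <= k)%N -> rdist (u m) (u k) < e) ->
    exists x, (fun k => rdist (u k) x) @ \oo --> (0 : R).

Definition Lip_loc (u : M -> R) : Prop :=
  forall x : M, exists L : R, exists2 U : set M, nbhs x U &
    forall y z : M, U y -> U z -> `|u y - u z| <= L * rdist y z.

Definition supp (u : M -> R) : set M := closure [set x | u x != 0].

Definition Lip_c (u : M -> R) : Prop :=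
  (exists L : R, forall y z, `|u y - u z| <= L * rdist y z) /\
  compact (supp u).

Definition inner (x : M) (v w : 'rV[R]_n) : R :=
  let i := rm_chart_at g x in (v *m rm_metric i (rm_coord i x) *m w^T) 0 0.

(* Components of the gradient in the chart [rm_chart_at g x].  A locally
   Lipschitz function is differentiable almost everywhere; the gradient is set
   to 0 on the remaining null set. *)
Definition grad (u : M -> R) (x : M) : 'rV[R]_n :=
  let i := rm_chart_at g x in
  let y := rm_coord i x in
  let f : 'rV[R]_n -> R := u \o rm_param i in
  if `[< differentiable f y >]
  then (\row_k 'D_(delta_mx 0 k) f y) *m invmx (rm_metric i y)
  else 0.

(* mu is the Riemannian measure: it has density sqrt(det g) with respect to
   Lebesgue measure in every chart, which determines it on Borel sets. *)
Definition is_volume (mu : {measure set (borelType M) -> \bar R}) : Prop :=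
  forall (i : rm_index g) (B : set (borelType M)), measurable B ->
    B `<=` rm_dom i ->
    mu B = lebesgue_integral_rV (fun y : 'rV[R]_n =>
      (\1_(rm_coord i @` B) y * Num.sqrt (\det (rm_metric i y)))%:E).

Variable mu : {measure set (borelType M) -> \bar R}.

Definition weak_form (a : M -> R) (A : R) (psi eta : M -> R) : R :=
  \int[mu]_x (a x * eta x * psi x ^+ 2)
  + \int[mu]_x (A * eta x * inner x (grad psi x) (grad psi x))
  - \int[mu]_x inner x (grad (eta \* psi) x) (grad psi x).

Definition distributional_subsolution (a : M -> R) (A : R) (psi : M -> R) :
    Prop :=
  forall eta : M -> R, Lip_c eta -> (forall x, 0 <= eta x) ->
    0 <= weak_form a A psi eta.

Definition distributional_equality_on (Omega : set M) (a : M -> R) (A : R)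
    (psi : M -> R) : Prop :=
  forall eta : M -> R, Lip_c eta -> (forall x, 0 <= eta x) ->
    supp eta `<=` Omega -> weak_form a A psi eta = 0.

(* lambda_1(- Delta - q) >= 0 *)
Definition schroedinger_nonneg (q : M -> R) : Prop :=
  forall phi : M -> R, Lip_c phi ->
    \int[mu]_x (q x * phi x ^+ 2)
      <= \int[mu]_x inner x (grad phi x) (grad phi x).

End RiemannianManifold.

(* t ^ A for t >= 0, with 0 ^ A = +oo when A < 0; recall 0 `^ 0 = 1. *)
Definition extpow (R : realType) (t A : R) : \bar R :=
  if (t == 0) && (A < 0) then +oo%E else (t `^ A)%:E.

(* Main.v *)
(* Let s = psi + d with d > 0, k = 2 p - 2 and D = p^2 - 2 H p + H (A + 1), and
   let rho be a cutoff function.  Testing the differential inequality with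
   eta = rho^2 s^k and the spectral inequality with rho s^p gives
     0 <= H W(eta) <= int s^k (s^2 |grad rho|^2
            + 2 rho (p s - H psi) <grad rho, grad psi>
            + rho^2 |grad psi|^2 (D + H k d / s)),
   where W(eta) is the left-hand side of the weak formulation.  Now D <= 0 for
   p0 <= p <= p1, the terms containing d are negligible for d small because
   d s^q <= d^(q+1) + d B^q for d <= s <= B, and the growth condition makes
   int s^(2p) |grad rho|^2 arbitrarily small for cutoffs on large balls, which
   are compactly supported by the Hopf-Rinow theorem.
   If D < 0, the cross term is absorbed by Young's inequality and grad psi = 0
   almost everywhere.  If H = A + 1, then p = H, D = 0 and W(rho^2 s^(2A)) is
   arbitrarily small; every admissible test function is at most a constant times
   rho^2 s^(2A), with a constant independent of rho and d, so that the
   nonnegative linear form W vanishes on it. *)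

Require Import Defs.
From HB Require Import structures.
From mathcomp Require Import all_boot all_order all_algebra.
From mathcomp Require Import all_classical all_reals all_analysis.
From mathcomp Require Import measurable_realfun ring lra.

Set Implicit Arguments.
Unset Strict Implicit.
Unset Printing Implicit Defensive.
Import Order.TTheory GRing.Theory Num.Theory.
Import numFieldNormedType.Exports.

Local Open Scope classical_set_scope.
Local Open Scope ring_scope.

(** * Lipschitz functions of one variable *)

(** The shift by [d] is forced by the exponent [2 * p - 2], which may be negative while psi
    vanishes: without it the test functions need not be locally Lipschitz. It stays positive
    throughout and is chosen after the radius of the cutoff, so no limit is taken under an integral
    sign. The powers in the two tests are matched so that their zero order terms nearly cancel;
    collecting what multiplies |grad psi|^2 gives p^2 - 2 H p + H (A + 1), the origin of the
    quadratic equation.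

    The calculus holds only almost everywhere: [grad] is 0 by convention where a function is not
    differentiable, so Rademacher's theorem must come before any product or chain rule under an
    integral. Distances are infima of lengths of curves, so it also has to be proved that [rdist]
    induces the given topology before balls are known to be open or compact. Finally, the real
    integral takes a default value on functions that are not integrable; hence all integrands are
    kept bounded with compact support. *)

Lemma ae_imp d (T : measurableType d) (R : realType) (mu : {measure set T -> \bar R})
  (P Q : T -> Prop) : (forall x, P x -> Q x) ->
  {ae mu, forall x, P x} -> {ae mu, forall x, Q x}.
Proof. by move=> PQ; apply: filterS => //; exact: (ae_filter_ringOfSetsType mu). Qed.

Lemma ae_imp2 d (T : measurableType d) (R : realType) (mu : {measure set T -> \bar R})
  (P1 P2 Q : T -> Prop) : (forall x, P1 x -> P2 x -> Q x) ->
  {ae mu, forall x, P1 x} -> {ae mu, forall x, P2 x} -> {ae mu, forall x, Q x}.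
Proof. by move=> PQ; apply: filterS2 => //; exact: (ae_filter_ringOfSetsType mu). Qed.

Section LipschitzLine.
Context {R : realType}.
Local Notation lam := (@lebesgue_measure R).
Variables (f : R -> R) (L : R).
Hypothesis L_gt0 : 0 < L.
Hypothesis f_lip : forall x y, `|f x - f y| <= L * `|x - y|.

Lemma lip_continuous1 : continuous f.
Proof.
move=> x; apply/cvgrPdist_lt => e e0.
near=> y; apply: le_lt_trans (f_lip _ _) _.
rewrite mulrC -ltr_pdivlMr//; near: y.
by apply: (@cvgr_dist_lt _ _ _ (nbhs x) _ id) => //; rewrite divr_gt0.
Unshelve. all: by end_near. Qed.

(** Adding or subtracting f from the line of slope L gives monotone functions, which carry Stieltjes
    measures. In the sum of the two measures f cancels and 2 L times Lebesgue measure remains, so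
    each of them is absolutely continuous. *)
Let Fp x := L * x + f x.
Let Fm x := L * x - f x.

Let Fp_nd : nondecreasing Fp.
Proof.
move=> x y xy; have := f_lip x y; rewrite (distrC x) (ger0_norm (_ : 0 <= y - x)) ?subr_ge0// => h.
rewrite /Fp; have := ler_norm (f x - f y); lra.
Qed.

Let Fm_nd : nondecreasing Fm.
Proof.
move=> x y xy; have := f_lip y x; rewrite (ger0_norm (_ : 0 <= y - x)) ?subr_ge0// => h.
rewrite /Fm; have := ler_norm (f y - f x); lra.
Qed.

Let Fp_c : continuous Fp.
Proof. by move=> x; apply: cvgD; [apply: cvgMr; exact: cvg_id|exact: lip_continuous1]. Qed.
Let Fm_c : continuous Fm.
Proof. by move=> x; apply: cvgB; [apply: cvgMr; exact: cvg_id|exact: lip_continuous1]. Qed.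

HB.instance Definition _ := isCumulative.Build R _ R Fp Fp_nd (right_continuousW Fp_c).
HB.instance Definition _ := isCumulative.Build R _ R Fm Fm_nd (right_continuousW Fm_c).

Let nup := lebesgue_stieltjes_measure Fp.
Let num := lebesgue_stieltjes_measure Fm.

Let lebesgue_stieltjes_itv (F : cumulative R R) a b : a <= b ->
  lebesgue_stieltjes_measure F `]a, b] = (F b - F a)%:E.
Proof.
move=> ab; rewrite /lebesgue_stieltjes_measure/= /measure_extension/= measurable_mu_extE/=.
  by rewrite wlength_itv_bnd.
exact: is_ocitv.
Qed.

Let c2 : {nonneg R} := NngNum (ltW (divr_gt0 (@ltr01 R) (mulr_gt0 (@ltr0n R 2) L_gt0))).

Let nup_sum A : measurable A -> lam A = ((c2%:num)%:E * (nup A + num A))%E.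
Proof.
have E B : ((c2%:num)%:E * (nup B + num B))%E = mscale c2 (measure_add nup num) B.
  by rewrite /mscale; congr (_ * _)%E; exact/esym/measure_addE.
move=> mA; rewrite E; move: mA.
move=> mA; apply: lebesgue_measure_unique => // X [[a b] _ /= <-].
rewrite -E.
wlog ab : a b / a <= b.
  move=> H; have [/H//|ba] := leP a b.
  have -> : `]a, b]%classic = `]a, a]%classic :> set R by rewrite !set_itv_ge// bnd_simp -leNgt ?(ltW ba).
  exact: H.
rewrite lebesgue_measure_itv /= lte_fin.
rewrite /nup /num !lebesgue_stieltjes_itv//.
case: ltP => [_|ba].
  have key : b - a = 1 / (2 * L) * (Fp b - Fp a + (Fm b - Fm a)).
    by rewrite /Fp /Fm; field; exact: lt0r_neq0.
  by rewrite -!EFinD -EFinM -key.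
have -> : a = b by apply/le_anti; rewrite ab ba.
by rewrite !subrr adde0 mule0.
Qed.

Let nup_dom : nup `<< lam.
Proof.
apply/null_content_dominatesP => A mA.
change (lam A = 0%E -> nup A = 0%E); rewrite (nup_sum mA) => /eqP; rewrite mule_eq0 orbC => /orP[|].
  rewrite padde_eq0 ?measure_ge0// => /andP[/eqP //].
by rewrite eqe mulf_eq0 invr_eq0 mulf_eq0 /= oner_eq0 pnatr_eq0 (gt_eqF L_gt0).
Qed.


(** The Stieltjes measure of [Fp] may have infinite mass. Its restriction to ]-N, N] is finite, so
    that Radon-Nikodym applies and the density is integrable on the whole line, as the
    differentiation theorem requires. *)
Let restr_dens (N : R) : 0 < N -> exists h : R -> R, [/\ forall x, 0 <= h x,
  lam.-integrable setT (EFin \o h) &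
  forall a b, - N <= a -> a <= b -> b <= N -> \int[lam]_(x in `]a, b]) h x = Fp b - Fp a].
Proof.
move=> N0.
pose D : set (measurableTypeR R) := `]-N, N]%classic.
have mD : measurable D by exact: measurable_itv.
have fin : fin_num_fun (mrestr nup mD).
  have H : (mrestr nup mD setT < +oo)%E.
    rewrite /mrestr (setTI D) /nup lebesgue_stieltjes_itv ?ltry//.
    by rewrite ge0_cp// ltW.
  exact: lty_fin_num_fun H.
pose nu : {finite_measure set (measurableTypeR R) -> \bar R} :=
  HB.pack (mrestr nup mD) (Measure_isFinite.Build _ _ _ (mrestr nup mD) fin).
have nud : nu `<< lam.
  apply/null_content_dominatesP => A mA A0.
  have /null_content_dominatesP/(_ _ mA A0) nA := nup_dom.
  by apply/eqP; rewrite -measure_le0 /= /mrestr -[leRHS]nA le_measure ?inE//; exact: measurableI.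
have [h [h0 hfin hint hE]] := radon_nikodym_sigma_finite nud.
have EF : EFin \o (fine \o h) = h by apply/funext => x /=; rewrite fineK.
exists (fine \o h); split.
- by move=> x; apply: fine_ge0.
- by rewrite EF.
- move=> a b Na ab bN; rewrite /Rintegral.
  have -> : (\int[lam]_(x in `]a, b]) ((fine \o h) x)%:E)%E = (\int[lam]_(x in `]a, b]) h x)%E.
    by apply: eq_integral => x _ /=; rewrite fineK.
  rewrite -hE; last exact: measurable_itv.
  rewrite /= /mrestr /nup setIidl ?lebesgue_stieltjes_itv//.
  move=> x /=; rewrite !in_itv/= => /andP[ax xb].
  by rewrite /D /= in_itv /= (le_lt_trans Na ax) (le_trans xb bN).
Qed.


Let restr_deriv (N : R) (h : R -> R) : 0 < N ->
  lam.-integrable setT (EFin \o h) ->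
  (forall a b, - N <= a -> a <= b -> b <= N -> \int[lam]_(x in `]a, b]) h x = Fp b - Fp a) ->
  {ae lam, forall x, -N < x < N -> derivable Fp x 1 /\ derive1 Fp x = h x}.
Proof.
move=> N0 hint hE.
have hi y : lam.-integrable [set` Interval (BRight (- N)) (BRight y)] (EFin \o h).
  by apply: (integrableS _ _ _ hint) => //; exact: measurable_itv.
have := FTC1 hi (open_integrable_locally openT hint).
move=> /= /ae_imp; apply=> x H /andP[Nx xN]; have [dF dFE] := H Nx.
have E : \forall y \near x, \int[lam]_(t in `]-N, y]) h t + Fp (-N) = Fp y.
  near=> y; rewrite hE ?subrK//; apply: ltW; near: y; [exact: lt_nbhsr|exact: lt_nbhsl].
have dG : is_derive x 1 (fun y => \int[lam]_(t in `]-N, y]) h t + Fp (-N)) (h x + 0).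
  apply: is_deriveD; rewrite -dFE derive1E; exact: DeriveDef.
have := near_eq_is_derive E dG; rewrite addr0 => -[d e]; split => //.
by rewrite derive1E.
Unshelve. all: by end_near. Qed.


Let ae_derivable_dens N : 0 < N -> exists h : R -> R, [/\
  lam.-integrable setT (EFin \o h),
  (forall a b, - N <= a -> a <= b -> b <= N -> \int[lam]_(x in `]a, b]) h x = Fp b - Fp a) &
  {ae lam, forall x, -N < x < N -> derivable Fp x 1 /\ derive1 Fp x = h x}].
Proof. by move=> N0; have [h [_ h1 h2]] := restr_dens N0; exists h; split => //; exact: restr_deriv. Qed.

Lemma lipschitz_ae_derivable : {ae lam, forall x, derivable f x 1}.
Proof.
have : {ae lam, forall x, forall k : nat, - k.+1%:R < x < k.+1%:R -> derivable Fp x 1}.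
  apply: ae_foralln => k.
  have [h [_ _]] := @ae_derivable_dens k.+1%:R (ltr0Sn _ _).
  by apply: ae_imp => x H /H[].
apply: ae_imp => x H.
have {}H : derivable Fp x 1.
  apply: (H (Num.truncn `|x|)); rewrite -ltr_norml; exact: truncnS_gt.
have -> : f = Fp - (fun x => L * x) by apply/funext => y; rewrite /Fp !fctE addrAC subrr add0r.
apply: derivableB => //; apply: derivableM => //; exact: derivable_id.
Qed.

(** Almost everywhere on ]a, b[ the density of [Fp] is its derivative, here the constant L.
    Integrating gives Fp b - Fp a = L (b - a), that is f a = f b. Absolute continuity is what makes
    a vanishing derivative almost everywhere sufficient. *)
Lemma lipschitz_flat_const (a b : R) : a <= b ->
  {ae lam, forall x : R, a < x < b -> is_derive x 1 f 0} -> f a = f b.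
Proof.
move=> ab flat.
pose N := 1 + `|a| + `|b|.
have N0 : 0 < N by rewrite /N -addrA ltr_pwDl.
have [h [hint hE hd]] := ae_derivable_dens N0.
have Na : - N < a.
  by rewrite ltrNl /N; have := ler_norm (-a); rewrite normrN; have := normr_ge0 b; lra.
have bN : b < N by rewrite /N; have := ler_norm b; have := normr_ge0 a; lra.
have := hE a b (ltW Na) ab (ltW bN).
have -> : \int[lam]_(x in `]a, b]) h x = \int[lam]_(x in `]a, b]) L.
  congr fine; apply: ae_eq_integral => //.
  - exact: measurable_funS (measurable_int _ hint).
  (* The integral runs over ]a, b] but the hypothesis is silent at b. *)
  - have nb : {ae lam, forall x : R, x != b}.
      exists [set b]; split; [exact: measurable_set1|exact: lebesgue_measure_set1|].
      by move=> x /= /negP; rewrite negbK => /eqP.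
    have fh := ae_imp2 (fun x p q => conj p q) flat hd.
    move: nb fh; apply: ae_imp2 => x xb [fx hx] /=.
    rewrite in_itv /= => /andP[ax xb'].
    have axb : a < x < b by rewrite ax lt_neqAle xb.
    have [|_ <-] := hx; first by rewrite (lt_trans Na ax) (lt_trans _ bN)//; case/andP: axb.
    congr (_%:E); rewrite derive1E; have fx' := fx axb.
    have : is_derive x 1 Fp (L *: 1 + 0) by apply: is_deriveD.
    by move=> /@derive_val ->; rewrite addr0 scaler1.
rewrite Rintegral_cst//= lebesgue_measure_itv /= lte_fin /Fp.
case: ltP => ba /=; first by move=> H; lra.
by have -> : a = b by apply/le_anti; rewrite ab ba.
Qed.

End LipschitzLine.

(** * Lebesgue measure on row vectors *)

Lemma ler_mx_coord (R : realType) m n (A : 'M[R]_(m, n)) i j : `|A i j| <= `|A|.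
Proof.
rewrite [leRHS]/Num.norm /= mx_normrE.
exact: (@le_bigmax _ _ _ 0 (fun ij => `|A ij.1 ij.2|) (i, j)).
Qed.

Lemma mx_norm_ltP (R : realType) m n (A : 'M[R]_(m, n)) (e : R) :
  0 < e -> (forall i j, `|A i j| < e) -> `|A| < e.
Proof.
move=> e0 H; rewrite [ltLHS]/Num.norm /= mx_normrE.
by apply/bigmax_ltP; split => // -[i j] _ /=.
Qed.

Lemma mx_norm_leP (R : realType) m n (A : 'M[R]_(m, n)) (e : R) :
  0 <= e -> (forall i j, `|A i j| <= e) -> `|A| <= e.
Proof.
move=> e0 H; rewrite [leLHS]/Num.norm /= mx_normrE.
by apply/bigmax_leP; split => // -[i j] _ /=.
Qed.

Section Cons.
Context {R : realType} {k : nat}.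
Implicit Types (t : R) (y : 'rV[R]_k).

(** The block row of [lebesgue_integral_rV], with its type fixed as a row of length [k.+1]. *)
Definition rcons_mx t y : 'rV[R]_k.+1 := row_mx (t%:M : 'M[R]_1) y.

Lemma rcons_mx0 t y : rcons_mx t y 0 0 = t.
Proof.
rewrite /rcons_mx; have -> : (0 : 'I_k.+1) = lshift k (0 : 'I_1) by exact: val_inj.
by rewrite (row_mxEl (t%:M : 'M[R]_1)) mxE eqxx mulr1n.
Qed.

Lemma rcons_mxS t y i : rcons_mx t y 0 (lift 0 i) = y 0 i.
Proof.
rewrite /rcons_mx; have -> : lift (0 : 'I_k.+1) i = rshift 1 i by exact: val_inj.
by rewrite (row_mxEr (t%:M : 'M[R]_1)).
Qed.

Lemma rcons_mxP (z : 'rV[R]_k.+1) : exists t y, z = rcons_mx t y.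
Proof.
exists (z 0 0), (\row_i z 0 (lift 0 i)); apply/rowP => i.
by case: (unliftP 0 i) => [j|] ->; rewrite ?rcons_mxS ?rcons_mx0 ?mxE.
Qed.

Lemma rcons_mxB t y t' y' : rcons_mx t y - rcons_mx t' y' = rcons_mx (t - t') (y - y').
Proof.
apply/rowP => i; rewrite [LHS]mxE [X in _ + X]mxE.
by case: (unliftP 0 i) => [j|] ->; rewrite ?rcons_mxS ?rcons_mx0 ?mxE.
Qed.

Lemma rcons_mxD t y t' y' : rcons_mx t y + rcons_mx t' y' = rcons_mx (t + t') (y + y').
Proof.
apply/rowP => i; rewrite [LHS]mxE.
by case: (unliftP 0 i) => [j|] ->; rewrite ?rcons_mxS ?rcons_mx0 ?mxE.
Qed.

Lemma norm_rcons_mx t y : `|rcons_mx t y| = Num.max `|t| `|y|.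
Proof.
apply/le_anti/andP; split.
  apply: mx_norm_leP => [|i j]; first by rewrite le_max normr_ge0.
  rewrite (ord1 i); case: (unliftP 0 j) => [l|] ->; rewrite ?rcons_mxS ?rcons_mx0 le_max ?lexx//.
  by rewrite ler_mx_coord orbT.
rewrite ge_max; apply/andP; split; first by rewrite -{1}(rcons_mx0 t y) ler_mx_coord.
by apply: mx_norm_leP => // i j; rewrite (ord1 i) -(rcons_mxS t y) ler_mx_coord.
Qed.

End Cons.

Lemma rat_approx (R : realType) (x e : R) : 0 < e -> exists q : rat, `|ratr q - x| < e.
Proof.
move=> e0; have [|q] := @rat_in_itvoo R (x - e) (x + e); first lra.
by rewrite in_itv /= => /andP[h1 h2]; exists q; rewrite ltr_norml; lra.
Qed.

Lemma rat_approx_rV (R : realType) k (x : 'rV[R]_k) (e : R) : 0 < e ->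
  exists q : 'rV[rat]_k, `|map_mx ratr q - x| < e.
Proof.
move=> e0; have /choice[q hq] : forall i, exists q : rat, `|ratr q - x 0 i| < e.
  by move=> i; exact: rat_approx.
by exists (\row_i q i); apply: mx_norm_ltP => // i j; rewrite !mxE (ord1 i).
Qed.

Lemma borel_open (T : ptopologicalType) (U : set T) : open U ->
  measurable (U : set (borelType T)).
Proof. by move=> oU; apply: sub_sigma_algebra. Qed.

Lemma borel_closed (T : ptopologicalType) (U : set T) : closed U ->
  measurable (U : set (borelType T)).
Proof.
by move=> cU; rewrite -(setCK U); apply: measurableC; apply: borel_open; exact: closed_openC.
Qed.

Lemma ball_normP (R : realType) (V : normedModType R) (x y : V) e :
  ball x e y <-> `|x - y| < e.
Proof. by rewrite -ball_normE. Qed.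

Lemma ball_le0 (R : realType) (V : normedModType R) (x : V) r : r <= 0 -> ball x r = set0.
Proof.
move=> r0; apply/seteqP; split => // y /ball_normP H.
by have := le_lt_trans (normr_ge0 _) (lt_le_trans H r0); rewrite ltxx.
Qed.

Lemma borel_ball (R : realType) k (x : 'rV[R]_k) r :
  measurable (ball x r : set (borelType 'rV[R]_k)).
Proof.
have [r0|r0] := leP r 0; last by apply: borel_open; exact: ball_open.
by rewrite ball_le0//; exact: measurable0.
Qed.

Lemma measurable_bigcup_count d (T : measurableType d) (C : countType) (F : C -> set T) :
  (forall c, measurable (F c)) -> measurable (\bigcup_c F c).
Proof.
move=> mF; have -> : \bigcup_c F c = \bigcup_i (if unpickle i is Some c then F c else set0).
  apply/seteqP; split => x [i _].
    by move=> Fx; exists (pickle i) => //; rewrite pickleK.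
  by case E : (unpickle i) => [c|//] Fx; exists c.
by apply: bigcup_measurable => i _; case: unpickle => // c; exact: mF.
Qed.

(** The source carries the product sigma-algebra, so openness of preimages is not enough. An open
    set for the max norm is a countable union of boxes with rational center and radius 1 / (m + 1),
    and boxes are measurable rectangles. *)
Lemma measurable_rcons_mx (R : realType) k : measurable_fun setT
  (fun p : measurableTypeR R * borelType 'rV[R]_k => rcons_mx p.1 p.2 : borelType 'rV[R]_k.+1).
Proof.
apply: measurability; first exact: erefl.
move=> _ [U oU <-]; rewrite setTI.
pose code := (rat * 'rV[rat]_k * nat)%type.
pose box (c : code) : set (measurableTypeR R * borelType 'rV[R]_k) :=
  (ball (ratr c.1.1 : R) (c.2.+1%:R^-1)) `*` (ball (map_mx ratr c.1.2 : 'rV[R]_k) (c.2.+1%:R^-1)).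
set V := _ @^-1` U.
pose B (c : code) := if `[< box c `<=` V >] then box c else set0.
have -> : V = \bigcup_c B c.
  apply/seteqP; split => [[t y] /= Uty|p [i _]].
    have /nbhs_ballP[e /= e0 He] : nbhs (rcons_mx t y) U by exact: open_nbhs_nbhs.
    have [m hm] : exists m : nat, m.+1%:R^-1 < e / 2.
      have := @ltr_add_invr R 0 (e/2); rewrite divr_gt0// => /(_ isT)[m]; rewrite add0r; by exists m.
    have m0 : 0 < m.+1%:R^-1 :> R by rewrite invr_gt0.
    have [q hq] := rat_approx t m0; have [w hw] := rat_approx_rV y m0.
    exists (q, w, m) => //; rewrite /B.
    have inb : box (q, w, m) (t, y) by split; apply/ball_normP.
    rewrite asboolT// => -[t' y'] [/= /ball_normP /= h1 /ball_normP /= h2].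
    apply: He; apply/ball_normP; rewrite rcons_mxB norm_rcons_mx.
    rewrite gt_max (splitr e); apply/andP; split.
      rewrite -(subrKA (ratr q)); apply: le_lt_trans (ler_normD _ _) _.
      by rewrite ltrD// ?(lt_trans h1)// distrC (lt_trans hq).
    rewrite -(subrKA (map_mx ratr w)); apply: le_lt_trans (ler_normD _ _) _.
    by rewrite ltrD// ?(lt_trans h2)// distrC (lt_trans hw).
  rewrite /B; case: ifPn => // /asboolP; exact.
apply: measurable_bigcup_count => c; rewrite /B; case: ifP => // _; apply: measurableX; [exact: measurable_ball|exact: borel_ball].
Qed.

Section LebesgueRV.
Context {R : realType}.
Local Notation lam := (@lebesgue_measure R).

(** [lebesgue_integral_rV] is only an iterated integral; measure theory needs an actual measure
    behind it. It is the image of the product of the line with the previous measure, and Tonelli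
    identifies the integrals. Finiteness on balls is carried along because it yields the
    sigma-finiteness that Tonelli needs at the next dimension. *)
Lemma exists_lebV k : exists m : {sigma_finite_measure set (borelType 'rV[R]_k) -> \bar R},
  (forall r : R, m (ball (0%R : 'rV[R]_k) r) < +oo)%E /\
  (forall f : borelType 'rV[R]_k -> \bar R, measurable_fun [set: borelType 'rV[R]_k] f -> (forall x, 0 <= f x)%E ->
     (\int[m]_x f x)%E = lebesgue_integral_rV f).
Proof.
elim: k => [|k [m [mfin mE]]].
  exists (\d_(0 : borelType 'rV[R]_0)); split.
    by move=> r; rewrite /= diracE ltry.
  by move=> f mf f0; rewrite integral_dirac//= diracT mul1e.
pose m' := pushforward (lam \x m)%E
  (fun p : measurableTypeR R * borelType 'rV[R]_k => rcons_mx p.1 p.2 : borelType 'rV[R]_k.+1).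
have mb r : (m' (ball (0%R : 'rV[R]_k.+1) r) < +oo)%E.
  have [r0|r0] := leP r 0.
    by rewrite /m' /pushforward ball_le0// preimage_set0 measure0.
  rewrite /m' /pushforward.
  rewrite (_ : _ @^-1` _ = (ball (0 : R) r `*` ball (0 : 'rV[R]_k) r)).
    rewrite product_measure1E; [|exact: measurable_ball|exact: borel_ball].
    have := @lebesgue_measure_ball R 0 r (ltW r0) => /= ->.
    by rewrite lte_mul_pinfty// ?lee_fin ?mulrn_wge0// ltW.
  apply/seteqP; split => -[t y] /=.
    move=> /ball_normP; rewrite sub0r normrN norm_rcons_mx gt_max => /andP[h1 h2].
    by split; apply/ball_normP; rewrite /= sub0r normrN.
  move=> [/ball_normP /= h1 /ball_normP /= h2]; apply/ball_normP; rewrite sub0r normrN norm_rcons_mx gt_max.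
  by move: h1 h2; rewrite !sub0r !normrN => -> ->.
have sf : sigma_finite setT m'.
  exists (fun i : nat => ball (0 : 'rV[R]_k.+1) i.+1%:R).
    apply/seteqP; split => // x _; exists (Num.truncn `|x|) => //; apply/ball_normP.
    by rewrite sub0r normrN; exact: truncnS_gt.
  by move=> i; split; [exact: borel_ball|exact: mb].
pose m1 : {sigma_finite_measure set (borelType 'rV[R]_k.+1) -> \bar R} :=
  HB.pack m' (Measure_isSigmaFinite.Build _ _ _ m' sf).
have mphi := @measurable_rcons_mx R k.
exists (m1 mphi mphi mphi); split => // f mf f0.
rewrite /= /m' ge0_integral_pushforward//.
have mg := measurableT_comp mf mphi.
rewrite preimage_setT (fubini_tonelli1 _ mg)//; last by move=> x; exact: f0.
apply: eq_integral => t _; rewrite /fubini_F /= mE//.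
apply: measurableT_comp mf _.
exact: (measurableT_comp mphi (measurable_pair1 t)).
Qed.

Definition lebV k := projT1 (cid (exists_lebV k)).

Lemma lebV_ball k r : (lebV k (ball (0%R : 'rV[R]_k) r) < +oo)%E.
Proof. by rewrite /lebV; case: cid => m [] /=. Qed.

Lemma lebV_integral k (f : borelType 'rV[R]_k -> \bar R) :
  measurable_fun [set: borelType 'rV[R]_k] f -> (forall x, 0 <= f x)%E ->
  (\int[lebV k]_x f x)%E = lebesgue_integral_rV f.
Proof. by rewrite /lebV; case: cid => m [] /= _; exact. Qed.

End LebesgueRV.

Section LebesgueRVTheory.
Context {R : realType}.
Local Notation lam := (@lebesgue_measure R).

Variables (k : nat) (B : set (borelType 'rV[R]_k.+1)).
Hypothesis mB : measurable B.

Let P : set (measurableTypeR R * borelType 'rV[R]_k) := (fun p => rcons_mx p.1 p.2) @^-1` B.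

Let mP : measurable P.
Proof. by rewrite -[P]setTI; apply: measurable_rcons_mx. Qed.

Lemma measurable_sectionl t : measurable ([set y | B (rcons_mx t y)] : set (borelType 'rV[R]_k)).
Proof.
have -> : [set y | B (rcons_mx t y)] = xsection P t by apply/seteqP; split => y; rewrite /xsection /= inE.
exact: measurable_xsection.
Qed.

Lemma measurable_sectionr y : measurable ([set t | B (rcons_mx t y)] : set (measurableTypeR R)).
Proof.
have -> : [set t | B (rcons_mx t y)] = ysection P y by apply/seteqP; split => t; rewrite /ysection /= inE.
exact: measurable_ysection.
Qed.

Let sectF t : fubini_F (lebV k) (EFin \o \1_P) t = lebV k [set y | B (rcons_mx t y)].
Proof.
have -> : [set y | B (rcons_mx t y)] = [set y | B (rcons_mx t y)] `&` setT by rewrite setIT.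
rewrite -(integral_indic (lebV k) measurableT); last first.
  have -> : [set y | B (rcons_mx t y)] = xsection P t by apply/seteqP; split => y; rewrite /xsection /= inE.
  exact: measurable_xsection.
by apply: eq_integral => y _ /=; rewrite !indicE.
Qed.

Let sectG y : fubini_G lam (EFin \o \1_P) y = lam [set t | B (rcons_mx t y)].
Proof.
have -> : [set t | B (rcons_mx t y)] = [set t | B (rcons_mx t y)] `&` setT by rewrite setIT.
rewrite -(integral_indic lam measurableT); last first.
  have -> : [set t | B (rcons_mx t y)] = ysection P y by apply/seteqP; split => t; rewrite /ysection /= inE.
  exact: measurable_ysection.
by apply: eq_integral => t _ /=; rewrite !indicE.
Qed.

Let lebVF : lebV k.+1 B = (\int[lam]_t (fubini_F (lebV k) (EFin \o \1_P) t))%E.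
Proof.
have -> : lebV k.+1 B = (\int[lebV k.+1]_x (\1_B x)%:E)%E by rewrite integral_indic// setIT.
rewrite lebV_integral//=; last by apply/measurable_EFinP; exact: measurable_indic.
apply: eq_integral => t _; rewrite -lebV_integral//.
apply/measurable_EFinP.
rewrite (_ : (fun _ => _) = \1_[set y | B (rcons_mx t y)]); last by apply/funext => y; rewrite !indicE.
by apply: measurable_indic; exact: measurable_sectionl.
Qed.

(** Tonelli for null sets. Passing from slices in one direction to slices in the other is what
    drives the inductions on the dimension in [rademacher] and [flat_const]. *)
Lemma lebVS_sectionl : lebV k.+1 B = 0%E <->
  {ae lam, forall t, lebV k [set y | B (rcons_mx t y)] = 0%E}.
Proof.
have mF : measurable_fun setT (fubini_F (lebV k) (EFin \o \1_P)).
  exact: indic_measurable_fun_fubini_tonelli_F.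
rewrite lebVF.
have -> : (\int[lam]_t fubini_F (lebV k) (EFin \o \1_P) t)%E = (\int[lam]_t `|fubini_F (lebV k) (EFin \o \1_P) t|)%E.
  by apply: eq_integral => t _; rewrite sectF gee0_abs.
rewrite (ae_eq_integral_abs lam measurableT mF); split; apply: ae_imp => t.
  by rewrite -sectF; exact.
by move=> H _; rewrite sectF.
Qed.

Lemma lebVS_sectionr : lebV k.+1 B = 0%E <->
  {ae lebV k, forall y, lam [set t | B (rcons_mx t y)] = 0%E}.
Proof.
have mG : measurable_fun setT (fubini_G lam (EFin \o \1_P)).
  exact: indic_measurable_fun_fubini_tonelli_G.
rewrite lebVF indic_fubini_tonelli//.
have -> : (\int[lebV k]_t fubini_G lam (EFin \o \1_P) t)%E = (\int[lebV k]_t `|fubini_G lam (EFin \o \1_P) t|)%E.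
  by apply: eq_integral => t _; rewrite sectG gee0_abs.
rewrite (ae_eq_integral_abs (lebV k) measurableT mG); split; apply: ae_imp => t.
  by rewrite -sectG; exact.
by move=> H _; rewrite sectG.
Qed.

End LebesgueRVTheory.

(** If S missed the ball of radius e |s| around t + s, it would miss a proportion e / (1 + e) of the
    ball of radius (1 + e) |s| around t, which contains the former. At a density point this fails
    for small s. *)
Lemma density_hit (R : realType) (S : set R) : measurable S ->
  {ae lebesgue_measure, forall t, S t -> forall e : R, 0 < e -> exists2 d : R, 0 < d &
     forall s, `|s| < d -> exists2 s', S (t + s') & `|s' - s| <= e * `|s|}.
Proof.
move=> mS; have := lebesgue_density mS; apply: ae_imp => t H St e e0.
have {}H : (lebesgue_measure (S `&` ball t r) * (lebesgue_measure (ball t r))^-1)%E @[r --> 0^'+] --> 1%:E.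
  by move: H; rewrite indicE mem_set.
have e1 : 0 < 1 + e by lra.
have c1 : ((1 - e / (1 + e))%:E < 1%:E :> \bar R)%E.
  by rewrite lte_fin ltrBlDr ltrDl divr_gt0.
have [d /= d0 Hd] := H _ (open_ereal_gt' c1).
exists (d / (1 + e)); first exact: divr_gt0.
move=> s sd; have [->|sneq0] := eqVneq s 0; first by exists 0; rewrite ?addr0// subrr normr0 mulr0.
apply: contrapT => nS; have s0 : 0 < `|s| by rewrite normr_gt0.
pose r := (1 + e) * `|s|.
have r0 : 0 < r by rewrite mulr_gt0.
have := Hd r; rewrite /= sub0r normrN gtr0_norm// => /(_ _ r0).
rewrite {1}/r mulrC -ltr_pdivlMr// => /(_ sd).
pose I : set R := ball (t + s) (e * `|s|).
have eb0 : 0 < e * `|s| by rewrite mulr_gt0.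
have mI : lebesgue_measure I = ((e * `|s|) *+ 2)%:E by rewrite lebesgue_measure_ball// ltW.
have mB : lebesgue_measure (ball t r) = (r *+ 2)%:E by rewrite lebesgue_measure_ball// ltW.
have IB : I `<=` ball t r.
  move=> x /ball_normP /= h; apply/ball_normP => /=.
  rewrite (_ : t - x = (t + s - x) - s); last ring.
  apply: le_lt_trans (ler_normB _ _) _; rewrite /r mulrDl mul1r; lra.
have SI : S `&` I = set0.
  apply/seteqP; split => // x [Sx /ball_normP /= h]; apply: nS; exists (x - t).
    by rewrite subrKC.
  by rewrite distrC (_ : s - (x - t) = t + s - x) ?ltW//; ring.
have : (lebesgue_measure (S `&` ball t r) + lebesgue_measure I <= lebesgue_measure (ball t r))%E.
  rewrite -measureU//; last 3 first.
    by apply: measurableI => //; exact: measurable_ball.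
    exact: measurable_ball.
    by rewrite setIAC SI set0I.
  apply: le_measure; rewrite ?inE; first 2 last.
  - by move=> x [[]|/IB].
  - by apply: measurableU; [apply: measurableI => //|]; exact: measurable_ball.
  - exact: measurable_ball.
have : (0 <= lebesgue_measure (S `&` ball t r))%E by [].
rewrite mI mB; case: (lebesgue_measure _) => [m| |]; last 2 first.
- by move=> _; rewrite addye// leye_eq.
- by rewrite leeNy_eq.
rewrite lee_fin -EFinD lee_fin => m0 mle.
rewrite inver mulrn_eq0/= (gt_eqF r0) -EFinM lte_fin ltr_pdivlMr ?mulrn_wgt0//.
apply/negP; rewrite -leNgt.
have -> : (1 - e / (1 + e)) * (r *+ 2) = r *+ 2 - (e * `|s|) *+ 2.
  by rewrite /r; field; exact: lt0r_neq0.
by rewrite lerBrDr.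
Qed.

(** * Rademacher's theorem *)

Lemma is_diff_eps (R : numFieldType) (V W : normedModType R) (f : V -> W) (x : V)
  (df : {linear V -> W}) : continuous df ->
  (forall e, 0 < e -> \forall h \near (0 : V), `|f (h + x) - f x - df h| <= e * `|h|) ->
  is_diff x f df.
Proof.
move=> cdf H.
have E : f \o shift x = cst (f x) + df +o_ (0 : V) id.
  apply/eqaddoP => _/posnumP[e]; near=> h.
  rewrite !fctE /= opprD addrA; near: h; exact: H.
have D := diff_unique cdf E; split => //.
by apply/diff_locallyP; rewrite D.
Unshelve. all: by end_near. Qed.

Lemma differentiable_eps (R : numFieldType) (V W : normedModType R) (f : V -> W) (x : V) :
  differentiable f x ->
  (forall e, 0 < e -> \forall h \near (0 : V), `|f (h + x) - f x - 'd f x h| <= e * `|h|).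
Proof.
move=> /diff_locallyP[_] /eqaddoP H e e0; near=> h.
have : `|(f \o shift x - (cst (f x) + 'd f x)) h| <= e * `|h|.
  by near: h; exact: H.
by rewrite !fctE /= opprD addrA.
Unshelve. all: by end_near. Qed.

Section Dot.
Context {R : realType} {k : nat}.
Implicit Types q h : 'rV[R]_k.

Definition dot q h : R := (q *m h^T) 0 0.

Lemma dotE q h : dot q h = \sum_i q 0 i * h 0 i.
Proof. by rewrite /dot mxE; apply: eq_bigr => i _; rewrite mxE. Qed.

Lemma dot_le q h : `|dot q h| <= k%:R * `|q| * `|h|.
Proof.
rewrite dotE; apply: le_trans (ler_norm_sum _ _ _) _.
apply: (@le_trans _ _ (\sum_(i < k) `|q| * `|h|)).
  by apply: ler_sum => i _; rewrite normrM ler_pM// ler_mx_coord.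
by rewrite sumr_const card_ord -mulrA mulr_natl.
Qed.

Lemma dotBl q q' h : dot (q - q') h = dot q h - dot q' h.
Proof. by rewrite /dot mulmxBl !mxE. Qed.

Lemma dot_delta q i : dot q (delta_mx 0 i) = q 0 i.
Proof.
rewrite dotE (bigD1 i)//= mxE !eqxx mulr1 big1 ?addr0// => j ji.
by rewrite mxE (negbTE ji) andbF mulr0.
Qed.

Lemma dot_is_linear q : linear (dot q).
Proof. by move=> c u v; rewrite /dot linearP mulmxDr -scalemxAr !mxE. Qed.

HB.instance Definition _ q := GRing.isLinear.Build R 'rV[R]_k R *:%R (dot q) (dot_is_linear q).

Lemma dot_continuous q : continuous (dot q).
Proof.
move=> h; apply/(@cvgrPdist_lt _ _ _ (nbhs h) (nbhs_filter h)) => e e0; near=> h'.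
rewrite -linearB; apply: le_lt_trans (dot_le _ _) _.
apply: (@le_lt_trans _ _ ((k%:R * `|q| + 1) * `|h - h'|)).
  by rewrite ler_wpM2r// lerDl.
have c0 : 0 < k%:R * `|q| + 1 by rewrite ltr_wpDl// mulr_ge0.
rewrite mulrC -ltr_pdivlMr//; near: h'.
by apply: (@cvgr_dist_lt _ _ _ (nbhs h) _ id) => //; rewrite divr_gt0.
Unshelve. all: by end_near. Qed.

End Dot.

Lemma dot_rcons (R : realType) k (t s : R) (q h : 'rV[R]_k) :
  dot (rcons_mx t q) (rcons_mx s h) = t * s + dot q h.
Proof.
rewrite !dotE big_ord_recl !rcons_mx0; congr (_ + _).
by apply: eq_bigr => i _; rewrite !rcons_mxS.
Qed.

Section AlmostDiff.
Context {R : realType} {k : nat}.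
Implicit Types (f : 'rV[R]_k -> R) (z : 'rV[R]_k).

(** Differentiability with a linear form that may depend on the precision e. No limit form has to be
    named, so the condition unfolds into countably many closed ones and its measurability can be
    read off. *)
Definition almost_diff f z := forall e, 0 < e -> exists q, exists2 d, 0 < d &
  forall h, `|h| < d -> `|f (z + h) - f z - dot q h| <= e * `|h|.

Lemma near0P (V : normedModType R) (P : V -> Prop) :
  (\forall h \near (0 : V), P h) <-> exists2 d : R, 0 < d & forall h, `|h| < d -> P h.
Proof.
split; first move=> /nbhs_ballP[d /= d0 H].
  by exists d => // h hd; apply: H; apply/ball_normP; rewrite sub0r normrN.
move=> [d d0 H]; apply/nbhs_ballP; exists d => // h /ball_normP.
by rewrite sub0r normrN => /H.
Qed.

Lemma differentiable_almost f z : differentiable f z -> almost_diff f z.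
Proof.
move=> df e e0; exists (\row_i 'd f z (delta_mx 0 i)).
have [d d0 H] := (near0P _).1 (differentiable_eps df e0).
exists d => // h /H; rewrite (addrC h).
suff -> : dot (\row_i 'd f z (delta_mx 0 i)) h = 'd f z h by [].
rewrite {2}[h]matrix_sum_delta big_ord1 linear_sum/= dotE.
by apply: eq_bigr => i _; rewrite linearZ/= mxE mulrC.
Qed.

(** Two forms that approximate f at z to precisions 1 / (m + 1) and 1 / (m' + 1) differ on each
    basis vector by at most the sum of the precisions, as a short increment in that direction shows.
    They are therefore Cauchy, and their limit is the differential. *)
Lemma almost_differentiable f z : almost_diff f z -> differentiable f z.
Proof.
move=> ad.
have e0 m : 0 < m.+1%:R^-1 :> R by [].
have /choice[q Hq] : forall m : nat, exists q, exists2 d, 0 < d &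
  forall h, `|h| < d -> `|f (z + h) - f z - dot q h| <= m.+1%:R^-1 * `|h|.
  by move=> m; exact: ad.
have qc m m' i : `|q m 0 i - q m' 0 i| <= m.+1%:R^-1 + m'.+1%:R^-1.
  have [d d0 Hd] := Hq m; have [d' d'0 Hd'] := Hq m'.
  pose s := Num.min d d' / 2.
  have s0 : 0 < s by rewrite divr_gt0// lt_min d0.
  pose h : 'rV[R]_k := s *: delta_mx 0 i.
  have hs : `|h| = s.
    rewrite normrZ gtr0_norm// -[RHS]mulr1; congr (_ * _); apply/le_anti/andP; split.
      by apply: mx_norm_leP => // a b; rewrite mxE; case: (_ && _); rewrite ?normr1 ?normr0.
    by have := ler_mx_coord (delta_mx 0 i : 'rV[R]_k) 0 i; rewrite mxE !eqxx normr1.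
  have sd : s < Num.min d d' by rewrite ltr_pdivrMr// mulr_natr mulr2n ltrDl lt_min d0.
  have h1 := Hd h; have h2 := Hd' h; move: h1 h2; rewrite hs.
  move: sd; rewrite lt_min => /andP[-> ->] /(_ isT) h1 /(_ isT) h2.
  rewrite -(ler_pM2r s0) mulrDl -[X in _ * X](gtr0_norm s0) -normrM.
  rewrite (_ : _ * s = (f (z + h) - f z - dot (q m') h) - (f (z + h) - f z - dot (q m) h)); last first.
    by rewrite /h !linearZ/= !dot_delta /GRing.scale/=; ring.
  by rewrite (le_trans (ler_normB _ _))// addrC lerD.
(* The limit is built as a supremum of lower bounds, which gives existence and the rate 1 / (m + 1)
   at once. *)
pose S i := range (fun m => q m 0 i - m.+1%:R^-1).
pose l : 'rV[R]_k := \row_i sup (S i).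
have ubS m i : ubound (S i) (q m 0 i + m.+1%:R^-1).
  move=> _ [m' _ <-]; rewrite lerBlDr -addrA -lerBlDl.
  rewrite addrC; exact: le_trans (ler_norm _) (qc _ _ _).
have S0 i : S i !=set0 by exists (q 0%N 0 i - 1%:R^-1), 0%N.
have ql m : `|l - q m| <= m.+1%:R^-1.
  apply: mx_norm_leP => // a i; rewrite (ord1 a) !mxE ler_distlC; apply/andP; split.
    by rewrite lerBlDr; apply: ge_sup.
  by rewrite -lerBlDr; apply: ub_le_sup; [exists (q m 0 i + m.+1%:R^-1); exact: ubS|exists m].
have k0 : 0 < k%:R + 1 :> R by rewrite ltr_wpDl.
suff : is_diff z f (dot l) by move=> [].
apply: is_diff_eps; first exact: dot_continuous.
move=> e ep; apply/near0P.
have [j hj] : exists j : nat, j.+1%:R^-1 < e / (k%:R + 1).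
  by have := @ltr_add_invr R 0 _ (divr_gt0 ep k0) => -[m]; rewrite add0r; exists m.
have [d d0 Hd] := Hq j.
exists d => // h /Hd; rewrite (addrC h) => hh.
rewrite (_ : _ - dot l h = (f (z + h) - f z - dot (q j) h) - dot (l - q j) h); last first.
  by rewrite dotBl opprB addrA subrK.
apply: le_trans (ler_normB _ _) _.
apply: (@le_trans _ _ (j.+1%:R^-1 * `|h| + k%:R * j.+1%:R^-1 * `|h|)).
  rewrite lerD//; apply: le_trans (dot_le _ _) _.
  by rewrite ler_wpM2r// ler_wpM2l.
rewrite -mulrDl ler_wpM2r// -[X in X + _]mul1r -mulrDl addrC mulrC -ler_pdivlMr//.
exact: ltW.
Qed.


(** Radius 1 / (m + 1) and a rational form are enough to witness the precision 1 / (j + 1), so the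
    codes c are countable; for a fixed code and continuous f the set is closed. *)
Definition Tset f (j : nat) (c : nat * 'rV[rat]_k) := [set z | forall h, `|h| < c.1.+1%:R^-1 ->
   `|f (z + h) - f z - dot (map_mx ratr c.2) h| <= j.+1%:R^-1 * `|h|].

Lemma almost_diffE f z : almost_diff f z <-> forall j, exists c, Tset f j c z.
Proof.
split=> [ad j|H e e0].
  have e0 : 0 < (j.+1%:R^-1) / 2 :> R by rewrite divr_gt0.
  have [q [d d0 Hd]] := ad _ e0.
  (* By [dot_le], moving the form by delta changes its value at h by at most k delta |h|; k + 1
     avoids dividing by 0 when k = 0. *)
  have k0 : 0 < k%:R + 1 :> R by rewrite ltr_wpDl.
  have [w hw] := rat_approx_rV q (divr_gt0 e0 k0).
  have [m hm] : exists m : nat, m.+1%:R^-1 < d.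
    by have := @ltr_add_invr R 0 d d0 => -[m]; rewrite add0r; exists m.
  exists (m, w) => h /= hh.
  have := Hd h (lt_trans hh hm).
  rewrite (_ : _ - dot (map_mx ratr w) h = (f (z + h) - f z - dot q h) - dot (map_mx ratr w - q) h); last by rewrite dotBl opprB addrA subrK.
  move=> h1; apply: le_trans (ler_normB _ _) _.
  rewrite [X in X * _]splitr mulrDl lerD//.
  apply: le_trans (dot_le _ _) _; apply: ler_wpM2r => //.
  apply: (@le_trans _ _ ((k%:R + 1) * (j.+1%:R^-1 / 2 / (k%:R + 1)))).
    by rewrite ler_pM// ?lerDl// ltW.
  by rewrite mulrC divfK// gt_eqF.
have [j hj] : exists j : nat, j.+1%:R^-1 < e.
  by have := @ltr_add_invr R 0 e e0 => -[m]; rewrite add0r; exists m.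
have [[m w] /= Hc] := H j.
exists (map_mx ratr w), (m.+1%:R^-1) => // h /Hc h1.
by apply: (le_trans h1); apply: ler_wpM2r => //; exact: ltW.
Qed.

(** The direction map v is left free so that one statement covers increments in all variables and
    increments in the last k variables alone. *)
Lemma closed_increment f (I : Type) (D : set I) (v : I -> 'rV[R]_k) (c b : I -> R) :
  continuous f ->
  closed [set z | forall i, D i -> `|f (z + v i) - f z - c i| <= b i].
Proof.
move=> cf.
have -> : [set z | forall i, D i -> `|f (z + v i) - f z - c i| <= b i] =
    \bigcap_(i in D) (fun z => `|f (z + v i) - f z - c i|) @^-1` [set x | x <= b i].
  by apply/seteqP; split => z H i /H.
apply: closed_bigI => i _; apply: closed_comp; last exact: closed_le.
move=> z _; apply: (@cvg_norm _ _ _ (nbhs z) (nbhs_filter z)).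
apply: (@cvgB _ _ _ (nbhs z) (nbhs_filter z)); last exact: cvg_cst.
apply: (@cvgB _ _ _ (nbhs z) (nbhs_filter z)); last exact: cf.
apply: (cvg_comp (fun z => z + v i) f); last exact: cf.
by apply: (@cvgD _ _ _ (nbhs z) (nbhs_filter z)); [exact: cvg_id|exact: cvg_cst].
Qed.

Lemma measurable_almost_diff f : continuous f ->
  measurable ([set z | almost_diff f z] : set (borelType 'rV[R]_k)).
Proof.
move=> cf.
have -> : [set z | almost_diff f z] = \bigcap_j \bigcup_c Tset f j c.
  apply/seteqP; split => z /=.
    by move=> /almost_diffE H j _; have [c Hc] := H j; exists c.
  by move=> H; apply/almost_diffE => j; have [c _ Hc] := H j I; exists c.
apply: bigcapT_measurable => j; apply: measurable_bigcup_count => c.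
apply: borel_closed.
have := closed_increment (D := [set h | `|h| < c.1.+1%:R^-1]) (v := id)
  (c := fun h => dot (map_mx ratr c.2) h) (b := fun h => j.+1%:R^-1 * `|h|) cf.
by congr (closed _); apply/seteqP; split => z Hz h /Hz.
Qed.

End AlmostDiff.

Section Rademacher.
Context {R : realType}.
Local Notation lam := (@lebesgue_measure R).

Lemma lip_continuous k (f : 'rV[R]_k -> R) L : 0 < L ->
  (forall x y, `|f x - f y| <= L * `|x - y|) -> continuous f.
Proof.
move=> L0 lf x; apply/(@cvgrPdist_lt _ _ _ (nbhs x) (nbhs_filter x)) => e e0; near=> y.
apply: le_lt_trans (lf _ _) _.
rewrite mulrC -ltr_pdivlMr//; near: y.
by apply: (@cvgr_dist_lt _ _ _ (nbhs x) _ id) => //; rewrite divr_gt0.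
Unshelve. all: by end_near. Qed.

(* If [t |-> f (t, y)] is differentiable at [t] and [t] is a density point of
   the set where the increments of [f] in [y] are uniformly approximated by the
   same linear map, then the two estimates can be combined at a nearby point of
   this set. *)
Lemma almost_diff_rcons k (f : 'rV[R]_k.+1 -> R) L t y : 0 < L ->
  (forall x y, `|f x - f y| <= L * `|x - y|) ->
  derivable (fun t => f (rcons_mx t y)) t 1 ->
  (forall j c, Tset (fun y => f (rcons_mx t y)) j c y ->
     forall e, 0 < e -> exists2 d : R, 0 < d & forall s, `|s| < d ->
       exists2 s', Tset (fun y => f (rcons_mx (t + s') y)) j c y & `|s' - s| <= e * `|s|) ->
  almost_diff (fun y => f (rcons_mx t y)) y ->
  almost_diff f (rcons_mx t y).
Proof.
move=> L0 lf df hit /almost_diffE ad e e0.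
(* Moving from t + s to the nearby point t + s' costs L e' r twice, and the two differential
   estimates cost e' r each. *)
have L1 : 0 < 2 * L + 2 by lra.
pose e' := e / (2 * L + 2).
have e'0 : 0 < e' by rewrite divr_gt0.
have [j hj] : exists j : nat, j.+1%:R^-1 < e'.
  by have := @ltr_add_invr R 0 _ e'0 => -[m]; rewrite add0r; exists m.
have [c Tc] := ad j.
have [d1 d10 hit1] := hit j c Tc _ e'0.
have /derivable1_diffP/differentiable_eps/(_ e' e'0)/near0P[d2 d20 H2] := df.
pose D := 'd (fun t0 : R => f (rcons_mx t0 y)) t 1.
have c0 : 0 < c.1.+1%:R^-1 :> R by [].
exists (rcons_mx D (map_mx ratr c.2)).
exists (Num.min d1 (Num.min d2 c.1.+1%:R^-1)); first by rewrite !lt_min d10 d20 c0.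
move=> z; have [s [h ->]] := rcons_mxP z.
rewrite norm_rcons_mx gt_max !lt_min => /andP[/and3P[sd1 sd2 _] /and3P[_ _ hc]].
have [s' Ts' ss'] := hit1 s sd1.
rewrite rcons_mxD dot_rcons; set r := Num.max _ _.
have sr : `|s| <= r by rewrite le_max lexx.
have hr : `|h| <= r by rewrite le_max lexx orbT.
have lss u : `|f (rcons_mx (t + s) u) - f (rcons_mx (t + s') u)| <= L * (e' * r).
  apply: le_trans (lf _ _) _; apply: ler_wpM2l; first exact: ltW.
  rewrite rcons_mxB subrr norm_rcons_mx normr0 max_l// opprD addrACA subrr add0r distrC.
  by apply: (le_trans ss'); rewrite ler_wpM2l// ltW.
have h1 := lss (y + h); have h2 := lss y.
have h3 : `|f (rcons_mx (t + s') (y + h)) - f (rcons_mx (t + s') y) - dot (map_mx ratr c.2) h| <= e' * r.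
  apply: le_trans (Ts' h hc) _; apply: ler_pM => //; exact: ltW.
have h4 : `|f (rcons_mx (t + s) y) - f (rcons_mx t y) - D * s| <= e' * r.
  have dE : 'd (fun t0 : R => f (rcons_mx t0 y)) t s = D * s.
    by rewrite -{1}[s]mulr1 -[s * 1]/(s *: (1 : R)) linearZ/= mulrC.
  have := H2 s sd2; rewrite (addrC s) dE => h4.
  by apply: (le_trans h4); rewrite ler_wpM2l// ltW.
have -> : e = 2 * (L * e') + 2 * e' by rewrite /e'; field; exact: lt0r_neq0.
move: h1 h2 h3 h4; rewrite !ler_norml.
set a1 := f _; set a2 := f _; set a3 := f _; set a4 := f _; set a5 := f _; set b := dot _ _.
move=> /andP[? ?] /andP[? ?] /andP[? ?] /andP[? ?]; apply/andP; split; nra.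
Qed.

Lemma Tset_rcons k (f : 'rV[R]_k.+1 -> R) j c t y :
  Tset (fun y => f (rcons_mx t y)) j c y <->
  [set z | forall h, [set h : 'rV[R]_k | `|h| < c.1.+1%:R^-1] h ->
     `|f (z + rcons_mx 0 h) - f z - dot (map_mx ratr c.2) h| <= j.+1%:R^-1 * `|h|] (rcons_mx t y).
Proof. by split=> H h /H; rewrite rcons_mxD addr0. Qed.

Lemma closed_Tset_rcons k (f : 'rV[R]_k.+1 -> R) j c : continuous f ->
  closed [set z | forall h, [set h : 'rV[R]_k | `|h| < c.1.+1%:R^-1] h ->
     `|f (z + rcons_mx 0 h) - f z - dot (map_mx ratr c.2) h| <= j.+1%:R^-1 * `|h|].
Proof. by move=> cf; exact: closed_increment. Qed.

Lemma ae_forallc d (T : measurableType d) (mu : {measure set T -> \bar R}) (C : countType)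
  (P : C -> T -> Prop) : (forall c, {ae mu, forall x, P c x}) ->
  {ae mu, forall x, forall c, P c x}.
Proof.
move=> H.
have : {ae mu, forall x, forall n : nat, if unpickle n is Some c then P c x else True}.
  by apply: ae_foralln => n; case: unpickle => [c|]; [exact: H|exact: aeW].
by apply: ae_imp => x Hx c; have := Hx (pickle c); rewrite pickleK.
Qed.

(** Induction on the dimension. By the induction hypothesis f (t, .) is differentiable almost
    everywhere for each t; exchanging slices, for almost every y this holds at (t, y) for almost
    every t. On such a line the one-dimensional theorem and Lebesgue density provide the hypotheses
    of [almost_diff_rcons]. *)
Theorem rademacher k (f : 'rV[R]_k -> R) L : 0 < L ->
  (forall x y, `|f x - f y| <= L * `|x - y|) ->
  lebV k (~` [set z | almost_diff f z]) = 0%E.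
Proof.
elim: k f => [|k IH] f L0 lf.
  rewrite (_ : ~` _ = set0) ?measure0//; apply/seteqP; split => // z /=; apply.
  move=> e e0; exists 0, 1 => // h _.
  have -> : z + h = z by apply/rowP => -[].
  by rewrite subrr sub0r normrN dotE big_ord0 normr0 mulr_ge0// ltW.
have cf := lip_continuous L0 lf.
have mN : measurable (~` [set z | almost_diff f z] : set (borelType 'rV[R]_k.+1)).
  by apply: measurableC; exact: measurable_almost_diff.
have crc (t : R) : continuous (fun y : 'rV[R]_k => f (rcons_mx t y)).
  apply: (lip_continuous L0) => y y'; apply: le_trans (lf _ _) _.
  by rewrite rcons_mxB subrr norm_rcons_mx normr0 max_r.
apply/(lebVS_sectionr mN).
(* The bad set for the last k variables, written with closed sets of the full space so that it is
   jointly measurable and its slices may be exchanged. *)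
pose B : set (borelType 'rV[R]_k.+1) := ~` \bigcap_j \bigcup_(c : nat * 'rV[rat]_k)
  [set z | forall h, [set h : 'rV[R]_k | `|h| < c.1.+1%:R^-1] h ->
     `|f (z + rcons_mx 0 h) - f z - dot (map_mx ratr c.2) h| <= j.+1%:R^-1 * `|h|].
have mB : measurable B.
  apply: measurableC; apply: bigcapT_measurable => j; apply: measurable_bigcup_count => c.
  by apply: borel_closed; exact: closed_Tset_rcons.
have BP t y : B (rcons_mx t y) <-> ~ almost_diff (fun y => f (rcons_mx t y)) y.
  split; apply: contra_not.
    by move=> /almost_diffE H j _; have [c /Tset_rcons Hc] := H j; exists c.
  by move=> H; apply/almost_diffE => j; have [c _ Hc] := H j I; exists c; exact/Tset_rcons.
have D1 : {ae lebV k, forall y, lam [set t | B (rcons_mx t y)] = 0%E}.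
  apply/(lebVS_sectionr mB)/(lebVS_sectionl mB); apply: aeW => t.
  rewrite -[RHS](IH (fun y => f (rcons_mx t y)) L0); last first.
    move=> y y'; apply: le_trans (lf _ _) _.
    by rewrite rcons_mxB subrr norm_rcons_mx normr0 max_r.
  by congr (lebV k _); apply/seteqP; split => y /= /BP.
move: D1; apply: ae_imp => y /(negligibleP _ (measurable_sectionr mB y)) N1.
apply/(negligibleP _ (measurable_sectionr mN y)).
have lfy t t' : `|f (rcons_mx t y) - f (rcons_mx t' y)| <= L * `|t - t'|.
  by apply: le_trans (lf _ _) _; rewrite rcons_mxB subrr norm_rcons_mx normr0 max_l.
have A1 : {ae lam, forall t, almost_diff (fun y => f (rcons_mx t y)) y}.
  by apply: negligibleS N1 => t /=; move/BP.
have A2 := lipschitz_ae_derivable L0 lfy.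
(* Density must hold at t for all precisions and all rational forms simultaneously; these are
   countably many. *)
have A3 : {ae lam, forall t, forall c : nat * (nat * 'rV[rat]_k),
     Tset (fun y => f (rcons_mx t y)) c.1 c.2 y ->
     forall e, 0 < e -> exists2 d : R, 0 < d & forall s, `|s| < d ->
       exists2 s', Tset (fun y => f (rcons_mx (t + s') y)) c.1 c.2 y & `|s' - s| <= e * `|s|}.
  apply: ae_forallc => -[j c] /=.
  have mS := measurable_sectionr (borel_closed (closed_Tset_rcons (j := j) (c := c) cf)) y.
  have := density_hit mS; apply: ae_imp => t H /Tset_rcons /H{}H e /H[d d0 Hd].
  by exists d => // s /Hd[s' Ts' ss']; exists s' => //; exact/Tset_rcons.
have := ae_imp2 (fun t p q => conj p q) A1 (ae_imp2 (fun t p q => conj p q) A2 A3).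
apply: ae_imp => t [a1 [a2 a3]] /=.
apply: (almost_diff_rcons L0 lf a2) => // j c.
exact: (a3 (j, c)).
Qed.

End Rademacher.

(** * Lipschitz functions whose differential vanishes almost everywhere *)

Section FlatConst.
Context {R : realType}.
Local Notation lam := (@lebesgue_measure R).

(** Differentiability with differential 0, stated by increments so that the set of such points is
    visibly Borel. *)
Definition flat k (f : 'rV[R]_k -> R) z := forall e, 0 < e -> exists2 d, 0 < d &
  forall h, `|h| < d -> `|f (z + h) - f z| <= e * `|h|.

Lemma measurable_flat k (f : 'rV[R]_k -> R) : continuous f ->
  measurable ([set z | flat f z] : set (borelType 'rV[R]_k)).
Proof.
move=> cf.
have -> : [set z | flat f z] = \bigcap_j \bigcup_m
   [set z | forall h, [set h | `|h| < m.+1%:R^-1] h -> `|f (z + h) - f z - 0| <= j.+1%:R^-1 * `|h|].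
  apply/seteqP; split => z /=.
    move=> H j _; have [d d0 Hd] := H j.+1%:R^-1 (ltac:(by [])).
    have [m hm] : exists m : nat, m.+1%:R^-1 < d.
      by have := @ltr_add_invr R 0 d d0 => -[m]; rewrite add0r; exists m.
    by exists m => // h /= hh; rewrite subr0; apply: Hd; exact: lt_trans hm.
  move=> H e e0.
  have [j hj] : exists j : nat, j.+1%:R^-1 < e.
    by have := @ltr_add_invr R 0 e e0 => -[m]; rewrite add0r; exists m.
  have [m _ Hm] := H j I; exists m.+1%:R^-1 => // h /Hm; rewrite subr0 => /le_trans; apply.
  by rewrite ler_wpM2r// ltW.
apply: bigcapT_measurable => j; apply: bigcupT_measurable => m.
by apply: borel_closed; exact: closed_increment.
Qed.

Lemma ball_rcons k (t t' : R) (y y' : 'rV[R]_k) r :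
  ball (rcons_mx t y) r (rcons_mx t' y') <-> ball t r t' /\ ball y r y'.
Proof.
split => [/ball_normP|[/ball_normP h1 /ball_normP h2]].
  by rewrite rcons_mxB norm_rcons_mx gt_max => /andP[h1 h2]; split; exact/ball_normP.
by apply/ball_normP; rewrite rcons_mxB norm_rcons_mx gt_max h1.
Qed.

Lemma lebesgue_ball_neq0 (t r : R) : 0 < r -> lam (ball t r) <> 0%E.
Proof.
move=> r0; have := @lebesgue_measure_ball R t r (ltW r0) => /= ->.
by apply/eqP; rewrite eqe mulrn_eq0/= gt_eqF.
Qed.

Lemma lebV_ball_neq0 k (z : 'rV[R]_k) r : 0 < r -> lebV k (ball z r) <> 0%E.
Proof.
elim: k z => [|k IH] z r0.
  have -> : ball z r = setT.
    apply/seteqP; split => // y _; apply/ball_normP.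
    by rewrite (_ : z = y) ?subrr ?normr0//; apply/rowP => -[].
  have := @lebV_integral R 0 (cst 1%E) (measurable_cst _) (fun=> lee01).
  by rewrite integral_cst// mul1e => ->; apply/eqP; exact: onee_neq0.
have [t [y ->]] := rcons_mxP z => /(lebVS_sectionl (borel_ball _ r)) H.
apply: (lebesgue_ball_neq0 (t := t) r0); apply/negligibleP; first exact: measurable_ball.
apply: negligibleS H => t' tt' /= H; apply: (IH y r0); rewrite -H.
by congr (lebV k _); apply/seteqP; split => y' /=; [move=> yy'; exact/ball_rcons|case/ball_rcons].
Qed.

Lemma ae_ball_exists k (P : 'rV[R]_k -> Prop) z r : 0 < r ->
  {ae lebV k, forall y, P y} -> exists2 y, ball z r y & P y.
Proof.
move=> r0 H; apply: contrapT => nP; apply: (lebV_ball_neq0 (z := z) r0).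
apply/negligibleP; first exact: borel_ball.
by apply: negligibleS H => y yb /= Py; apply: nP; exists y.
Qed.

Lemma ae_ball_exists1 (P : R -> Prop) t r : 0 < r ->
  {ae lam, forall t, P t} -> exists2 t', ball t r t' & P t'.
Proof.
move=> r0 H; apply: contrapT => nP; apply: (lebesgue_ball_neq0 (t := t) r0).
apply/negligibleP; first exact: measurable_ball.
by apply: negligibleS H => y yb /= Py; apply: nP; exists y.
Qed.

(** Induction on the dimension: f (t, .) is constant for almost every t, and f (., y1) is constant
    for some y1 by the one-dimensional case. Together these give the value f (t0, y1) on almost
    every slice, and the Lipschitz bound extends it to the remaining ones. *)
Lemma flat_const k (f : 'rV[R]_k -> R) L z0 r : 0 < L ->
  (forall x y, `|f x - f y| <= L * `|x - y|) ->
  lebV k (ball z0 r `&` ~` [set z | flat f z]) = 0%E ->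
  forall z z', ball z0 r z -> ball z0 r z' -> f z = f z'.
Proof.
elim: k f z0 => [|k IH] f z0 L0 lf null z z' zb zb'; first by congr f; apply/rowP => -[].
have r0 : 0 < r by move: zb => /ball_normP; exact: le_lt_trans (normr_ge0 _).
have mN : measurable (ball z0 r `&` ~` [set z | flat f z] : set (borelType 'rV[R]_k.+1)).
  apply: measurableI; first exact: borel_ball.
  by apply: measurableC; apply: measurable_flat; exact: lip_continuous lf.
have [t0 [y0 z0E]] := rcons_mxP z0; subst z0.
have lft t y y' : `|f (rcons_mx t y) - f (rcons_mx t y')| <= L * `|y - y'|.
  by apply: le_trans (lf _ _) _; rewrite rcons_mxB subrr norm_rcons_mx normr0 max_r.
have lfy y t t' : `|f (rcons_mx t y) - f (rcons_mx t' y)| <= L * `|t - t'|.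
  by apply: le_trans (lf _ _) _; rewrite rcons_mxB subrr norm_rcons_mx normr0 max_l.
have A1 : {ae lam, forall t, ball t0 r t ->
    forall y y', ball y0 r y -> ball y0 r y' -> f (rcons_mx t y) = f (rcons_mx t y')}.
  move/(lebVS_sectionl mN): null; apply: ae_imp => t H tb.
  apply: (IH (fun y => f (rcons_mx t y)) y0 L0 (lft t)).
  apply/eqP; rewrite -measure_le0 -[leRHS]H; apply: le_measure.
  - rewrite inE; apply: measurableI; first exact: borel_ball.
    by apply: measurableC; apply: measurable_flat; exact: lip_continuous (lft t).
  - by rewrite inE; exact: measurable_sectionl mN t.
  - move=> y [yb nf]; split; first exact/ball_rcons.
    apply: contra_not nf => fl e /fl[d d0 Hd]; exists d => // h hd.
    have := Hd (rcons_mx 0 h); rewrite rcons_mxD addr0 norm_rcons_mx normr0 max_r//; exact.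
(* A single good line is enough, and one exists because balls are not null. *)
have /(ae_ball_exists y0 r0)[y1 y1b y1N] := (lebVS_sectionr mN).1 null.
have C1 t t' : ball t0 r t -> ball t0 r t' -> f (rcons_mx t y1) = f (rcons_mx t' y1).
  wlog tt : t t' / t <= t'.
    by move=> H tb tb'; have [/H|/ltW/H] := leP t t'; [exact|move=> ->].
  move=> /ball_normP /= tb /ball_normP /= tb'.
  apply: (lipschitz_flat_const L0 (lfy y1) tt).
  move/(negligibleP _ (measurable_sectionr mN y1)): y1N; apply: negligibleS => s /= ns.
  apply: contrapT => /= nN; apply: ns => /andP[ts st].
  have sb : ball t0 r s.
    by apply/ball_normP => /=; move: tb tb'; rewrite !ltr_norml => /andP[? ?] /andP[? ?]; lra.
  have fl : flat f (rcons_mx s y1).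
    by apply: contrapT => nf; apply: nN; split => //; apply/ball_rcons.
  have : is_diff s (fun t => f (rcons_mx t y1)) (\0 : {linear R -> R}).
    apply: is_diff_eps => [|e e0]; first exact: cst_continuous.
    apply/near0P; have [d d0 Hd] := fl e e0; exists d => // h hd.
    have := Hd (rcons_mx h 0); rewrite rcons_mxD addr0 norm_rcons_mx normr0 max_l//.
    by move=> /(_ hd); rewrite (addrC h) [X in _ -> `|_ - X| <= _](_ : _ = 0)// subr0.
  move=> [df dE]; split; first exact/derivable1_diffP.
  by rewrite deriveE// dE.
suff key t y : ball t0 r t -> ball y0 r y -> f (rcons_mx t y) = f (rcons_mx t0 y1).
  have [t [y zE]] := rcons_mxP z; have [t' [y' zE']] := rcons_mxP z'; subst z z'.
  by move: zb zb' => /ball_rcons[? ?] /ball_rcons[? ?]; rewrite !key.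
move=> tb yb.
apply/eqP; rewrite -subr_eq0 -normr_le0; apply/ler_addgt0Pr => e e0; rewrite add0r.
move: (tb) => /ball_normP /= tb'.
(* A good slice t1 within s of t stays in the ball, and moving to it changes f by at most e. *)
pose s := Num.min (e / L) (r - `|t0 - t|).
have s0 : 0 < s by rewrite lt_min divr_gt0//= subr_gt0.
have [t1 /ball_normP /= tt1 H1] := ae_ball_exists1 t s0 A1.
move: tt1; rewrite lt_min => /andP[tt1 tt2].
have t1b : ball t0 r t1.
  apply/ball_normP => /=; rewrite (_ : t0 - t1 = (t0 - t) + (t - t1)); last ring.
  by apply: le_lt_trans (ler_normD _ _) _; rewrite -ltrBrDl.
have t0b : ball t0 r t0 by apply/ball_normP; rewrite subrr normr0.
rewrite (C1 t0 t1)// (H1 t1b y1 y)//.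
apply: (le_trans (lfy _ _ _)); rewrite mulrC -ler_pdivlMr//; exact: ltW.
Qed.

End FlatConst.

(** * Charts and gradients *)

Lemma dotDl (R : realType) n (q q' h : 'rV[R]_n) : dot (q + q') h = dot q h + dot q' h.
Proof. by rewrite /dot mulmxDl mxE. Qed.

Lemma dotZl (R : realType) n c (q h : 'rV[R]_n) : dot (c *: q) h = c * dot q h.
Proof. by rewrite /dot -scalemxAl mxE. Qed.

Lemma dotDr (R : realType) n (q h h' : 'rV[R]_n) : dot q (h + h') = dot q h + dot q h'.
Proof. exact: linearD. Qed.

Lemma dotZr (R : realType) n c (q h : 'rV[R]_n) : dot q (c *: h) = c * dot q h.
Proof. exact: linearZ. Qed.

(** * Functions with continuous directional derivatives *)

Section C1.
Context {R : realType}.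

Lemma derive_line (V W : normedModType R) (F : V -> W) y v (s : R) :
  derivable F (y + s *: v) v ->
  is_derive s 1 (fun t : R => F (y + t *: v)) ('D_v F (y + s *: v)).
Proof.
move=> dF.
have E : (fun h : R => h^-1 *: (((fun t : R => F (y + t *: v)) \o shift s) (h *: (1 : R)) - F (y + s *: v)))
   = (fun h : R => h^-1 *: ((F \o shift (y + s *: v)) (h *: v) - F (y + s *: v))).
  apply/funext => h /=; congr (_ *: (F _ - _)).
  by rewrite [h *: 1]mulr1 scalerDl addrCA.
by split; rewrite /derivable /derive E.
Qed.

Lemma increment_le (phi dphi : R -> R) (c e : R) :
  (forall s : R, `|s| <= `|c| -> is_derive s 1 phi (dphi s)) ->
  (forall s : R, `|s| <= `|c| -> `|dphi s| <= e) ->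
  `|phi c - phi 0| <= e * `|c|.
Proof.
move=> dp de.
have cp s : `|s| <= `|c| -> {for s, continuous phi}.
  by move=> /dp[d _]; apply/differentiable_continuous/derivable1_diffP.
have [c0|c0] := leP 0 c.
  have h1 : {in `]0, c[, forall s : R, is_derive s 1 phi (dphi s)}.
    by move=> s; rewrite in_itv/= => /andP[s0 sc]; apply: dp; rewrite !ger0_norm// ltW.
  have h2 : {within `[0, c], continuous phi}.
    apply: continuous_in_subspaceT => s; rewrite inE/= in_itv/= => /andP[s0 sc].
    by apply: cp; rewrite !ger0_norm.
  have [s + ->] := MVT_segment c0 h1 h2; rewrite in_itv/= => /andP[s0 sc].
  by rewrite subr0 normrM ler_wpM2r// de// !ger0_norm.
have h1 : {in `]c, 0[, forall s : R, is_derive s 1 phi (dphi s)}.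
  move=> s; rewrite in_itv/= => /andP[cs s0]; apply: dp.
  by rewrite !ler0_norm ?lerN2; exact: ltW.
have h2 : {within `[c, 0], continuous phi}.
  apply: continuous_in_subspaceT => s; rewrite inE/= in_itv/= => /andP[cs s0].
  by apply: cp; rewrite !ler0_norm ?lerN2// ltW.
have [s + H] := MVT_segment (ltW c0) h1 h2; rewrite in_itv/= => /andP[cs s0].
rewrite distrC H sub0r normrM normrN ler_wpM2r// de// !ler0_norm ?lerN2//.
exact: ltW.
Qed.

(** The increment of F is split into n steps that change one coordinate each. The mean value
    inequality controls every step by the variation of one partial derivative near x. *)
Lemma C1_differentiable n (D : set 'rV[R]_n) (F : 'rV[R]_n -> R) x : open D -> D x ->
  (forall y v, D y -> derivable F y v) ->
  (forall v, {for x, continuous ('D_v F)}) -> differentiable F x.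
Proof.
move=> oD Dx dF cF.
pose e_ i : 'rV[R]_n := delta_mx 0 i.
pose q : 'rV[R]_n := \row_i 'D_(e_ i) F x.
suff : is_diff x F (dot q) by move=> [].
apply: is_diff_eps; first exact: dot_continuous.
move=> e e0; apply/near0P.
have n0 : 0 < n%:R + 1 :> R by rewrite ltr_wpDl.
pose e' := e / (n%:R + 1); have e'0 : 0 < e' by rewrite divr_gt0.
have [d d0 Hd] : exists2 d, 0 < d & forall y, `|x - y| < d -> D y /\
    forall i, `|'D_(e_ i) F x - 'D_(e_ i) F y| <= e'.
  have /nbhs_ballP[d /= d0 Hd] : \forall y \near x, D y /\
      forall i, `|'D_(e_ i) F x - 'D_(e_ i) F y| <= e'.
    apply: filterI; first exact: open_nbhs_nbhs.
    apply: (@filter_forall _ _ (fun i y => `|'D_(e_ i) F x - 'D_(e_ i) F y| <= e') (nbhs x) (nbhs_filter x)) => i.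
    exact: ((@cvgrPdist_le _ _ _ (nbhs x) (nbhs_filter x) _ _).1 (cF (e_ i)) _ e'0).
  by exists d => // y /ball_normP/Hd.
exists d => // h hd.
(* The vector h with all but its first k coordinates set to 0: the corners of the path from x to x +
   h. *)
pose hh (k : nat) : 'rV[R]_n := \row_i (if (i < k)%N then h 0 i else 0).
have hhS (k : 'I_n) : hh k.+1 = hh k + h 0 k *: e_ k.
  apply/rowP => i; rewrite !mxE eqxx /= ltnS leq_eqVlt.
  have [->|ik] := eqVneq i k; first by rewrite eqxx ltnn add0r mulr1.
  by rewrite (_ : (i == k :> nat) = false) ?mulr0 ?addr0//; apply/negbTE.
have hle k : `|hh k| <= `|h|.
  by apply: mx_norm_leP => // a b; rewrite mxE; case: ifP => _; rewrite ?normr0// ler_mx_coord.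
have step (k : 'I_n) : `|F (x + hh k.+1) - F (x + hh k) - q 0 k * h 0 k| <= e' * `|h|.
  have inD s : `|s| <= `|h 0 k| -> `|x - (x + hh k + s *: e_ k)| < d.
    move=> sh; apply: le_lt_trans hd; rewrite -addrA opprD addrA subrr sub0r normrN.
    apply: mx_norm_leP => // a b; rewrite !mxE (ord1 a) eqxx/=.
    have [->|bk] := eqVneq b k.
      by rewrite ltnn add0r mulr1 (le_trans sh)// ler_mx_coord.
    by rewrite mulr0 addr0; case: ifP => _; rewrite ?normr0// ler_mx_coord.
  have := @increment_le (fun s => F (x + hh k + s *: e_ k) - q 0 k * s)
     (fun s => 'D_(e_ k) F (x + hh k + s *: e_ k) - q 0 k) (h 0 k) e' _ _.
  rewrite mulr0 subr0 scale0r addr0 hhS addrA => H.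
  rewrite [X in `|X|]addrAC; apply: le_trans (H _ _) _.
  - move=> s /inD/Hd[Ds _]; apply: is_deriveB.
      by apply: derive_line; exact: dF.
    have : is_derive s 1 (q 0 k *: (id : R -> R)) (q 0 k *: 1) by exact: is_deriveZ.
    by rewrite scaler1.
  - by move=> s /inD/Hd[_ /(_ k)]; rewrite distrC mxE.
  - by rewrite ler_wpM2l ?ler_mx_coord// ltW.
have tel k : (k <= n)%N -> `|F (x + hh k) - F x - dot q (hh k)| <= k%:R * (e' * `|h|).
  elim: k => [_|k IH kn].
    have -> : hh 0 = 0 by apply/rowP => i; rewrite !mxE.
    by rewrite addr0 subrr linear0 subrr normr0 mul0r.
  have h2 := step (Ordinal kn); have h1 := IH (ltnW kn).
  have E : dot q (hh k.+1) = dot q (hh k) + q 0 (Ordinal kn) * h 0 (Ordinal kn).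
    by rewrite (hhS (Ordinal kn)) dotDr dotZr dot_delta mulrC.
  rewrite E (_ : F (x + hh k.+1) - _ - _ = (F (x + hh k) - F x - dot q (hh k)) +
     (F (x + hh k.+1) - F (x + hh k) - q 0 (Ordinal kn) * h 0 (Ordinal kn))).
    by rewrite -natr1 mulrDl mul1r (le_trans (ler_normD _ _))// lerD.
  by rewrite opprD; ring.
have := tel n (leqnn n).
have -> : hh n = h by apply/rowP => i; rewrite mxE ltn_ord.
rewrite (addrC x) => /le_trans; apply.
rewrite mulrA ler_wpM2r// /e' mulrCA -[leRHS]mulr1 ler_wpM2l ?(ltW e0)//.
by rewrite ler_pdivrMr// mul1r lerDl.
Qed.

Lemma differentiable_mx n (f : 'rV[R]_n -> 'rV[R]_n) x :
  (forall j, differentiable (fun y => f y 0 j) x) -> differentiable f x.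
Proof.
move=> H.
have -> : f = \sum_j (fun y => f y 0 j *: (delta_mx 0 j : 'rV[R]_n)).
  apply/funext => y; rewrite fct_sumE {1}[f y]matrix_sum_delta big_ord1.
  by apply: eq_bigr.
by apply: differentiable_sum => j; exact: differentiableZl.
Qed.

(** [smooth_on] speaks of directional derivatives only, whereas the chain rule for changes of charts
    needs a differential. *)
Lemma smooth_differentiable n (D : set 'rV[R]_n) (f : 'rV[R]_n -> 'rV[R]_n) x :
  open D -> D x -> smooth_on D f -> differentiable f x.
Proof.
move=> oD Dx sf; apply: differentiable_mx => j.
have df y v : D y -> derivable f y v by move=> Dy; have [_] := sf [::] y Dy; exact.
have dfj y v : D y -> derivable (fun y => f y 0 j) y v.
  by move=> Dy; have /derivable_mxP := df y v Dy; exact.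
apply: (C1_differentiable oD Dx) => //.
move=> v; have [/= cv _] := sf [:: v] x Dx.
have E : \forall y \near x, 'D_v (fun y => f y 0 j) y = ('D_v f y) 0 j.
  have : nbhs x D by exact: open_nbhs_nbhs.
  by apply: filterS => y Dy; rewrite (derive_mx (df _ _ Dy)) mxE.
have E' : {near x, (fun y => ('D_v f y) 0 j) =1 'D_v (fun y => f y 0 j)} by apply: filterS E.
apply: cvg_trans (near_eq_cvg E') _.
rewrite (nbhs_singleton E).
exact: (cvg_comp _ _ cv (@coord_continuous _ _ _ 0 j _)).
Qed.

Lemma near_eq_is_diff (V W : normedModType R) (f g : V -> W) (x : V) (df : {linear V -> W}) :
  (\forall y \near x, f y = g y) -> is_diff x f df -> is_diff x g df.
Proof.
move=> E [Df dfE]; apply: is_diff_eps.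
  by rewrite -dfE; exact: diff_continuous.
move=> e e0; have H := differentiable_eps Df e0.
have E' : \forall h \near (0 : V), f (h + x) = g (h + x).
  by move: E; rewrite (near_shift 0 x); apply: filterS => h; rewrite /= subr0.
near=> h.
rewrite -(near E' h)// -(nbhs_singleton E) -dfE; near: h; exact: H.
Unshelve. all: by end_near. Qed.

End C1.

Lemma posdef_unitmx (R : realType) n (G : 'M[R]_n) :
  (forall v : 'rV[R]_n, v != 0 -> 0 < (v *m G *m v^T) 0 0) -> G \in unitmx.
Proof.
move=> H; rewrite -row_free_unit -kermx_eq0; apply/rowV0P => v /sub_kermxP vG.
by apply/eqP; apply: contraT => /H; rewrite vG mul0mx mxE ltxx.
Qed.

Lemma invmx_mulmx (R : comUnitRingType) n (A B : 'M[R]_n) : A \in unitmx -> B \in unitmx ->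
  invmx (A *m B) = invmx B *m invmx A.
Proof.
move=> uA uB; have uAB : A *m B \in unitmx by rewrite unitmx_mul uA.
apply: (can_inj (mulKmx uAB)); rewrite mulmxV// mulmxA -(mulmxA A) mulmxV//.
by rewrite mulmx1 mulmxV.
Qed.

Section Charts.
Context {R : realType} {n : nat} {M : ptopologicalType} (g : riemannian_manifold R n M).
Implicit Types (i j : rm_index g) (x : M) (u w : M -> R).

Definition cod i : set 'rV[R]_n := rm_coord i @` rm_dom i.

Lemma cod_coord i x : rm_dom i x -> cod i (rm_coord i x).
Proof. by exists x. Qed.

Lemma dom_param i y : cod i y -> rm_dom i (rm_param i y).
Proof. by move=> [x xi <-]; rewrite rm_coordK. Qed.

Lemma paramK i y : cod i y -> rm_coord i (rm_param i y) = y.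
Proof. by move=> [x xi <-]; rewrite rm_coordK. Qed.

Lemma overlapE i j : rm_coord i @` (rm_dom i `&` rm_dom j) = [set y | cod i y /\ rm_dom j (rm_param i y)].
Proof.
apply/seteqP; split => [_ [x [xi xj] <-]|y [yi yj]] /=.
  by split; [exact: cod_coord|rewrite rm_coordK].
by exists (rm_param i y); [split => //; exact: dom_param|exact: paramK].
Qed.

Lemma open_overlap i j : open (rm_coord i @` (rm_dom i `&` rm_dom j)).
Proof.
rewrite overlapE openE => y [yi yj].
have h1 : nbhs y (cod i) by apply: open_nbhs_nbhs; split => //; exact: rm_cod_open.
have h2 : nbhs (rm_param i y) (rm_dom j) by apply: open_nbhs_nbhs; split => //; exact: rm_dom_open.
have h3 := @rm_param_continuous _ _ _ g i y yi _ h2.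
by apply: filterS2 h1 h3 => z.
Qed.

Definition transition i j := rm_coord j \o rm_param i.

Lemma transition_differentiable i j x : rm_dom i x -> rm_dom j x ->
  differentiable (transition i j) (rm_coord i x).
Proof.
move=> xi xj; apply: (smooth_differentiable (@open_overlap i j) _ (@rm_transition_smooth _ _ _ g i j)).
by exists x.
Qed.

Definition lrep i u : 'rV[R]_n -> R := u \o rm_param i.

Lemma lrep_is_diff i j u x : rm_dom i x -> rm_dom j x ->
  differentiable (lrep j u) (rm_coord j x) ->
  is_diff (rm_coord i x) (lrep i u)
    ('d (lrep j u) (rm_coord j x) \o 'd (transition i j) (rm_coord i x)).
Proof.
move=> xi xj du.
have dt := transition_differentiable xi xj.
have E : transition i j (rm_coord i x) = rm_coord j x by rewrite /transition /= rm_coordK.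
apply: (near_eq_is_diff (f := lrep j u \o transition i j)).
  have : nbhs (rm_coord i x) (rm_coord i @` (rm_dom i `&` rm_dom j)).
    by apply: open_nbhs_nbhs; split; [exact: open_overlap|exists x].
  by apply: filterS => _ [z [zi zj] <-]; rewrite /lrep /transition /= rm_coordK// rm_coordK.
rewrite -E in du *; split; first exact: differentiable_comp.
by rewrite diff_comp.
Qed.

(** The components of du in a chart i that is free, unlike the one used by [grad]; this makes a
    transformation law expressible. The value 0 where u is not differentiable is compatible with
    that law. *)
Definition cograd i u x : 'rV[R]_n :=
  if `[< differentiable (lrep i u) (rm_coord i x) >]
  then \row_k 'D_(delta_mx 0 k) (lrep i u) (rm_coord i x) else 0.

Lemma differentiable_chart i j u x : rm_dom i x -> rm_dom j x ->
  differentiable (lrep j u) (rm_coord j x) -> differentiable (lrep i u) (rm_coord i x).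
Proof. by move=> xi xj du; have [] := lrep_is_diff xi xj du. Qed.

Lemma dot_cograd i u x h : differentiable (lrep i u) (rm_coord i x) ->
  dot (cograd i u x) h = 'd (lrep i u) (rm_coord i x) h.
Proof.
move=> du; rewrite /cograd asboolT//.
rewrite {2}[h]matrix_sum_delta big_ord1 linear_sum/= dotE.
by apply: eq_bigr => k _; rewrite linearZ/= mxE deriveE// mulrC.
Qed.

Lemma dot_inj (q q' : 'rV[R]_n) : (forall h, dot q h = dot q' h) -> q = q'.
Proof. by move=> H; apply/rowP => k; rewrite -!dot_delta. Qed.

Lemma cograd_change i j u x : rm_dom i x -> rm_dom j x ->
  cograd i u x = cograd j u x *m (jacobian (transition i j) (rm_coord i x))^T.
Proof.
move=> xi xj; have [du|ndu] := pselect (differentiable (lrep j u) (rm_coord j x)).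
  apply: dot_inj => h.
  have [du' dE] := lrep_is_diff xi xj du.
  rewrite dot_cograd// dE/= -dot_cograd// /dot -mulmxA -trmx_mul /jacobian mul_rV_lin1//.
have ndu' : ~ differentiable (lrep i u) (rm_coord i x).
  by apply: contra_not ndu; exact: differentiable_chart.
by rewrite /cograd (asboolF ndu) (asboolF ndu') mul0mx.
Qed.

(** The dual metric applied to du and dw. Being independent of the chart, it allows <grad u, grad w>
    to be computed in one fixed chart around a point, while [rm_chart_at] may jump arbitrarily from
    point to point. *)
Definition pairing i u w x : R :=
  (cograd i u x *m invmx (rm_metric i (rm_coord i x)) *m (cograd i w x)^T) 0 0.

Lemma metric_unitmx i x : rm_dom i x -> rm_metric i (rm_coord i x) \in unitmx.
Proof. by move=> xi; apply: posdef_unitmx; apply: rm_metric_pos; exact: cod_coord. Qed.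

Lemma pairing_change i j u w x : rm_dom i x -> rm_dom j x -> pairing i u w x = pairing j u w x.
Proof.
move=> xi xj; rewrite /pairing (cograd_change u xi xj) (cograd_change w xi xj).
have gE := rm_metric_change xi xj.
have ui := metric_unitmx xi; have uj := metric_unitmx xj.
move: gE ui; rewrite /= -/(transition i j).
set J := jacobian _ _ => gE ui.
have uJ : J \in unitmx.
  by move: ui; rewrite gE unitmx_mul => /andP[]; rewrite unitmx_mul => /andP[].
have uJT : J^T \in unitmx by rewrite unitmx_tr.
rewrite gE !invmx_mulmx ?unitmx_mul ?uJ ?uj// trmx_mul trmxK !mulmxA.
by rewrite -(mulmxA _ J^T) mulmxV// mulmx1 -(mulmxA _ (invmx J)) mulVmx// mulmx1.
Qed.

Lemma inner_gradE i u w x : rm_dom i x ->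
  inner g x (grad g u x) (grad g w x) = pairing i u w x.
Proof.
move=> xi; rewrite (@pairing_change i (rm_chart_at g x))//; last exact: rm_chart_atP.
rewrite /inner /pairing; set k := rm_chart_at g x.
have uk : rm_metric k (rm_coord k x) \in unitmx by apply: metric_unitmx; exact: rm_chart_atP.
have gradE v : grad g v x = cograd k v x *m invmx (rm_metric k (rm_coord k x)).
  by rewrite /grad /cograd -/k /lrep; case: asboolP => // _; rewrite mul0mx.
rewrite !gradE trmx_mul trmx_inv rm_metric_sym; last by apply: cod_coord; exact: rm_chart_atP.
by rewrite !mulmxA -(mulmxA _ (invmx _) (rm_metric _ _)) mulVmx// mulmx1.
Qed.

Section Calculus.
Implicit Types (v : 'rV[R]_n).

Definition diffat u x := differentiable (lrep (rm_chart_at g x) u) (rm_coord (rm_chart_at g x) x).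

Lemma grad_cograd u x : grad g u x =
  cograd (rm_chart_at g x) u x *m invmx (rm_metric (rm_chart_at g x) (rm_coord (rm_chart_at g x) x)).
Proof. by rewrite /grad /cograd /lrep; case: asboolP => // _; rewrite mul0mx. Qed.

Lemma lrep_coord i u x : rm_dom i x -> lrep i u (rm_coord i x) = u x.
Proof. by move=> xi; rewrite /lrep /= rm_coordK. Qed.

Lemma diffatM u w x : diffat u x -> diffat w x -> diffat (u \* w) x.
Proof. exact: differentiableM. Qed.

Lemma grad_mul u w x : diffat u x -> diffat w x ->
  grad g (u \* w) x = u x *: grad g w x + w x *: grad g u x.
Proof.
move=> du dw; rewrite !grad_cograd !scalemxAl -mulmxDl; congr (_ *m _).
have xi := rm_chart_atP g x; set i := rm_chart_at g x in xi *.
have duw : differentiable (lrep i (u \* w)) (rm_coord i x) by exact: differentiableM.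
apply: dot_inj => h; rewrite dot_cograd//.
rewrite (_ : lrep i (u \* w) = lrep i u * lrep i w)// diffM//.
rewrite dotDl !dotZl !dot_cograd//.
by rewrite !fctE !lrep_coord.
Qed.

Lemma diffat_comp (h : R -> R) u x : derivable h (u x) 1 -> diffat u x -> diffat (h \o u) x.
Proof.
move=> /derivable1_diffP dh du; apply: (@differentiable_comp _ _ _ _ (lrep _ u) h) => //.
by rewrite lrep_coord//; exact: rm_chart_atP.
Qed.

Lemma grad_comp (h : R -> R) u x : derivable h (u x) 1 -> diffat u x ->
  grad g (h \o u) x = derive1 h (u x) *: grad g u x.
Proof.
move=> dh du; rewrite !grad_cograd !scalemxAl; congr (_ *m _).
have xi := rm_chart_atP g x; set i := rm_chart_at g x in xi *.
have dhu : differentiable (lrep i (h \o u)) (rm_coord i x) by exact: diffat_comp.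
have dh' : differentiable h (lrep i u (rm_coord i x)) by rewrite lrep_coord//; exact/derivable1_diffP.
apply: dot_inj => v; rewrite dot_cograd//.
rewrite (_ : lrep i (h \o u) = h \o lrep i u)// diff_comp//=.
rewrite dotZl dot_cograd// lrep_coord//.
rewrite -[X in 'd h _ X]mulr1 -[_ * 1]/(_ *: (1 : R)) linearZ/= derive1E deriveE ?lrep_coord//.
  by rewrite mulrC.
exact/derivable1_diffP.
Qed.

Lemma diffat_lin (c d : R) u w x : diffat u x -> diffat w x ->
  diffat (fun z => c * u z + d * w z) x.
Proof.
move=> du dw; apply: (@differentiableD _ _ _ (fun z => c * lrep _ u z) (fun z => d * lrep _ w z)).
  exact: (differentiableZ _ du).
exact: (differentiableZ _ dw).
Qed.

Lemma grad_lin (c d : R) u w x : diffat u x -> diffat w x ->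
  grad g (fun z => c * u z + d * w z) x = c *: grad g u x + d *: grad g w x.
Proof.
move=> du dw; rewrite !grad_cograd !scalemxAl -mulmxDl; congr (_ *m _).
have xi := rm_chart_atP g x; set i := rm_chart_at g x in xi *.
have duw : differentiable (lrep i (fun z => c * u z + d * w z)) (rm_coord i x) by exact: diffat_lin.
apply: dot_inj => h; rewrite dot_cograd//.
rewrite (_ : lrep i _ = c *: lrep i u + d *: lrep i w)// diffD ?diffZ//; try exact: differentiableZ.
by rewrite dotDl !dotZl !dot_cograd.
Qed.

(** At a minimum the differential is nonnegative in every direction, hence zero, and without
    differentiability the gradient is 0 by convention. The result thus holds at every zero of u,
    with no exceptional set, and gives the vanishing of gradients off supports. *)
Lemma grad_min0 u x : (forall y, 0 <= u y) -> u x = 0 -> grad g u x = 0.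
Proof.
move=> u0 ux; rewrite grad_cograd.
suff -> : cograd (rm_chart_at g x) u x = 0 by rewrite mul0mx.
have xi := rm_chart_atP g x; set i := rm_chart_at g x in xi *.
have [du|ndu] := pselect (differentiable (lrep i u) (rm_coord i x)); last first.
  by rewrite /cograd asboolF.
apply: dot_inj => h; rewrite dot_cograd// [RHS]/dot mul0mx mxE.
have pos h' : 0 <= 'd (lrep i u) (rm_coord i x) h'.
  rewrite leNgt; apply/negP => neg.
  have h1 : 0 < `|h'| + 1 by rewrite ltr_wpDl.
  (* Small enough that the error e |h'| stays below the assumed drop of the differential, so that u
     would become negative. *)
  pose e := - 'd (lrep i u) (rm_coord i x) h' / (2 * (`|h'| + 1)).
  have e0 : 0 < e by rewrite divr_gt0 ?oppr_gt0// mulr_gt0.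
  have [d d0 Hd] := (near0P _).1 (differentiable_eps du e0).
  pose t := d / (`|h'| + 1) / 2; have t0 : 0 < t by rewrite !divr_gt0.
  have th : `|t *: h'| < d.
    rewrite normrZ gtr0_norm//; apply: (@le_lt_trans _ _ (d / 2)).
      rewrite /t mulrAC ler_pM2r// mulrAC ler_pdivrMr// ler_pM2l//; lra.
    by rewrite ltr_pdivrMr// ltr_pMr// ltr1n.
  have := Hd _ th; rewrite lrep_coord// ux subr0 linearZ/= normrZ gtr0_norm// => H.
  have := le_trans (ler_norm _) H; rewrite lerBlDl leNgt => /negP; apply.
  apply: (@lt_le_trans _ _ 0); last exact: u0.
  rewrite /GRing.scale/= mulrCA -mulrDr pmulr_rlt0//.
  have : e * `|h'| < - 'd (lrep i u) (rm_coord i x) h'.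
    rewrite /e mulrAC ltr_pdivrMr ?mulr_gt0// ltr_pM2l ?oppr_gt0//; lra.
  by rewrite ltrNr -subr_lt0 opprK addrC.
apply/le_anti; rewrite pos andbT -oppr_ge0 -linearN; exact: pos.
Qed.

Lemma innerC x v (w : 'rV[R]_n) : inner g x v w = inner g x w v.
Proof.
rewrite /inner; set G := rm_metric _ _.
have GT : G^T = G by apply: rm_metric_sym; apply: cod_coord; exact: rm_chart_atP.
have <- : (w *m G *m v^T)^T = v *m G *m w^T by rewrite !trmx_mul trmxK GT mulmxA.
by rewrite mxE.
Qed.

Lemma innerDl x v v' (w : 'rV[R]_n) : inner g x (v + v') w = inner g x v w + inner g x v' w.
Proof. by rewrite /inner !mulmxDl mxE. Qed.

Lemma innerZl x c v (w : 'rV[R]_n) : inner g x (c *: v) w = c * inner g x v w.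
Proof. by rewrite /inner -!scalemxAl mxE. Qed.

Lemma innerDr x v (w w' : 'rV[R]_n) : inner g x v (w + w') = inner g x v w + inner g x v w'.
Proof. by rewrite innerC innerDl !(innerC x v). Qed.

Lemma innerZr x c v (w : 'rV[R]_n) : inner g x v (c *: w) = c * inner g x v w.
Proof. by rewrite innerC innerZl innerC. Qed.

Lemma inner_ge0 x v : 0 <= inner g x v v.
Proof.
have [->|v0] := eqVneq v 0; first by rewrite /inner !mul0mx mxE.
by apply/ltW/rm_metric_pos => //; apply: cod_coord; exact: rm_chart_atP.
Qed.

Lemma inner0l x v : inner g x 0 v = 0.
Proof. by rewrite /inner !mul0mx mxE. Qed.

End Calculus.

End Charts.

(** * Lengths of curves *)

Section UnitInterval.
Context {R : realType}.
Local Notation lam := (@lebesgue_measure R).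

(** Compactness of [0, 1] as an induction principle: the supremum of the points t with P 0 t is
    attained and equals 1, since the local hypothesis reaches across it from both sides. It serves
    for mean value estimates and, with P an implication, for Hopf-Rinow. *)
Lemma cousin (P : R -> R -> Prop) :
  (forall a b c, P a b -> P b c -> P a c) ->
  (forall t : R, 0 <= t <= 1 -> exists2 d : R, 0 < d &
     forall a b : R, 0 <= a -> a <= t -> t <= b -> b <= 1 -> b - a < d -> P a b) ->
  P 0 1.
Proof.
move=> tr loc.
pose S := [set t : R | 0 <= t <= 1 /\ P 0 t].
have S0 : S 0.
  split; first by rewrite lexx ler01.
  have [|d d0 Hd] := loc 0; first by rewrite lexx ler01.
  by apply: Hd; rewrite ?lexx ?ler01// subrr.
have ubS : ubound S 1 by move=> t [/andP[]].
have hS : has_sup S by split; [exists 0|exists 1].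
set s := sup S.
have s0 : 0 <= s by apply: ub_le_sup => //; exists 1.
have s1 : s <= 1 by apply: ge_sup => //; exists 0.
have [|d d0 Hd] := loc s; first by rewrite s0.
have d2 : 0 < d / 2 by rewrite divr_gt0.
have [a Sa sa] := sup_adherent d2 hS.
have as_ : a <= s by apply: ub_le_sup => //; exists 1.
have [/andP[a0 a1] P0a] := Sa.
pose b := Num.min 1 (s + d / 2).
have sb : s <= b by rewrite le_min s1 lerDl ltW.
have b1 : b <= 1 by rewrite ge_min lexx.
have P0b : P 0 b.
  apply: tr P0a (Hd a b a0 as_ sb b1 _).
  have : b <= s + d / 2 by rewrite ge_min lexx orbT.
  move: sa; rewrite -/s; lra.
have Sb : S b by split=> //; rewrite (le_trans s0 sb).
have bs : b <= s by apply: ub_le_sup => //; exists 1.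
move: bs P0b; rewrite /b ge_min => /orP[h|]; last by rewrite gerDl leNgt d2.
by rewrite /b min_l// (le_trans h)// lerDl ltW.
Qed.

(* Differentiability with free endpoints on both sides of t: unlike [derivable]
   it makes sense at 0 and 1 without extending Phi beyond [0, 1]. *)
Definition strict_deriv (Phi k : R -> R) := forall t : R, 0 <= t <= 1 -> forall e : R, 0 < e ->
  exists2 d : R, 0 < d & forall a b : R, 0 <= a -> a <= t -> t <= b -> b <= 1 -> b - a < d ->
    `|Phi b - Phi a - k t * (b - a)| <= e * (b - a).

(** A mean value inequality in which h need not be differentiable: it will be a bump function
    composed with an arc. *)
Lemma growth_le (h K k : R -> R) : strict_deriv K k ->
  (forall t : R, 0 <= t <= 1 -> forall e : R, 0 < e -> exists2 d : R, 0 < d &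
     forall s : R, 0 <= s <= 1 -> `|s - t| < d -> `|h s - h t| <= (k t + e) * `|s - t|) ->
  `|h 1 - h 0| <= K 1 - K 0.
Proof.
move=> sK sh; apply/ler_addgt0Pr => e e0.
have e2 : 0 < e / 2 by rewrite divr_gt0.
suff : `|h 1 - h 0| <= K 1 - K 0 + e * (1 - 0) by rewrite subr0 mulr1.
apply: (@cousin (fun a b => `|h b - h a| <= K b - K a + e * (b - a))) => [a b c h1 h2|t t01].
  rewrite (_ : h c - h a = (h c - h b) + (h b - h a)); last ring.
  by apply: le_trans (ler_normD _ _) _; lra.
have [d d0 Hd] := sK t t01 _ e2; have [d' d'0 Hd'] := sh t t01 _ e2.
exists (Num.min d d'); first by rewrite lt_min d0.
move=> a b a0 at_ tb b1; rewrite lt_min => /andP[bad bad'].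
have /andP[t0 t1] := t01.
have := Hd a b a0 at_ tb b1 bad; rewrite ler_norml => /andP[h1 _].
have h2 : `|h b - h t| <= (k t + e / 2) * (b - t).
  have := Hd' b; rewrite ger0_norm ?subr_ge0//; apply; first by rewrite b1 (le_trans t0 tb).
  by apply: le_lt_trans bad'; rewrite lerD2l lerN2.
have h3 : `|h a - h t| <= (k t + e / 2) * (t - a).
  have := Hd' a; rewrite (distrC a t) ger0_norm ?subr_ge0//; apply; first by rewrite a0 (le_trans at_ t1).
  by apply: le_lt_trans bad'; rewrite lerD2r.
rewrite (_ : h b - h a = (h b - h t) - (h a - h t)); last ring.
apply: le_trans (ler_normB _ _) _; nra.
Qed.

Lemma strict_deriv_eq (Phi Psi k : R -> R) : strict_deriv Phi k -> strict_deriv Psi k ->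
  Phi 1 - Phi 0 = Psi 1 - Psi 0.
Proof.
move=> s1 s2; apply/eqP; rewrite -subr_eq0 -normr_le0; apply/ler_addgt0Pr => e e0.
have e2 : 0 < e / 2 by rewrite divr_gt0.
suff : `|Phi 1 - Phi 0 - (Psi 1 - Psi 0)| <= e * (1 - 0) by rewrite subr0 mulr1 add0r.
apply: (@cousin (fun a b => `|Phi b - Phi a - (Psi b - Psi a)| <= e * (b - a))) => [a b c h1 h2|t t01].
  rewrite (_ : Phi c - Phi a - (Psi c - Psi a) = (Phi c - Phi b - (Psi c - Psi b)) +
    (Phi b - Phi a - (Psi b - Psi a))); last ring.
  by apply: le_trans (ler_normD _ _) _; lra.
have [d d0 Hd] := s1 t t01 _ e2; have [d' d'0 Hd'] := s2 t t01 _ e2.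
exists (Num.min d d'); first by rewrite lt_min d0.
move=> a b a0 at_ tb b1; rewrite lt_min => /andP[bad bad'].
have h1 := Hd a b a0 at_ tb b1 bad; have h2 := Hd' a b a0 at_ tb b1 bad'.
rewrite (_ : Phi b - Phi a - (Psi b - Psi a) = (Phi b - Phi a - k t * (b - a)) -
  (Psi b - Psi a - k t * (b - a))); last ring.
by apply: le_trans (ler_normB _ _) _; lra.
Qed.

Lemma within_continuousP (V : normedModType R) (k : R -> V) : {within `[0%R, 1%R], continuous k} ->
  forall t : R, 0 <= t <= 1 -> forall e : R, 0 < e -> exists2 d : R, 0 < d &
    forall s : R, 0 <= s <= 1 -> `|s - t| < d -> `|k s - k t| <= e.
Proof.
move=> ck t t01 e e0.
have tI : `[0%R, 1%R]%classic t by rewrite /= in_itv.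
have := ck t; rewrite /prop_for /continuous_at => /cvgrPdist_le/(_ e e0) H.
have : within `[0%R, 1%R] (nbhs t) [set s | `|k t - k s| <= e].
  by rewrite (nbhs_subspace_in tI); exact: H.
move=> /nbhs_ballP[d /= d0 Hd].
exists d => // s s01 sd; rewrite distrC; apply: Hd; last by rewrite /= in_itv.
by apply/ball_normP; rewrite distrC.
Qed.

Lemma eps_within_continuous (V : normedModType R) (k : R -> V) :
  (forall t : R, 0 <= t <= 1 -> forall e : R, 0 < e -> exists2 d : R, 0 < d &
    forall s : R, 0 <= s <= 1 -> `|s - t| < d -> `|k s - k t| <= e) ->
  {within `[0%R, 1%R], continuous k}.
Proof.
move=> H; apply/subspace_continuousP => t; rewrite /= in_itv/= => t01.
apply/cvgrPdist_le => e e0; have [d d0 Hd] := H t t01 e e0.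
apply/nbhs_ballP; exists d => // s /ball_normP /= sd; rewrite in_itv/= => s01.
by rewrite distrC; apply: Hd; rewrite // distrC.
Qed.

Definition prim (k : R -> R) t := \int[lam]_(s in `[0%R, t]) k s.

Lemma prim_strict_deriv (k : R -> R) : {within `[0%R, 1%R], continuous k} ->
  strict_deriv (prim k) k.
Proof.
move=> ck t t01 e e0.
have ik : lam.-integrable `[0%R, 1%R] (EFin \o k).
  by apply: continuous_compact_integrable => //; exact: segment_compact.
have [d d0 Hd] := within_continuousP ck t01 e0.
exists d => // a b a0 at_ tb b1 bad.
have ab : a <= b by exact: le_trans tb.
have ikab : lam.-integrable `]a, b] (EFin \o k).
  have sub : `]a, b]%classic `<=` `[0%R, 1%R]%classic.
    move=> x /=; rewrite !in_itv/= => /andP[ax xb].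
    by rewrite (le_trans a0 (ltW ax)) (le_trans xb b1).
  by apply: integrableS ik => //; exact: measurable_itv.
rewrite /prim Rintegral_itvB ?bnd_simp//; last first.
  have sub : `[0%R, b]%classic `<=` `[0%R, 1%R]%classic.
    by move=> x /=; rewrite !in_itv/= => /andP[-> xb]; rewrite (le_trans xb b1).
  by apply: integrableS ik => //; exact: measurable_itv.
have mab : lam (`]a, b]%classic : set R) = (b - a)%:E.
  rewrite lebesgue_measure_itv/= lte_fin; case: ltP => // ba.
  by have -> : a = b by [apply/le_anti; rewrite ab ba]; rewrite subrr.
have icst c : lam.-integrable (`]a, b]%classic : set R) (EFin \o cst c).
  have icc : lam.-integrable `[0%R, 1%R] (EFin \o cst c).
    apply: continuous_compact_integrable; first exact: segment_compact.
    by apply: continuous_subspaceT; exact: cst_continuous.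
  apply: integrableS icc => //.
  move=> x /=; rewrite !in_itv/= => /andP[ax xb].
  by rewrite (le_trans a0 (ltW ax)) (le_trans xb b1).
have cstE c : \int[lam]_(s in `]a, b]) c = c * (b - a).
  by rewrite Rintegral_cst//; move: mab => /= ->.
have iB : lam.-integrable `]a, b] (EFin \o (fun s => k s - k t)).
  exact: (integrableB _ ikab (icst (k t))).
rewrite -(cstE (k t)) -RintegralB//; last exact: icst.
apply: le_trans (le_normr_Rintegral _ _) _ => //.
rewrite -(cstE e); apply: le_Rintegral => //.
- exact: integrable_norm.
- exact: icst.
- move=> x /=; rewrite in_itv/= => /andP[ax xb]; apply: Hd.
    by rewrite (le_trans a0 (ltW ax)) (le_trans xb b1).
  by apply: le_lt_trans bad; rewrite ler_norml; lra.
Qed.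

(** Any strict primitive computes the integral. Arc lengths of restricted and reversed arcs follow
    from it without a change of variables. *)
Lemma Rintegral_strict_deriv (Phi k : R -> R) : {within `[0%R, 1%R], continuous k} ->
  strict_deriv Phi k -> \int[lam]_(s in `[0%R, 1%R]) k s = Phi 1 - Phi 0.
Proof.
move=> ck sk; rewrite -(strict_deriv_eq (prim_strict_deriv ck) sk).
by rewrite /prim set_itv1 Rintegral_set1 subr0.
Qed.

Lemma cvg_quadratic (T : Type) (F : set_system T) n (v : T -> 'rV[R]_n) (G : T -> 'M[R]_n)
  (v0 : 'rV[R]_n) (G0 : 'M[R]_n) : Filter F -> v @ F --> v0 -> G @ F --> G0 ->
  (v t *m G t *m (v t)^T) 0 0 @[t --> F] --> (v0 *m G0 *m v0^T) 0 0.
Proof.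
move=> FF cv cG.
have cvj j : v t 0 j @[t --> F] --> v0 0 j.
  exact: (cvg_comp _ _ cv (@coord_continuous _ _ _ 0 j v0)).
have cGj i j : G t i j @[t --> F] --> G0 i j.
  exact: (cvg_comp _ _ cG (@coord_continuous _ _ _ i j G0)).
under eq_fun do rewrite mxE.
rewrite mxE; apply: cvg_big => [|j _]; first exact: add_continuous.
under eq_fun do rewrite !mxE.
rewrite !mxE; apply: cvgM => //.
by apply: cvg_big => [|i _]; [exact: add_continuous|apply: cvgM].
Qed.

End UnitInterval.

Section StrictDeriv.
Context {R : realType}.

Lemma strict_deriv_affine (K k : R -> R) (a b : R) : 0 <= a -> 0 <= b -> a + b <= 1 ->
  strict_deriv K k -> strict_deriv (fun t => K (a + t * b)) (fun t => b * k (a + t * b)).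
Proof.
move=> a0 b0 ab1 sK t /andP[t0 t1] e e0.
have in01 s : 0 <= s -> s <= 1 -> 0 <= a + s * b <= 1 by move=> s0 s1; nra.
(* [b + 1] instead of b, which may be 0. *)
have b1 : 0 < b + 1 by rewrite ltr_wpDl.
have [d d0 Hd] := sK _ (in01 t t0 t1) _ (divr_gt0 e0 b1).
exists (d / (b + 1)); first by rewrite divr_gt0.
move=> s s' s0 st ts' s'1; rewrite ltr_pdivlMr// => ss'.
have h := Hd (a + s * b) (a + s' * b).
rewrite (_ : a + s' * b - (a + s * b) = b * (s' - s)) in h; last ring.
have ss'0 : 0 <= s' - s by rewrite subr_ge0 (le_trans st).
rewrite mulrAC (mulrC (b * _)).
apply: le_trans (h _ _ _ _ _) _.
- by have /andP[] := in01 s s0 (le_trans st t1).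
- by rewrite lerD2l ler_wpM2r.
- by rewrite lerD2l ler_wpM2r.
- by have /andP[] := in01 s' (le_trans t0 ts') s'1.
- by apply: le_lt_trans ss'; rewrite mulrC ler_wpM2l// lerDl.
rewrite mulrA ler_wpM2r// mulrAC ler_pdivrMr// ler_wpM2l ?(ltW e0)// lerDl//.
Qed.

Lemma strict_deriv_rev (K k : R -> R) :
  strict_deriv K k -> strict_deriv (fun t => - K (1 - t)) (fun t => k (1 - t)).
Proof.
move=> sK t /andP[t0 t1] e e0.
have [|d d0 Hd] := sK (1 - t) _ _ e0; first by lra.
exists d => // a b a0 at_ tb b1 bad.
have := Hd (1 - b) (1 - a).
rewrite (_ : 1 - a - (1 - b) = b - a); last ring.
by rewrite opprK [X in _ -> `|X - _| <= _]addrC; apply; lra.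
Qed.

Lemma eq_strict_deriv (K k k' : R -> R) : (forall t : R, 0 <= t <= 1 -> k t = k' t) ->
  strict_deriv K k -> strict_deriv K k'.
Proof. by move=> E H t t01 e /(H t t01 e)[d d0 Hd]; exists d => //; rewrite -E. Qed.

End StrictDeriv.

Section Arcs.
Context {R : realType} {n : nat} {M : ptopologicalType} (g : riemannian_manifold R n M).
Implicit Types (i j : rm_index g) (x y z : M) (c : R -> 'rV[R]_n).

Definition speed i c t := Num.sqrt ((derive1 c t *m rm_metric i (c t) *m (derive1 c t)^T) 0 0).

Definition is_arc i c := [/\ forall t : R, 0 <= t <= 1 -> cod i (c t),
  forall t : R, 0 <= t <= 1 -> derivable c t 1 & {within `[0%R, 1%R], continuous (derive1 c)}].

Lemma metric_continuous i (y : 'rV[R]_n) : cod i y -> {for y, continuous (rm_metric i)}.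
Proof. by move=> yi; have [] := @rm_metric_smooth _ _ _ g i [::] y yi. Qed.

Lemma speed_continuous i c : is_arc i c -> {within `[0%R, 1%R], continuous (speed i c)}.
Proof.
move=> [ci dc cc]; apply/subspace_continuousP => t tI.
have t01 : 0 <= t <= 1 by move: tI; rewrite /= in_itv.
have cvc' : derive1 c @ within `[0%R, 1%R] (nbhs t) --> derive1 c t.
  by move/subspace_continuousP: cc; exact.
have cvc : c @ within `[0%R, 1%R] (nbhs t) --> c t.
  apply: cvg_within_filter; apply: differentiable_continuous.
  exact/derivable1_diffP/dc.
have cvG : (rm_metric i \o c) @ within `[0%R, 1%R] (nbhs t) --> rm_metric i (c t).
  exact: (cvg_comp _ _ cvc (metric_continuous (ci t t01))).
have H := cvg_quadratic (within_filter _ (nbhs_filter t)) cvc' cvG.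
exact: (cvg_comp _ _ H (@sqrt_continuous R _)).
Qed.

Lemma arc_length_strict i c (Phi : R -> R) : is_arc i c -> strict_deriv Phi (speed i c) ->
  arc_length i c = Phi 1 - Phi 0 :> R.
Proof. by move=> ac sP; rewrite -(Rintegral_strict_deriv (speed_continuous ac) sP). Qed.


Lemma derivable_affine c (a b t : R) : derivable c (a + t * b) 1 ->
  is_derive t 1 (fun s : R => c (a + s * b)) (b *: derive1 c (a + t * b)).
Proof.
move=> /derivable1_diffP dc.
have := @derive_line _ _ _ c a b t (diff_derivable (v := b) dc).
have -> : 'D_b c (a + t * b) = b *: derive1 c (a + t * b) by rewrite deriveE// deriv1E//; exact/derivable1_diffP.
exact.
Qed.

Lemma speed_affine i c (a b t : R) : derivable c (a + t * b) 1 ->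
  speed i (fun s => c (a + s * b)) t = `|b| * speed i c (a + t * b).
Proof.
move=> /derivable_affine dc; rewrite /speed derive1E derive_val.
rewrite linearZ /= -!scalemxAl -scalemxAr scalerA mxE sqrtrM ?sqr_ge0//.
by rewrite -expr2 sqrtr_sqr.
Qed.

Lemma arc_affine i c (a b : R) : 0 <= a <= 1 -> 0 <= a + b <= 1 -> is_arc i c ->
  is_arc i (fun s => c (a + s * b)).
Proof.
move=> a01 ab01 [ci dc cc].
have in01 (t : R) : 0 <= t <= 1 -> 0 <= a + t * b <= 1 by move=> /andP[t0 t1]; nra.
split=> [t /in01/ci//|t /in01/dc/derivable_affine[]//|].
apply: eps_within_continuous => t t01 e e0.
have b1 : 0 < `|b| + 1 by rewrite ltr_wpDl.
have [d d0 Hd] := within_continuousP cc (in01 t t01) (divr_gt0 e0 b1).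
exists (d / (`|b| + 1)); first exact: divr_gt0.
move=> s s01 sd.
have E (r : R) : 0 <= r <= 1 -> derive1 (fun s => c (a + s * b)) r = b *: derive1 c (a + r * b).
  by move=> r01; rewrite [LHS]derive1E (derive_val (is_derive := derivable_affine (dc _ (in01 r r01)))).
rewrite !E// -scalerBr normrZ.
apply: (@le_trans _ _ (`|b| * (e / (`|b| + 1)))).
  rewrite ler_wpM2l//; apply: Hd; first exact: in01.
  rewrite opprD addrACA subrr add0r -mulrBl normrM; move: sd; rewrite ltr_pdivlMr// => /le_lt_trans; apply.
  by rewrite ler_wpM2l// lerDl.
by rewrite mulrCA -[leRHS]mulr1 ler_wpM2l ?(ltW e0)// ler_pdivrMr// mul1r lerDl.
Qed.

Lemma arc_length_ge0 i c : 0 <= arc_length i c.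
Proof. by apply: Rintegral_ge0 => t _; exact: sqrtr_ge0. Qed.

Lemma speed_ge0 i c t : 0 <= speed i c t.
Proof. exact: sqrtr_ge0. Qed.

Lemma arc_length_sub i c (a b : R) : 0 <= a -> 0 <= b -> a + b <= 1 -> is_arc i c ->
  arc_length i (fun s => c (a + s * b)) = prim (speed i c) (a + b) - prim (speed i c) a.
Proof.
move=> a0 b0 ab1 ac.
have a01 : 0 <= a <= 1 by rewrite a0 (le_trans _ ab1)// lerDl.
have ab01 : 0 <= a + b <= 1 by rewrite addr_ge0.
have sd := strict_deriv_affine a0 b0 ab1 (prim_strict_deriv (speed_continuous ac)).
have := arc_length_strict (arc_affine a01 ab01 ac) (Phi := fun t => prim (speed i c) (a + t * b)).
rewrite mul1r mul0r addr0; apply; apply: eq_strict_deriv sd => t /andP[t0 t1].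
rewrite speed_affine ?ger0_norm//; case: ac => _ dc _; apply: dc; nra.
Qed.

Lemma arc_length_rev i c : is_arc i c -> arc_length i (fun s => c (1 + s * (-1))) = arc_length i c.
Proof.
move=> ac.
have sd := strict_deriv_rev (prim_strict_deriv (speed_continuous ac)).
have ac' : is_arc i (fun s => c (1 + s * (-1))).
  by apply: arc_affine => //; rewrite ?subrr ?lexx ?ler01.
have := arc_length_strict ac' (Phi := fun t => - prim (speed i c) (1 - t)).
rewrite subrr subr0 /prim set_itv1 Rintegral_set1 oppr0 sub0r opprK; apply.
apply: eq_strict_deriv sd => t /andP[t0 t1].
rewrite speed_affine ?normrN1 ?mul1r ?mulrN1//; case: ac => _ dc _; apply: dc; lra.
Qed.

Local Notation curve := (piecewise_C1_curve g).

Lemma curve_arc i c y l : is_arc i c -> curve (rm_param i (c 1)) y l ->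
  curve (rm_param i (c 0)) y (arc_length i c + l).
Proof. by move=> [ci dc cc]; exact: curve_cons. Qed.

Lemma curve_ge0 x y l : curve x y l -> 0 <= l.
Proof. by elim=> // i c y' l' _ _ _ _ l0; rewrite addr_ge0// arc_length_ge0. Qed.

Lemma curve_cat x y z l l' : curve x y l -> curve y z l' -> curve x z (l + l').
Proof.
move=> cxy; elim: cxy l' z => [x' l' z|i c y' l1 ci dc cc _ IH l' z H]; first by rewrite add0r.
by rewrite -addrA; apply: curve_arc => //; exact: IH.
Qed.

Lemma curve1 i c : is_arc i c -> curve (rm_param i (c 0)) (rm_param i (c 1)) (arc_length i c).
Proof. by move=> ac; rewrite -[arc_length i c]addr0; apply: curve_arc => //; exact: curve_nil. Qed.

Lemma curve_rev x y l : curve x y l -> curve y x l.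
Proof.
elim=> [x'|i c y' l' ci dc cc _ IH]; first exact: curve_nil.
rewrite addrC; apply: curve_cat IH _.
have ac : is_arc i c by [].
have ac' : is_arc i (fun s => c (1 + s * (-1))).
  by apply: arc_affine => //; rewrite ?subrr ?lexx ?ler01.
have := curve1 ac'; rewrite arc_length_rev// mul0r addr0 mul1r subrr; exact.
Qed.

(** The curve is cut in the first arc on which its length reaches a, by the intermediate value
    theorem for the length. This replaces minimizing geodesics in the proof of Hopf-Rinow. *)
Lemma curve_split x y l a b : curve x y l -> 0 < a -> 0 < b -> l < a + b ->
  exists z l1 l2, [/\ curve x z l1, curve z y l2, l1 < a & l2 < b].
Proof.
move=> cxy; elim: cxy a b => [x' a b a0 b0 _|i c y' l' ci dc cc cl' IH a b a0 b0 lab].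
  by exists x', 0, 0; split => //; exact: curve_nil.
have ac : is_arc i c by [].
have l'0 := curve_ge0 cl'.
have [La|aL] := ltP (arc_length i c) a.
  have [||z [l1 [l2 [h1 h2 h3 h4]]]] := IH (a - arc_length i c) b _ b0.
  - by rewrite subr_gt0.
  - by rewrite addrAC ltrBrDl.
  exists z, (arc_length i c + l1), l2; split => //; first exact: curve_arc.
  by rewrite -ltrBrDl.
pose K := prim (speed i c).
have K0 : K 0 = 0 by rewrite /K /prim set_itv1 Rintegral_set1.
have K1 : K 1 = arc_length i c by [].
(* Giving up half of the slack a + b - l keeps v below a and the remaining length below b; a / 2
   keeps v positive. *)
pose v := Num.max (a / 2) (a - (a + b - (arc_length i c + l')) / 2).
have v0 : 0 < v by rewrite lt_max divr_gt0.
have va : v < a by rewrite gt_max; apply/andP; split; lra.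
have vl : arc_length i c + l' - v < b.
  have : a - (a + b - (arc_length i c + l')) / 2 <= v by rewrite le_max lexx orbT.
  by move: lab; lra.
have cK : {within `[0%R, 1%R], continuous K}.
  apply: parameterized_integral_continuous => //.
  by apply: continuous_compact_integrable; [exact: segment_compact|exact: speed_continuous].
have [s + Ks] : exists2 s, s \in `[0%R, 1%R] & K s = v.
  apply: (IVT ler01 cK); rewrite K0 K1 min_l ?max_r ?arc_length_ge0//.
  by rewrite (ltW v0) (ltW (lt_le_trans va aL)).
rewrite in_itv/= => /andP[s0 s1].
have a1 : is_arc i (fun t => c (0 + t * s)).
  by apply: arc_affine => //; rewrite ?add0r ?s0 ?lexx ?ler01.
have a2 : is_arc i (fun t => c (s + t * (1 - s))).
  by apply: arc_affine => //; rewrite ?s0// subrKC ler01 lexx.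
have := curve1 a1; have := curve_arc a2 (y := y') (l := l').
rewrite !arc_length_sub// ?add0r ?subr_ge0 ?subrKC//.
rewrite !mul1r !mul0r addr0 subrKC -/K K0 K1 Ks subr0 => h2 h1.
by exists (rm_param i (c s)), v, (arc_length i c - v + l'); split => //; [exact: h2|lra].
Qed.

End Arcs.

(** * The Riemannian distance *)

Section Segments.
Context {R : realType} {n : nat} {M : ptopologicalType} (g : riemannian_manifold R n M).
Implicit Types (i j : rm_index g) (x y z : M).
Local Notation lam := (@lebesgue_measure R).
Local Notation curve := (piecewise_C1_curve g).
Local Notation dist := (rdist g).

Definition quad (G : 'M[R]_n) (v : 'rV[R]_n) := (v *m G *m v^T) 0 0.

Lemma quadE (G : 'M[R]_n) v : quad G v = dot (v *m G) v. Proof. by []. Qed.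

Lemma mulmx_norm_le (v : 'rV[R]_n) (G : 'M[R]_n) : `|v *m G| <= n%:R * `|v| * `|G|.
Proof.
apply: mx_norm_leP => [|i j]; first by rewrite !mulr_ge0.
rewrite mxE; apply: le_trans (ler_norm_sum _ _ _) _.
have -> : n%:R * `|v| * `|G| = \sum_(k < n) `|v| * `|G|.
  by rewrite sumr_const card_ord -mulrA mulr_natl.
apply: ler_sum => k _.
by rewrite normrM ler_pM ?ler_mx_coord.
Qed.

Lemma quad_le (G : 'M[R]_n) v : `|quad G v| <= n%:R ^+ 2 * `|G| * `|v| ^+ 2.
Proof.
apply: le_trans (dot_le _ _) _.
apply: (@le_trans _ _ (n%:R * (n%:R * `|v| * `|G|) * `|v|)).
  by rewrite ler_wpM2r// ler_wpM2l// mulmx_norm_le.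
by rewrite le_eqVlt; apply/orP; left; apply/eqP; ring.
Qed.

Lemma quadZ (G : 'M[R]_n) c v : quad G (c *: v) = c ^+ 2 * quad G v.
Proof. by rewrite /quad linearZ/= -!scalemxAl -scalemxAr scalerA mxE. Qed.

Lemma arc_segment i (y v : 'rV[R]_n) :
  (forall t : R, 0 <= t <= 1 -> cod i (y + t *: v)) -> is_arc i (fun t => y + t *: v).
Proof.
move=> yv.
have D (t : R) : is_derive t 1 (fun t : R => y + t *: v) v.
  have dv : derivable (@id 'rV[R]_n) (y + t *: v) v by exact: derivable_id.
  by have := derive_line dv; rewrite derive_id.
split => //.
have -> : derive1 (fun t : R => y + t *: v) = cst v.
  by apply/funext => t; rewrite derive1E (derive_val (is_derive := D t)).
by apply: continuous_subspaceT; exact: cst_continuous.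
Qed.

Lemma speed_segment i (y v : 'rV[R]_n) t :
  speed i (fun t => y + t *: v) t = Num.sqrt (quad (rm_metric i (y + t *: v)) v).
Proof.
rewrite /speed; have -> // : derive1 (fun t : R => y + t *: v) t = v.
have dv : derivable (@id 'rV[R]_n) (y + t *: v) v by exact: derivable_id.
have D := derive_line dv; rewrite derive_id in D.
by rewrite derive1E (derive_val (is_derive := D)).
Qed.

Lemma curve_segment i (y v : 'rV[R]_n) (K : R) : 0 <= K ->
  (forall t : R, 0 <= t <= 1 -> cod i (y + t *: v) /\ quad (rm_metric i (y + t *: v)) v <= K ^+ 2) ->
  exists2 l, curve (rm_param i y) (rm_param i (y + v)) l & l <= K.
Proof.
move=> K0 H; pose c := fun t : R => y + t *: v.
have ac : is_arc i c by apply: arc_segment => t /H[].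
exists (arc_length i c); first by have := curve1 ac; rewrite /c scale0r scale1r addr0.
have -> : K = \int[lam]_(s in `[0%R, 1%R]) K.
  rewrite Rintegral_cst//= lebesgue_measure_itv/= lte_fin ltr01/= oppr0 addr0 mulr1//.
apply: le_Rintegral => //.
- by apply: continuous_compact_integrable; [exact: segment_compact|exact: speed_continuous].
- apply: continuous_compact_integrable; first exact: segment_compact.
  by apply: continuous_subspaceT; exact: cst_continuous.
move=> t; rewrite /= in_itv/= => /H[_ h].
change (speed i c t <= K).
rewrite speed_segment -(ger0_norm K0) -sqrtr_sqr.
exact: ler_wsqrtr.
Qed.

Lemma has_lbound_curve x y : has_lbound [set l | curve x y l].
Proof. by exists 0 => l; exact: curve_ge0. Qed.

Lemma rdist_le x y l : curve x y l -> dist x y <= l.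
Proof. by move=> cl; apply: ge_inf => //; exact: has_lbound_curve. Qed.

Lemma rdist_ge0 x y : 0 <= dist x y.
Proof.
have [[l cl]|/asboolPn/asboolPn ne] := pselect (exists l, curve x y l).
  by apply: lb_le_inf; [exists l|move=> l'; exact: curve_ge0].
rewrite /rdist (_ : [set l | curve x y l] = set0) ?inf0//.
by apply/seteqP; split => // l cl; apply: ne; exists l.
Qed.

Lemma rdist_refl x : dist x x = 0.
Proof. by apply/le_anti; rewrite rdist_ge0 andbT; apply: rdist_le; exact: curve_nil. Qed.

Lemma rdist_sym x y : dist x y = dist y x.
Proof.
by rewrite /rdist; congr inf; apply/seteqP; split=> l /=; exact: curve_rev.
Qed.

(** The metric is bounded near y0 by continuity, and balls of the max norm are convex, so coordinate
    segments are admissible curves of length at most C times their coordinate length. *)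
Lemma chart_lip i (y0 : 'rV[R]_n) : cod i y0 -> exists2 C : R, 0 < C & exists2 r : R, 0 < r &
  forall y z : 'rV[R]_n, `|y - y0| < r -> `|z - y0| < r ->
    cod i y /\ exists2 l, curve (rm_param i y) (rm_param i z) l & l <= C * `|y - z|.
Proof.
move=> y0i.
have /nbhs_ballP[r1 /= r10 H1] : nbhs y0 (cod i) by apply: open_nbhs_nbhs; split => //; exact: rm_cod_open.
have /cvgrPdist_lt/(_ 1 ltr01)/nbhs_ballP[r2 /= r20 H2] := metric_continuous y0i.
set B := `|rm_metric i y0| + 1.
have B0 : 0 < B by rewrite ltr_wpDl.
(* [quad_le] bounds the squared speed by n^2 |G| |v|^2, and |G| <= B <= B^2 because B >= 1. *)
exists ((n%:R + 1) * B + 1); first by rewrite ltr_wpDl// mulr_ge0// ?ltW// addr_ge0.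
exists (Num.min r1 r2); first by rewrite lt_min r10.
move=> y z; rewrite !lt_min => /andP[y1 y2] /andP[z1 z2].
split; first by apply: H1; apply/ball_normP; rewrite distrC.
rewrite -[rm_param i z](congr1 (rm_param i) (subrKC y z)).
have conv (t : R) r : 0 <= t <= 1 -> `|y - y0| < r -> `|z - y0| < r -> `|y + t *: (z - y) - y0| < r.
  move=> /andP[t0 t1] yr zr.
  rewrite (_ : y + t *: (z - y) - y0 = (1 - t) *: (y - y0) + t *: (z - y0)); last first.
    by apply/matrixP => p q; rewrite !mxE; ring.
  apply: le_lt_trans (ler_normD _ _) _; rewrite !normrZ (ger0_norm t0) ger0_norm ?subr_ge0//.
  have := @le_max _ R `|y - y0| `|y - y0| `|z - y0|; have := @le_max _ R `|z - y0| `|y - y0| `|z - y0|.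
  rewrite !lexx orbT /= => h1 h2.
  have : Num.max `|y - y0| `|z - y0| < r by rewrite gt_max yr.
  by apply: le_lt_trans; nra.
apply: curve_segment => [|t t01].
  by rewrite mulr_ge0// addr_ge0// mulr_ge0// ?(ltW B0)// addr_ge0.
split; first by apply: H1; apply/ball_normP; rewrite distrC; exact: conv.
apply: le_trans (ler_norm _) _; apply: le_trans (quad_le _ _) _.
rewrite (distrC y z) exprMn ler_wpM2r ?sqr_ge0//.
set N := `|rm_metric i _|.
have NB : N <= B.
  have : `|rm_metric i y0 - rm_metric i (y + t *: (z - y))| < 1.
    by apply: H2; apply/ball_normP; rewrite distrC; exact: conv.
  rewrite -/N; have := lerB_dist (rm_metric i (y + t *: (z - y))) (rm_metric i y0).
  rewrite distrC -/N /B; lra.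
have N0 : 0 <= N by exact: normr_ge0.
have n0 : 0 <= n%:R :> R by [].
have B1 : 1 <= B by rewrite /B lerDr.
apply: (@le_trans _ _ (n%:R ^+ 2 * B ^+ 2)).
  by rewrite ler_wpM2l ?sqr_ge0//; nra.
by rewrite -exprMn ler_sqr ?nnegrE; nra.
Qed.

Lemma coord_ball i x (r : R) : rm_dom i x -> 0 < r ->
  \forall z \near x, rm_dom i z /\ `|rm_coord i z - rm_coord i x| < r.
Proof.
move=> xi r0; near=> z; split.
  by near: z; apply: open_nbhs_nbhs; split => //; exact: rm_dom_open.
rewrite distrC; near: z.
by have /cvgrPdist_lt/(_ r r0) := @rm_coord_continuous _ _ _ g i x xi.
Unshelve. all: by end_near. Qed.

Lemma near_curve x (e : R) : 0 < e -> \forall z \near x, exists2 l, curve x z l & l < e.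
Proof.
move=> e0; set i := rm_chart_at g x.
have xi : rm_dom i x by exact: rm_chart_atP.
have [C C0 [r r0 H]] := chart_lip (cod_coord xi).
have eC : 0 < e / C by exact: divr_gt0.
have m0 : 0 < Num.min r (e / C) by rewrite lt_min r0.
apply: filterS (coord_ball xi m0) => z [zi]; rewrite lt_min => /andP[zr ze].
have [|_ [l]] := H (rm_coord i x) (rm_coord i z) _ zr; first by rewrite subrr normr0.
rewrite !rm_coordK// => cl lC; exists l => //.
by apply: le_lt_trans lC _; rewrite distrC mulrC -ltr_pdivlMr.
Qed.

(** The set of points reachable from x is open and closed. Without this [rdist] could be the infimum
    of an empty set, which is 0 by default. *)
Lemma curve_exists x y : exists l, curve x y l.
Proof.
pose B := [set y | exists l, curve x y l].
suff : B = setT by move=> /seteqP[_ /(_ y I)].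
apply: (@rm_connected _ _ _ g); first by exists x, 0; exact: curve_nil.
- exists B; last by rewrite setTI.
  rewrite openE => z [l cl]; apply: filterS (near_curve z ltr01) => w [l' cl' _].
  by exists (l + l'); exact: curve_cat cl cl'.
- exists B; last by rewrite setTI.
  rewrite -[B]setCK; apply: open_closedC.
  rewrite openE => z nz; apply: filterS (near_curve z ltr01) => w [l' cl' _] [l cl].
  by apply: nz; exists (l + l'); exact: curve_cat cl (curve_rev cl').
Qed.

Lemma rdist_adherent x y (e : R) : dist x y < e -> exists2 l, curve x y l & l < e.
Proof.
move=> xye; have [l cl] := curve_exists x y.
have hi : has_inf [set l | curve x y l] by split; [exists l|exact: has_lbound_curve].
have e0 : 0 < e - dist x y by rewrite subr_gt0.
have [l' cl' le] := inf_adherent e0 hi.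
by exists l' => //; move: le; rewrite -/(rdist g x y) subrKC.
Qed.

Lemma rdist_triangle x y z : dist x z <= dist x y + dist y z.
Proof.
apply/ler_addgt0Pr => e e0.
have e2 : 0 < e / 2 by rewrite divr_gt0.
have [|l cl le] := @rdist_adherent x y (dist x y + e / 2); first by rewrite ltrDl.
have [|l' cl' le'] := @rdist_adherent y z (dist y z + e / 2); first by rewrite ltrDl.
by apply: le_trans (rdist_le (curve_cat cl cl')) _; lra.
Qed.

Lemma rdist_split x y (a b : R) : 0 < a -> 0 < b -> dist x y < a + b ->
  exists z, dist x z < a /\ dist z y < b.
Proof.
move=> a0 b0 /rdist_adherent[l cl lab].
have [z [l1 [l2 [c1 c2 h1 h2]]]] := curve_split cl a0 b0 lab.
by exists z; split; apply: le_lt_trans (rdist_le _) _; eassumption.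
Qed.

Lemma near_rdist x (e : R) : 0 < e -> \forall z \near x, dist x z < e.
Proof.
by move=> /(near_curve x); apply: filterS => z [l cl]; exact: le_lt_trans (rdist_le cl).
Qed.

Lemma rdist_dist o x y : `|dist o x - dist o y| <= dist x y.
Proof.
rewrite ler_norml; have := rdist_triangle o x y; have := rdist_triangle o y x.
by rewrite (rdist_sym y x); lra.
Qed.

Lemma rdist_chart_lip i (y0 : 'rV[R]_n) : cod i y0 -> exists2 C : R, 0 < C & exists2 r : R, 0 < r &
  forall y z : 'rV[R]_n, `|y - y0| < r -> `|z - y0| < r ->
    cod i y /\ dist (rm_param i y) (rm_param i z) <= C * `|y - z|.
Proof.
move=> /chart_lip[C C0 [r r0 H]]; exists C => //; exists r => // y z yr zr.
have [yi [l cl lC]] := H y z yr zr; split => //.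
exact: le_trans (rdist_le cl) lC.
Qed.

End Segments.

Lemma is_derive1_diff_comp (R : realType) (V W : normedModType R) (c : R -> V) (F : V -> W) (t : R) :
  derivable c t 1 -> differentiable F (c t) ->
  is_derive t 1 (F \o c) ('d F (c t) (derive1 c t)).
Proof.
move=> dc dF; have dct : differentiable c t by exact/derivable1_diffP.
have dD : differentiable (F \o c) t by exact: differentiable_comp.
apply: DeriveDef; first exact/derivable1_diffP.
by rewrite (deriveE _ dD) diff_comp//= derive1E (deriveE _ dct).
Qed.

(** * The distance induces the topology of the manifold *)

Section Topology.
Context {R : realType} {n : nat} {M : ptopologicalType} (g : riemannian_manifold R n M).
Implicit Types (i j : rm_index g) (x y z : M).
Local Notation curve := (piecewise_C1_curve g).
Local Notation dist := (rdist g).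

Lemma arc_chart i j c (t : R) : is_arc j c -> 0 <= t <= 1 -> rm_dom i (rm_param j (c t)) ->
  exists2 w, is_derive t 1 (transition j i \o c) w &
    quad (rm_metric i (rm_coord i (rm_param j (c t)))) w = quad (rm_metric j (c t)) (derive1 c t).
Proof.
move=> [ci dc _] t01 zi; set z := rm_param j (c t).
have zj : rm_dom j z by apply: dom_param; exact: ci.
have zK : rm_coord j z = c t by apply: paramK; exact: ci.
have dT := transition_differentiable zj zi; rewrite zK in dT.
have dct : differentiable c t by exact/derivable1_diffP/dc.
exists ('d (transition j i) (c t) (derive1 c t)).
  by apply: is_derive1_diff_comp => //; exact: dc.
have := rm_metric_change zj zi; rewrite /= -/(transition j i) zK => ->.
by rewrite /quad -mul_rV_lin1 trmx_mul !mulmxA.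
Qed.

Lemma lip_curve (u : M -> R) (L : R) :
  (forall j c, is_arc j c -> forall t : R, 0 <= t <= 1 -> forall e : R, 0 < e ->
    exists2 d : R, 0 < d & forall s : R, 0 <= s <= 1 -> `|s - t| < d ->
     `|u (rm_param j (c s)) - u (rm_param j (c t))| <= (L * speed j c t + e) * `|s - t|) ->
  forall x y l, curve x y l -> `|u x - u y| <= L * l.
Proof.
move=> H x y l; elim=> [z|i c y' l' ci dc cc _ IH]; first by rewrite subrr normr0 mulr0.
have ac : is_arc i c by [].
have sL : strict_deriv (fun t => L * prim (speed i c) t) (fun t => L * speed i c t).
  move=> t t01 e e0.
  have L1 : 0 < `|L| + 1 by rewrite ltr_wpDl.
  have [d d0 Hd] := prim_strict_deriv (speed_continuous ac) t01 (divr_gt0 e0 L1).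
  exists d => // a b a0 at_ tb b1 bad.
  rewrite -mulrBr -mulrA -mulrBr normrM.
  apply: (@le_trans _ _ (`|L| * (e / (`|L| + 1) * (b - a)))); first by rewrite ler_wpM2l// Hd.
  rewrite mulrA ler_wpM2r ?subr_ge0 ?(le_trans at_)//.
  by rewrite mulrCA ger_pMr// ler_pdivrMr// mul1r lerDl.
have := growth_le sL (h := fun t => u (rm_param i (c t))) (H i c ac).
rewrite -mulrBr {2}/prim set_itv1 Rintegral_set1 subr0 distrC => h.
rewrite mulrDr (_ : u _ - u y' = (u (rm_param i (c 0)) - u (rm_param i (c 1))) + (u (rm_param i (c 1)) - u y')); last ring.
exact: le_trans (ler_normD _ _) (lerD h IH).
Qed.

(** The metric is positive at y0 on the compact unit sphere; compactness makes the bound uniform in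
    the vector and in the base point near y0, and homogeneity extends it to all vectors. *)
Lemma metric_lower_bound i (y0 : 'rV[R]_n) : cod i y0 -> exists2 b : R, 0 < b & exists2 r : R, 0 < r &
  forall w : 'rV[R]_n, `|w - y0| <= r -> cod i w /\ forall v, (b * `|v|) ^+ 2 <= quad (rm_metric i w) v.
Proof.
move=> y0i.
have cS : compact [set v : 'rV[R]_n | `|v| = 1].
  apply: bounded_closed_compact.
    exists 1; split => // e e1 v /= ->; exact: ltW.
  apply: (@closed_comp _ _ (fun v : 'rV[R]_n => `|v|) [set 1]); last exact: closed_eq.
  by move=> v _; exact: norm_continuous.
(* The covering form of compactness, with base points tending to y0 and N tending to infinity: local
   bounds 1 / N^2 become one common bound. The same device recurs below whenever a uniform constant
   is extracted from a compact set. *)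
have := (compact_near_coveringP _).1 cS _ (filter_prod (nbhs (y0 : 'rV[R]_n)) (nbhs +oo_R))
  (fun p v => p.2^-1 ^+ 2 <= quad (rm_metric i p.1) v) _.
case=> [v /= v1|[P Q] /= [nP nQ] H].
  have v0 : v != 0 by rewrite -normr_gt0 v1.
  have q0 : 0 < quad (rm_metric i y0) v by exact: (rm_metric_pos y0i v0).
  set q := quad _ _ in q0.
  have cq : quad (rm_metric i p.2.1) p.1 @[p --> filter_prod (nbhs v) (filter_prod (nbhs y0) (nbhs +oo_R))] --> q.
    apply: (@cvg_quadratic R _ _ n fst (fun p => rm_metric i p.2.1)); first exact: cvg_fst.
    have c21 : p.2.1 @[p --> filter_prod (nbhs v) (filter_prod (nbhs y0) (nbhs +oo_R))] --> y0.
      exact: (cvg_comp _ _ cvg_snd cvg_fst).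
    exact: (cvg_comp _ _ c21 (metric_continuous y0i)).
  have q2 : 0 < q / 2 by rewrite divr_gt0.
  have /cvgrPdist_lt/(_ _ q2) N1 := cq.
  have N2 : \forall p \near filter_prod (nbhs v) (filter_prod (nbhs y0) (nbhs +oo_R)),
      Num.max 1 (2 / q) < p.2.2.
    have : p.2.2 @[p --> filter_prod (nbhs v) (filter_prod (nbhs y0) (nbhs +oo_R))] --> +oo_R.
      exact: (cvg_comp _ _ cvg_snd cvg_snd).
    by move=> /cvgryPgt; exact.
  apply: filterS2 N1 N2 => -[v' [w N]] /=; rewrite gt_max => h /andP[N1 Nq].
  have N0 : 0 < N by exact: lt_trans N1.
  apply: (@le_trans _ _ (q / 2)); last by move: h; rewrite ltr_norml; lra.
  apply: (@le_trans _ _ N^-1).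
    by rewrite expr2 ger_pMr ?invr_gt0// invf_le1// ltW.
  by rewrite -[q / 2]invrK lef_pV2 ?posrE ?invr_gt0// invf_div ltW.
have /nbhs_ballP[r1 /= r10 H1] : nbhs y0 (cod i) by apply: open_nbhs_nbhs; split => //; exact: rm_cod_open.
have /nbhs_ballP[r2 /= r20 H2] := nP.
have [N [QN N0]] : exists N, Q N /\ 0 < N.
  by have [N []] := filter_ex (filterI nQ (nbhs_pinfty_gt (num_real 0))); exists N.
exists N^-1; first by rewrite invr_gt0.
have m0 : 0 < Num.min r1 r2 by rewrite lt_min r10.
exists (Num.min r1 r2 / 2); first by rewrite divr_gt0.
move=> w wr.
have : `|w - y0| < Num.min r1 r2 by apply: le_lt_trans wr _; rewrite ltr_pdivrMr// ltr_pMr// ltr1n.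
rewrite lt_min => /andP[w1 w2].
split; first by apply: H1; apply/ball_normP; rewrite distrC.
move=> v; have [->|v0] := eqVneq v 0; first by rewrite normr0 mulr0 expr0n/= /quad mul0mx mul0mx mxE.
have nv0 : 0 < `|v| by rewrite normr_gt0.
have := H (w, N) _ (`|v|^-1 *: v) _; rewrite /= quadZ => h.
rewrite exprMn -ler_pdivlMr ?exprn_gt0// mulrC -exprVn; apply: h.
  by split => //; apply: H2; apply/ball_normP; rewrite distrC.
by rewrite normrZ normfV normr_id mulVf// gt_eqF.
Qed.

Lemma compact_cube i (y0 : 'rV[R]_n) r : (forall y : 'rV[R]_n, `|y - y0| <= r -> cod i y) ->
  compact (rm_param i @` [set y : 'rV[R]_n | `|y - y0| <= r]).
Proof.
move=> H; apply: continuous_compact.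
  apply: continuous_in_subspaceT => y; rewrite inE => /H yi.
  exact: rm_param_continuous.
apply: bounded_closed_compact.
  exists (r + `|y0|); split => [|e]; first exact: num_real.
  move=> eb v /= vr; rewrite -(subrK y0 v).
  by apply: le_trans (ler_normD _ _) (le_trans _ (ltW eb)); rewrite lerD2r.
apply: (@closed_comp _ _ (fun v : 'rV[R]_n => `|v - y0|) [set t | t <= r]); last exact: closed_le.
move=> v _; apply: (@lip_continuous R n (fun v => `|v - y0|) 1 ltr01) => p q.
by rewrite mul1r; apply: le_trans (ler_dist_dist _ _) _; rewrite opprB addrA subrK.
Qed.

Lemma max0_lip (r a b : R) : `|Num.max 0 (r - a) - Num.max 0 (r - b)| <= `|a - b|.
Proof.
rewrite /Num.max; case: ltP => h1; case: ltP => h2; rewrite ler_norml; have := ler_norm (a - b); have := ler_norm (b - a); rewrite distrC; lra.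
Qed.

(* The bump function u below is Lipschitz along curves, so that a curve leaving
   the coordinate cube has length at least b * r. *)
Lemma rdist_coord i x : rm_dom i x -> exists2 b : R, 0 < b & exists2 r : R, 0 < r &
  forall z, dist x z < b * r -> rm_dom i z /\ b * `|rm_coord i z - rm_coord i x| <= dist x z.
Proof.
move=> xi; set y0 := rm_coord i x.
have [b b0 [r r0 Hb]] := metric_lower_bound (cod_coord xi).
exists b => //; exists r => // z xz.
pose cl := [set y : 'rV[R]_n | `|y - y0| <= r].
pose K := rm_param i @` cl.
have Kx z' : rm_dom i z' -> `|rm_coord i z' - y0| <= r -> K z'.
  by move=> zi zr; exists (rm_coord i z') => //; rewrite rm_coordK.
(* Here the Hausdorff property enters: around a point outside K, the bump function vanishes on a
   whole neighbourhood, also at points beyond the chart. *)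
have cK : closed K.
  apply: compact_closed; first exact: (rm_hausdorff g).
  by apply: compact_cube => y /Hb[].
pose u z := if `[< rm_dom i z >] then Num.max 0 (r - `|rm_coord i z - y0|) else 0.
have u0 z' : ~ K z' -> u z' = 0.
  move=> nK; rewrite /u; case: asboolP => // zi; apply/max_idPl; rewrite subr_le0 leNgt.
  by apply/negP => /ltW zr; apply: nK; exact: Kx.
have uL j c : is_arc j c -> forall t : R, 0 <= t <= 1 -> forall e : R, 0 < e ->
    exists2 d : R, 0 < d & forall s : R, 0 <= s <= 1 -> `|s - t| < d ->
     `|u (rm_param j (c s)) - u (rm_param j (c t))| <= (b^-1 * speed j c t + e) * `|s - t|.
  move=> ac t t01 e e0; have [ci dc _] := ac.
  have cgam : {for t, continuous (rm_param j \o c)}.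
    apply: continuous_comp; first exact/differentiable_continuous/derivable1_diffP/dc.
    by apply: rm_param_continuous; exact: ci.
  have rhs0 s : 0 <= (b^-1 * speed j c t + e) * `|s - t|.
    by rewrite mulr_ge0// addr_ge0// ?(ltW e0)// mulr_ge0// ?speed_ge0// invr_ge0 ltW.
  have [Kt|nKt] := pselect (K (rm_param j (c t))); last first.
    have /cgam/nbhs_ballP[d /= d0 Hd] : nbhs (rm_param j (c t)) (~` K).
      by apply: open_nbhs_nbhs; split => //; exact: closed_openC.
    exists d => // s _ sd; rewrite !u0 ?subrr ?normr0//.
    by apply: Hd; apply/ball_normP; rewrite distrC.
  have [y yr yE] := Kt; have [yi qy] := Hb _ yr.
  have zi : rm_dom i (rm_param j (c t)) by rewrite -yE; exact: dom_param.
  have zE : rm_coord i (rm_param j (c t)) = y by rewrite -yE paramK.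
  have [w dw qw] := arc_chart ac t01 zi.
  have wle : `|w| <= b^-1 * speed j c t.
    rewrite mulrC ler_pdivlMr// mulrC -[leLHS]ger0_norm ?mulr_ge0 ?(ltW b0)// -sqrtr_sqr /speed ler_wsqrtr//.
    by rewrite -/(quad _ _) -qw zE; exact: qy.
  have /cgam/nbhs_ballP[d1 /= d10 Hd1] : nbhs (rm_param j (c t)) (rm_dom i).
    by apply: open_nbhs_nbhs; split => //; exact: rm_dom_open.
  have dft : differentiable (transition j i \o c) t by apply/derivable1_diffP; case: dw.
  have /near0P[d2 d20 Hd2] := differentiable_eps dft e0.
  exists (Num.min d1 d2); first by rewrite lt_min d10.
  move=> s _; rewrite lt_min => /andP[sd1 sd2].
  have si : rm_dom i (rm_param j (c s)) by apply: Hd1; apply/ball_normP; rewrite distrC.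
  rewrite /u !asboolT//; apply: le_trans (max0_lip _ _ _) _.
  apply: le_trans (ler_dist_dist _ _) _.
  rewrite opprB addrA subrK.
  have := Hd2 _ sd2; rewrite subrK.
  have -> : 'd (transition j i \o c) t (s - t) = (s - t) *: w.
    by rewrite deriv1E ?derive1E ?derive_val//; exact/derivable1_diffP.
  move=> h; rewrite -(subrK ((s - t) *: w) (_ - _)).
  apply: le_trans (ler_normD _ _) _; rewrite normrZ [X in _ + X]mulrC mulrDl addrC lerD//.
  by rewrite ler_wpM2r.
have [l cl' lbr] := rdist_adherent xz.
have uz l' : curve x z l' -> r - u z <= b^-1 * l'.
  move=> /(lip_curve uL); rewrite {1}/u asboolT// subrr normr0 subr0 max_r ?(ltW r0)//.
  by apply: le_trans; exact: ler_norm.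
have uz0 : 0 < u z.
  have := uz _ cl'; have : b^-1 * l < r by rewrite mulrC ltr_pdivrMr// mulrC.
  lra.
have zi : rm_dom i z by move: uz0; rewrite /u; case: asboolP => //; rewrite ltxx.
split => //.
apply/ler_addgt0Pr => e e0.
have [|l1 c1 l1e] := @rdist_adherent _ _ _ g x z (dist x z + e); first by rewrite ltrDl.
apply: le_trans (ltW l1e); have := uz _ c1.
move: uz0; rewrite /u asboolT// lt_max ltxx /= => h; rewrite max_r ?(ltW h)//.
by rewrite opprB addrC subrK mulrC ler_pdivlMr// mulrC.
Qed.

Lemma nbhs_rdist x (U : set M) : nbhs x U <-> exists2 e : R, 0 < e & forall z, dist x z < e -> U z.
Proof.
split=> [nU|[e e0 H]]; last by apply: filterS (near_rdist g x e0) => z; exact: H.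
set i := rm_chart_at g x; have xi : rm_dom i x by exact: rm_chart_atP.
have [b b0 [r r0 Hb]] := rdist_coord xi.
have : nbhs (rm_coord i x) (rm_param i @^-1` U).
  by apply: rm_param_continuous; [exact: cod_coord|rewrite rm_coordK].
move=> /nbhs_ballP[r' /= r'0 Hr'].
exists (b * Num.min r r'); first by rewrite mulr_gt0// lt_min r0.
move=> z zlt; have [|zi zb] := Hb z.
  by apply: lt_le_trans zlt _; rewrite ler_pM2l// ge_min lexx.
rewrite -(rm_coordK zi); apply: Hr'; apply/ball_normP; rewrite distrC -(ltr_pM2l b0).
by apply: le_lt_trans zb (lt_le_trans zlt _); rewrite ler_pM2l// ge_min lexx orbT.
Qed.

Lemma rdist_continuous o : continuous (dist o).
Proof.
move=> x; apply/cvgrPdist_lt => e e0; apply: filterS (near_rdist g x e0) => z.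
exact/le_lt_trans/rdist_dist.
Qed.

Lemma open_geodesic_ball o (r : R) : open (geodesic_ball g o r).
Proof. by apply: (@open_comp _ _ (dist o) [set t | t < r]) => [x _|]; [exact: rdist_continuous|exact: open_lt]. Qed.

Lemma rdist_eq0 x y : dist x y = 0 -> x = y.
Proof.
move=> xy0; apply: (rm_hausdorff g) => U V /nbhs_rdist[e e0 HU] /nbhs_rdist[e' e'0 HV].
by exists y; split; [apply: HU; rewrite xy0|apply: HV; rewrite rdist_refl].
Qed.

End Topology.

(** * The Hopf-Rinow theorem and cutoff functions *)

Lemma min1_lip (R : realType) (a b : R) : `|Num.min 1 a - Num.min 1 b| <= `|b - a|.
Proof.
have := ler_norm (a - b); have := ler_norm (b - a); rewrite [`|a - b|]distrC => h1 h2.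
by rewrite /Num.min; case: (ltP 1 a) => ?; case: (ltP 1 b) => ?; rewrite ler_norml; lra.
Qed.

Section HopfRinow.
Context {R : realType} {n : nat} {M : ptopologicalType} (g : riemannian_manifold R n M).
Implicit Types (x y z : M).
Local Notation dist := (rdist g).

Definition cball x r := [set z | dist x z <= r].

Lemma cball_closed x r : closed (cball x r).
Proof.
apply: (@closed_comp _ _ (dist x) [set t | t <= r]); last exact: closed_le.
by move=> z _; exact: rdist_continuous.
Qed.

Lemma cball_mono x r r' : r <= r' -> cball x r `<=` cball x r'.
Proof. by move=> rr' z /= /le_trans; apply. Qed.

Lemma local_compact x : exists2 d : R, 0 < d & exists2 C : set M, compact C &
  forall z, dist x z < d -> C z.
Proof.
set i := rm_chart_at g x; have xi : rm_dom i x by exact: rm_chart_atP.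
have [b b0 [r r0 Hb]] := metric_lower_bound (cod_coord xi).
have cC := compact_cube (fun (y : 'rV[R]_n) yr => (Hb y yr).1).
have /(nbhs_rdist g)[d d0 Hd] : nbhs x (rm_param i @` [set y : 'rV[R]_n | `|y - rm_coord i x| <= r]).
  apply: filterS (coord_ball xi r0) => z [zi zr].
  by exists (rm_coord i z); [exact: ltW|rewrite rm_coordK].
by exists d => //; exists (rm_param i @` [set y : 'rV[R]_n | `|y - rm_coord i x| <= r]).
Qed.

Lemma compact_net (A : set M) (e : R) : compact A -> 0 < e ->
  exists2 s : seq M, {in s, forall x, A x} & forall z, A z -> exists2 x, x \in s & dist x z < e.
Proof.
rewrite compact_cover => cA e0.
have [|z Az|D sD AD] := cA M A (fun x => geodesic_ball g x e).
- by move=> x _; exact: open_geodesic_ball.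
- by exists z => //; rewrite /geodesic_ball/= rdist_refl.
exists (finmap.enum_fset D) => [x xD|z /AD[x /= xD zx]]; last by exists x.
by have := sD x xD; rewrite inE.
Qed.

Lemma ultra_seq (T : eqType) (F : set_system M) (s : seq T) (P : T -> set M) : UltraFilter F ->
  F [set z | exists2 x, x \in s & P x z] -> exists2 x, x \in s & F (P x).
Proof.
move=> FU; elim: s => [|x s IH] Fs.
  by have /filter_ex[z [y]] := Fs; rewrite in_nil.
have [FP|FnP] := in_ultra_setVsetC (P x) FU; first by exists x; rewrite ?mem_head.
have [|y ys Fy] := IH; last by exists y => //; rewrite in_cons ys orbT.
apply: filterS (filterI Fs FnP) => z [[y]]; rewrite in_cons => /orP[/eqP -> //|ys Py _].
by exists y.
Qed.

(* An ultrafilter containing A contains a ball of each radius 1 / (k + 1); the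
   centers of these balls form a Cauchy sequence. *)
Lemma totally_bounded_compact (A : set M) : rm_complete g -> closed A ->
  (forall e : R, 0 < e -> exists s : seq M, forall z, A z -> exists2 x, x \in s & dist x z < e) ->
  compact A.
Proof.
move=> cM cA tb; rewrite compact_ultra => F FU FA.
have H (k : nat) : exists x, F (geodesic_ball g x k.+1%:R^-1).
  have k0 : 0 < k.+1%:R^-1 :> R by rewrite invr_gt0.
  have [s Hs] := tb _ k0.
  have [|x _ Fx] := @ultra_seq _ F s (fun x => geodesic_ball g x k.+1%:R^-1) FU; last by exists x.
  exact: filterS FA.
have [u Fu] := choice H.
have [|x ux] := cM u.
  move=> e e0; have [N _ HN] := near_infty_natSinv_lt (PosNum (divr_gt0 e0 (ltr0n R 2))).
  exists N => m k Nm Nk.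
  have [z [zm zk]] := filter_ex (filterI (Fu m) (Fu k)).
  apply: le_lt_trans (rdist_triangle g _ z _) _; rewrite [rdist _ z _]rdist_sym (splitr e).
  by apply: ltrD; [apply: lt_trans zm (HN m Nm)|apply: lt_trans zk (HN k Nk)].
have Fx : F --> x.
  move=> U /(nbhs_rdist g)[e e0 HU].
  have e2 : 0 < e / 2 by rewrite divr_gt0.
  have [N _ HN] := near_infty_natSinv_lt (PosNum e2).
  have /cvgrPdist_lt/(_ _ e2)[N' _ HN'] := ux.
  apply: filterS (Fu (maxn N N')) => z zk; apply: HU.
  apply: le_lt_trans (rdist_triangle g _ (u (maxn N N')) _) _; rewrite (splitr e).
  apply: ltrD; last by apply: lt_trans zk (HN _ _); exact: leq_maxl.
  have := HN' (maxn N N') (leq_maxr _ _); rewrite /= sub0r normrN ger0_norm ?rdist_ge0//.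
  by rewrite rdist_sym.
exists x; split => //; apply: cA => U /Fx FUx.
exact: filter_ex (filterI FA FUx).
Qed.

(** By compactness of the ball, one radius e serves for compact neighbourhoods of all its points. A
    point of the slightly larger ball is close to the smaller one by [rdist_split], so finitely many
    of these neighbourhoods cover it. *)
Lemma cball_compact_extend x (r : R) : compact (cball x r) ->
  exists2 d : R, 0 < d & compact (cball x (r + d)).
Proof.
move=> cr.
have := (compact_near_coveringP _).1 cr _ +oo_R
  (fun N z => exists2 C : set M, compact C & forall w, dist z w < N^-1 -> C w) _.
case=> [z zr|N [Nr HN]].
  have [d d0 [C cC HC]] := local_compact z.
  have d2 : 0 < d / 2 by rewrite divr_gt0.
  exists ([set z' | dist z z' < d / 2], [set N | (d / 2)^-1 < N]) => /=.
    split; first exact: near_rdist.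
    by apply: nbhs_pinfty_gt; exact: num_real.
  move=> [z' N] /= [zz' dN]; exists C => // w z'w; apply: HC.
  apply: le_lt_trans (rdist_triangle g _ z' _) _; rewrite (splitr d); apply: ltrD => //.
  apply: lt_trans z'w _; rewrite -[d / 2]invrK ltf_pV2 ?posrE ?invr_gt0//.
  by apply: lt_trans dN; rewrite invr_gt0.
pose N1 := Num.max N 0 + 1.
have N1N : N < N1 by rewrite /N1 ltr_pwDr// le_max lexx.
have N10 : 0 < N1 by rewrite /N1 ltr_wpDl// le_max lexx orbT.
have {}HN := HN _ N1N.
set e := N1^-1; have e0 : 0 < e by rewrite invr_gt0.
have e2 : 0 < e / 2 by rewrite divr_gt0.
have [r0|r0] := ltP r 0.
  exists (- r / 2); first by rewrite divr_gt0// oppr_gt0.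
  rewrite (_ : cball _ _ = set0); first exact: compact0.
  apply/seteqP; split => // z; rewrite /cball/=; have := rdist_ge0 g x z; lra.
exists (e / 4); first by rewrite divr_gt0.
have [s sr Hs] := compact_net cr e2.
have /choice[C HC] : forall z, exists C : set M, z \in s -> compact C /\ forall w, dist z w < e -> C w.
  move=> z.
  have [zs|] := boolP (z \in s); last by exists set0.
  by have [C cC HC] := HN z (sr z zs); exists C.
have cU : compact (\big[setU/set0]_(z <- s) C z).
  rewrite big_seq; apply: bigsetU_compact => z zs; exact: (HC z zs).1.
apply: subclosed_compact cU _; first exact: cball_closed.
move=> w /= wr.
have [v xv vw] : exists2 v, cball x r v & dist v w < e / 2.
  move: r0; rewrite le_eqVlt => /orP[/eqP rE|r0].
    by exists x; rewrite /cball/= ?rdist_refl -?rE//; move: wr; rewrite /cball/= -rE; lra.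
  have [|v [xv vw]] := @rdist_split _ _ _ g x w r (e / 2) r0 e2; first by move: wr; rewrite /cball/=; lra.
  by exists v => //; exact: ltW.
have [u us uv] := Hs v xv.
rewrite -bigcup_seq; exists u => //; apply: (HC u us).2.
by apply: le_lt_trans (rdist_triangle g _ v _) _; rewrite (splitr e) ltrD.
Qed.

(** Every point of the ball is within e / 2 of a smaller ball, whose finite net is then a net of the
    large ball. Completeness is used only here, through total boundedness. *)
Lemma cball_compact_limit x (r : R) : rm_complete g -> 0 < r ->
  (forall r', 0 <= r' -> r' < r -> compact (cball x r')) -> compact (cball x r).
Proof.
move=> cM r0 H; apply: totally_bounded_compact => //; first exact: cball_closed.
move=> e e0; have e2 : 0 < e / 2 by rewrite divr_gt0.
pose a := Num.max (r / 2) (r - e / 4).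
have a0 : 0 < a by rewrite lt_max divr_gt0.
have ar : a < r by rewrite gt_max; apply/andP; split; lra.
have [s _ Hs] := compact_net (H a (ltW a0) ar) e2.
exists s => z xz.
have [|w [xw wz]] := @rdist_split _ _ _ g x z a (e / 2) a0 e2.
  apply: le_lt_trans xz _; have : r - e / 4 <= a by rewrite le_max lexx orbT.
  lra.
have [y ys yw] := Hs w (ltW xw); exists y => //.
by apply: le_lt_trans (rdist_triangle g _ w _) _; rewrite (splitr e) ltrD.
Qed.

(** Induction along the radius with [cousin], applied to the relation that compactness at radius a *
    r implies compactness at radius b * r. Closed balls of smaller radii give compactness at the
    limit radius, and local compactness carries it beyond. *)
Theorem hopf_rinow x (r : R) : rm_complete g -> compact (cball x r).
Proof.
move=> cM; have [r0|r0] := leP r 0.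
  apply: (@subclosed_compact _ _ [set x]); [exact: cball_closed|exact: compact_set1|].
  move=> z xz; apply: esym; apply: (@rdist_eq0 _ _ _ g); apply/le_anti.
  by rewrite rdist_ge0 (le_trans xz).
suff : compact (cball x (0 * r)) -> compact (cball x (1 * r)).
  rewrite mul0r mul1r; apply.
  apply: (@subclosed_compact _ _ [set x]); [exact: cball_closed|exact: compact_set1|].
  move=> z xz; apply: esym; apply: (@rdist_eq0 _ _ _ g); apply/le_anti.
  by rewrite rdist_ge0 (le_trans xz).
apply: (@cousin R (fun a b => compact (cball x (a * r)) -> compact (cball x (b * r)))) => [a b c h1 h2 h|t].
  exact/h2/h1.
move=> /andP[t0 t1].
have mono a b : a <= b -> compact (cball x (b * r)) -> compact (cball x (a * r)).
  move=> ab cb; apply: (@subclosed_compact _ _ (cball x (b * r))); [exact: cball_closed|exact: cb|].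
  by apply: cball_mono; rewrite ler_pM2r.
(* If the ball of some smaller radius a * r is not compact, neither are those of radii between a * r
   and t * r, and the implication holds vacuously near t. *)
have [H|/existsNP[a /not_implyP[a0 /not_implyP[at_ nca]]]] :=
    pselect (forall a, 0 <= a -> a < t -> compact (cball x (a * r))); last first.
  exists (t - a); first by rewrite subr_gt0.
  move=> a' b a'0 a't tb b1 bat ca'; exfalso; apply: nca; apply: mono ca'.
  by lra.
have step : compact (cball x (t * r)) -> exists2 d : R, 0 < d &
    forall a b, 0 <= a -> a <= t -> t <= b -> b <= 1 -> b - a < d ->
    compact (cball x (a * r)) -> compact (cball x (b * r)).
  move=> /cball_compact_extend[d d0 cd]; exists (d / r); first exact: divr_gt0.
  move=> a b _ at_ _ _ bad _; apply: (@mono _ (t + d / r)); first by lra.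
  by rewrite mulrDl divfK// gt_eqF.
move: t0; rewrite le_eqVlt => /orP[/eqP tE|t0].
  have [cC|nC] := pselect (compact (cball x (t * r))); first exact: step.
  exists 1 => // a b a0 at_ _ _ _ ca; exfalso; apply: nC.
  by apply: mono ca; rewrite -tE.
apply: step; apply: cball_compact_limit => //; first exact: mulr_gt0.
move=> r' r'0 r't; rewrite -(divfK (lt0r_neq0 r0) r'); apply: H.
  by rewrite divr_ge0// ltW.
by rewrite ltr_pdivrMr.
Qed.

Definition cutoff o (r : R) x := Num.max 0 (Num.min 1 (2 - 2 * (dist o x / r))).

Lemma cutoff_ge0 o (r : R) x : 0 <= cutoff o r x.
Proof. by rewrite /cutoff le_max lexx. Qed.

Lemma cutoff1 o (r : R) x : 0 < r -> dist o x <= r / 2 -> cutoff o r x = 1.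
Proof.
move=> r0 xr; have h : 1 <= 2 - 2 * (dist o x / r).
  have : dist o x / r <= 1 / 2 by rewrite ler_pdivrMr// mul1r mulrC.
  lra.
by rewrite /cutoff min_l// max_r.
Qed.

Lemma cutoff0 o (r : R) x : 0 < r -> r <= dist o x -> cutoff o r x = 0.
Proof.
move=> r0 xr; have h : 2 - 2 * (dist o x / r) <= 0.
  have : 1 <= dist o x / r by rewrite ler_pdivlMr// mul1r.
  lra.
by rewrite /cutoff max_l// ge_min h orbT.
Qed.

Lemma cutoff_lip o (r : R) x y : 0 < r -> `|cutoff o r x - cutoff o r y| <= 2 / r * dist x y.
Proof.
move=> r0; have h := rdist_dist g o x y.
have ir0 : 0 <= r^-1 by rewrite invr_ge0 ltW.
apply: (@le_trans _ _ (`|2 * (dist o x / r) - 2 * (dist o y / r)|)).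
  rewrite /cutoff; set a := 2 * _; set b := 2 * _.
  have := max0_lip 0 (- Num.min 1 (2 - a)) (- Num.min 1 (2 - b)).
  rewrite !sub0r !opprK => /le_trans; apply; rewrite addrC.
  apply: le_trans (min1_lip _ _) _; rewrite le_eqVlt; apply/orP; left; apply/eqP.
  by rewrite distrC; congr `|_|; ring.
rewrite -mulrBr -mulrBl !normrM (ger0_norm ir0) ger0_norm// -mulrA ler_wpM2l// mulrC ler_wpM2l//.
Qed.

Lemma cutoff_Lip_c o (r : R) : rm_complete g -> 0 < r -> Lip_c g (cutoff o r).
Proof.
move=> cM r0; split; first by exists (2 / r) => y z; exact: cutoff_lip.
apply: (@subclosed_compact _ _ (cball o r)); [exact: closed_closure|exact: hopf_rinow|].
rewrite [X in _ `<=` X](closure_id (cball o r)).1; last exact: cball_closed.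
apply: closure_subset => x /= /eqP cx; rewrite /cball/= leNgt; apply/negP => /ltW rx.
by apply: cx; exact: cutoff0.
Qed.

End HopfRinow.

(** * Locally Lipschitz functions *)

(** A power is monotone or antitone according to the sign of q; the sum of the values at both ends
    bounds it in either case. *)
Lemma powR_le_sum (R : realType) (a b x q : R) : 0 < a -> a <= x -> x <= b ->
  x `^ q <= a `^ q + b `^ q.
Proof.
move=> a0 ax xb; have x0 := lt_le_trans a0 ax; have b0 := lt_le_trans x0 xb.
have [q0|q0] := leP 0 q.
  by rewrite -[leLHS]add0r lerD ?powR_ge0// ge0_ler_powR// nnegrE ltW.
rewrite -[leLHS]addr0 lerD ?powR_ge0// -[q]opprK (powRN a) (powRN x) lef_pV2 ?posrE ?powR_gt0//.
by apply: ge0_ler_powR; rewrite ?nnegrE ?oppr_ge0// ltW.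
Qed.

Lemma powR_locally_lip (R : realType) (s0 q : R) : 0 < s0 ->
  exists2 L : R, 0 < L & exists2 d : R, 0 < d &
    forall s t : R, `|s - s0| < d -> `|t - s0| < d -> `|s `^ q - t `^ q| <= L * `|s - t|.
Proof.
move=> s00; pose C := (s0 / 2) `^ (q - 1) + (3 * s0 / 2) `^ (q - 1).
have C0 : 0 <= C by rewrite addr_ge0 ?powR_ge0.
exists (`|q| * C + 1); first by rewrite ltr_wpDl// mulr_ge0.
exists (s0 / 2); first by rewrite divr_gt0.
suff H (s t : R) : s0 / 2 < s -> s <= t -> t < 3 * s0 / 2 ->
    `|t `^ q - s `^ q| <= (`|q| * C + 1) * (t - s).
  move=> s t; rewrite !ltr_norml => /andP[s1 s2] /andP[t1 t2].
  have [st|ts] := leP s t.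
    by rewrite distrC [X in _ * X]distrC (@ger0_norm _ (t - s)) ?subr_ge0//; apply: H; lra.
  by rewrite [X in _ * X]ger0_norm ?subr_ge0 ?(ltW ts)//; apply: H; lra.
move=> s1 st t2.
have [||c] := @MVT_segment R (fun x => x `^ q) (fun x => q * x `^ (q - 1)) s t st.
- by move=> x; rewrite in_itv/= => /andP[sx xt]; apply: is_derive1_powR; lra.
- apply: derivable_within_continuous => x; rewrite in_itv/= => /andP[sx xt].
  by have x0 : 0 < x by [lra]; have [] := is_derive1_powR q x0.
rewrite in_itv/= => /andP[sc ct] ->.
rewrite !normrM (@ger0_norm _ (t - s)) ?subr_ge0// ler_wpM2r ?subr_ge0//.
apply: (@le_trans _ _ (`|q| * C)); last by rewrite ler_wpDr.
rewrite (ger0_norm (powR_ge0 _ _)).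
by rewrite ler_wpM2l// powR_le_sum//; lra.
Qed.

Section LipschitzCalculus.
Context {R : realType} {n : nat} {M : ptopologicalType} (g : riemannian_manifold R n M).
Implicit Types (x y z : M) (u w : M -> R).
Local Notation dist := (rdist g).

Lemma Lip_locP u : Lip_loc g u <-> forall x, exists2 L : R, 0 < L & exists2 d : R, 0 < d &
  forall y z, dist x y < d -> dist x z < d -> `|u y - u z| <= L * dist y z.
Proof.
split=> H x.
  have [L [U /(nbhs_rdist g)[d d0 HU] HL]] := H x.
  exists (`|L| + 1); first by rewrite ltr_wpDl.
  exists d => // y z /HU Uy /HU Uz; apply: le_trans (HL y z Uy Uz) _.
  by rewrite ler_wpM2r ?rdist_ge0// ler_wpDr// ler_norm.
have [L L0 [d d0 HL]] := H x.
exists L; exists [set z | dist x z < d] => [|y z]; last exact: HL.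
exact: near_rdist.
Qed.

Lemma Lip_c_loc u : Lip_c g u -> Lip_loc g u.
Proof.
by move=> [[L HL] _] x; exists L; exists setT => [|y z _ _]; [exact: filterT|exact: HL].
Qed.

Lemma Lip_loc_continuous u : Lip_loc g u -> continuous u.
Proof.
move=> /Lip_locP H x; have [L L0 [d d0 HL]] := H x.
apply/cvgrPdist_lt => e e0; apply/(nbhs_rdist g).
exists (Num.min d (e / L)); first by rewrite lt_min d0 divr_gt0.
move=> z; rewrite lt_min => /andP[zd ze]; apply: le_lt_trans (HL x z _ zd) _.
  by rewrite rdist_refl.
by rewrite mulrC -ltr_pdivlMr.
Qed.

Lemma Lip_loc_lin (c d : R) u w : Lip_loc g u -> Lip_loc g w -> Lip_loc g (fun z => c * u z + d * w z).
Proof.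
move=> /Lip_locP Hu /Lip_locP Hw; apply/Lip_locP => x.
have [L L0 [r r0 HL]] := Hu x; have [L' L'0 [r' r'0 HL']] := Hw x.
exists (`|c| * L + `|d| * L' + 1).
  by rewrite ltr_wpDl// addr_ge0// mulr_ge0// ltW.
exists (Num.min r r'); first by rewrite lt_min r0.
move=> y z; rewrite !lt_min => /andP[y1 y2] /andP[z1 z2].
rewrite (_ : _ - _ = c * (u y - u z) + d * (w y - w z)); last ring.
apply: le_trans (ler_normD _ _) _; rewrite !normrM.
apply: (@le_trans _ _ (`|c| * (L * dist y z) + `|d| * (L' * dist y z))).
  by apply: lerD; rewrite ler_wpM2l// ?HL ?HL'.
by rewrite !mulrA -mulrDl ler_wpM2r ?rdist_ge0// lerDl.
Qed.

Lemma Lip_loc_mul u w : Lip_loc g u -> Lip_loc g w -> Lip_loc g (u \* w).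
Proof.
move=> lu lw; have cu := Lip_loc_continuous lu; have cw := Lip_loc_continuous lw.
move/Lip_locP : lu => Hu; move/Lip_locP : lw => Hw; apply/Lip_locP => x.
have [L L0 [r r0 HL]] := Hu x; have [L' L'0 [r' r'0 HL']] := Hw x.
have /cvgrPdist_lt/(_ _ ltr01)/(nbhs_rdist g)[e e0 He] := cu x.
have /cvgrPdist_lt/(_ _ ltr01)/(nbhs_rdist g)[e' e'0 He'] := cw x.
exists ((`|u x| + 1) * L' + (`|w x| + 1) * L).
  by rewrite addr_gt0// mulr_gt0// ltr_wpDl.
exists (Num.min (Num.min r r') (Num.min e e')); first by rewrite !lt_min r0 r'0 e0.
move=> y z; rewrite !lt_min => /andP[/andP[y1 y2] /andP[y3 y4]] /andP[/andP[z1 z2] /andP[z3 z4]].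
rewrite /= (_ : _ - _ = u y * (w y - w z) + w z * (u y - u z)); last ring.
apply: le_trans (ler_normD _ _) _; rewrite !normrM mulrDl -!mulrA.
have bnd (a b : R) : `|b - a| < 1 -> `|a| <= `|b| + 1.
  by move=> h; rewrite -lerBlDl; apply: le_trans (ltW h); rewrite distrC; exact: lerB_dist.
apply: lerD; apply: ler_pM => //; first exact/bnd/He.
- exact: HL'.
- exact/bnd/He'.
- exact: HL.
Qed.

Lemma Lip_loc_comp (h : R -> R) u : Lip_loc g u ->
  (forall x, exists2 L : R, 0 < L & exists2 d : R, 0 < d &
    forall s t : R, `|s - u x| < d -> `|t - u x| < d -> `|h s - h t| <= L * `|s - t|) ->
  Lip_loc g (h \o u).
Proof.
move=> lu Hh; have cu := Lip_loc_continuous lu.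
move/Lip_locP : lu => Hu; apply/Lip_locP => x.
have [L L0 [r r0 HL]] := Hu x; have [L' L'0 [d d0 HL']] := Hh x.
have /cvgrPdist_lt/(_ _ d0)/(nbhs_rdist g)[e e0 He] := cu x.
exists (L' * L); first exact: mulr_gt0.
exists (Num.min r e); first by rewrite lt_min r0.
move=> y z; rewrite !lt_min => /andP[y1 y2] /andP[z1 z2].
apply: le_trans (HL' _ _ _ _) _; rewrite ?(distrC _ (u x)); [exact: He|exact: He|].
by rewrite -mulrA ler_wpM2l ?(ltW L'0)// HL.
Qed.

Lemma Lip_loc_shift u (c : R) : Lip_loc g u -> Lip_loc g (fun x => u x + c).
Proof.
move=> /Lip_locP H; apply/Lip_locP => x; have [L L0 [d d0 HL]] := H x.
exists L => //; exists d => // y z yd zd.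
by rewrite (_ : _ - _ = u y - u z); [exact: HL|ring].
Qed.

Lemma Lip_loc_powR u (q : R) : Lip_loc g u -> (forall x, 0 < u x) -> Lip_loc g (fun x => u x `^ q).
Proof.
by move=> lu u0; apply: (@Lip_loc_comp (fun t => t `^ q)) => // x; exact: powR_locally_lip.
Qed.

Lemma supp_mul u w : supp (u \* w) `<=` supp u.
Proof.
by apply: closure_subset => x /=; apply: contraNN => /eqP ->; rewrite mul0r.
Qed.

Lemma supp0 u x : ~ supp u x -> u x = 0.
Proof.
by move=> nx; apply/eqP; apply: contra_notT nx => ux; exact: subset_closure.
Qed.

Lemma compact_bounded (K : set M) u : compact K -> continuous u ->
  exists2 B : R, 0 < B & forall x, K x -> `|u x| <= B.
Proof.
move=> cK cu.
have := (compact_near_coveringP _).1 cK _ +oo_R (fun N z => `|u z| <= N) _.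
case=> [x _|N [Nr HN]].
  have /cvgrPdist_lt/(_ _ ltr01) h := cu x.
  exists ([set z | `|u x - u z| < 1], [set N | `|u x| + 1 < N]) => /=.
    by split => //; apply: nbhs_pinfty_gt; exact: num_real.
  move=> [z N] /= [zx Nx]; apply: le_trans (ltW Nx).
  by rewrite -lerBlDl; apply: le_trans (ltW zx); rewrite distrC; exact: lerB_dist.
exists (Num.max N 0 + 1); first by rewrite ltr_wpDl// le_max lexx orbT.
by apply: HN; rewrite ltr_pwDr// le_max lexx.
Qed.

(** For points closer than 1 / N1, compactness of the support gives the uniform constant N1. For
    points farther apart, the values differ by at most 2 B, which is at most 2 B N1 times the
    distance. *)
Lemma Lip_loc_c u : Lip_loc g u -> compact (supp u) -> Lip_c g u.
Proof.
move=> lu cs; split => //.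
have [B B0 HB] := compact_bounded cs (Lip_loc_continuous lu).
have := (compact_near_coveringP _).1 cs _ +oo_R
  (fun N z => forall y, dist z y < N^-1 -> `|u z - u y| <= N * dist z y) _.
case=> [x _|N [Nr HN]].
  move/Lip_locP : lu => /(_ x)[L L0 [d d0 HL]].
  have d2 : 0 < d / 2 by rewrite divr_gt0.
  exists ([set z | dist x z < d / 2], [set N | Num.max L (d / 2)^-1 < N]) => /=.
    split; first exact: near_rdist.
    by apply: nbhs_pinfty_gt; exact: num_real.
  move=> [z N] /= [zx]; rewrite gt_max => /andP[NL Nd] y zy.
  have N0 := lt_trans L0 NL.
  apply: (@le_trans _ _ (L * dist z y)); last by rewrite ler_wpM2r ?rdist_ge0// ltW.
  apply: HL; first by apply: lt_trans zx _; rewrite ltr_pdivrMr// ltr_pMr// ltr1n.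
  apply: le_lt_trans (rdist_triangle g _ z _) _; rewrite (splitr d); apply: ltrD => //.
  by apply: lt_trans zy _; rewrite -[d / 2]invrK ltf_pV2 ?posrE ?invr_gt0.
pose N1 := Num.max N 0 + 1.
have N1N : N < N1 by rewrite /N1 ltr_pwDr// le_max lexx.
have N10 : 0 < N1 by rewrite /N1 ltr_wpDl// le_max lexx orbT.
have {}HN := HN _ N1N.
have uB z : `|u z| <= B.
  have [/HB//|/supp0 ->] := pselect (supp u z); by rewrite normr0 ltW.
have K0 : 0 <= N1 + 2 * B * N1 by rewrite addr_ge0 ?mulr_ge0 ?ltW.
have H y z : supp u y -> `|u y - u z| <= (N1 + 2 * B * N1) * dist y z.
  move=> sy; have [yz|yz] := ltP (dist y z) N1^-1.
    apply: le_trans (HN y sy z yz) _; rewrite ler_wpM2r ?rdist_ge0// lerDl.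
    by rewrite !mulr_ge0 ?ltW.
  apply: (@le_trans _ _ (2 * B)).
    by apply: le_trans (ler_normB _ _) _; have := uB y; have := uB z; lra.
  rewrite [leRHS]mulrDl -[leLHS]add0r; apply: lerD; rewrite ?mulr_ge0 ?rdist_ge0 ?(ltW N10)//.
  rewrite -[leRHS]mulrA ler_peMr ?mulr_ge0 ?(ltW B0)//.
  by rewrite mulrC -ler_pdivrMr// div1r.
exists (N1 + 2 * B * N1) => y z.
have [sy|/supp0 uy] := pselect (supp u y); first exact: H.
have [sz|/supp0 uz] := pselect (supp u z); first by rewrite distrC rdist_sym; exact: H.
by rewrite uy uz subrr normr0 mulr_ge0// rdist_ge0.
Qed.

Lemma Lip_c_mul u w : Lip_c g u -> Lip_loc g w -> Lip_c g (u \* w).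
Proof.
move=> lu lw; apply: Lip_loc_c; first by apply: Lip_loc_mul => //; exact: Lip_c_loc.
by apply: subclosed_compact lu.2 _; [exact: closed_closure|exact: supp_mul].
Qed.

Lemma Lip_loc_lrep (i : rm_index g) u x : Lip_loc g u -> rm_dom i x -> exists2 L : R, 0 < L & exists2 r : R, 0 < r &
  forall y z : 'rV[R]_n, `|y - rm_coord i x| < r -> `|z - rm_coord i x| < r ->
    cod i y /\ `|lrep i u y - lrep i u z| <= L * `|y - z|.
Proof.
move=> /Lip_locP/(_ x)[L L0 [d d0 HL]] xi.
have [C C0 [r r0 HC]] := rdist_chart_lip (cod_coord xi).
exists (L * C); first exact: mulr_gt0.
have m0 : 0 < Num.min r (d / C) by rewrite lt_min r0 divr_gt0.
exists (Num.min r (d / C)) => // y z; rewrite !lt_min => /andP[yr yd] /andP[zr zd].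
have x0 : `|rm_coord i x - rm_coord i x| < r by rewrite subrr normr0.
have xd (w : 'rV[R]_n) : `|w - rm_coord i x| < r -> `|w - rm_coord i x| < d / C -> dist x (rm_param i w) < d.
  move=> wr wd; have [_] := HC _ w x0 wr; rewrite rm_coordK// => /le_lt_trans; apply.
  by rewrite mulrC -ltr_pdivlMr// distrC.
have [yi h] := HC y z yr zr; split => //.
apply: le_trans (HL _ _ (xd _ yr yd) (xd _ zr zd)) _.
by rewrite -mulrA ler_wpM2l// ltW.
Qed.

(* Differentiates u in the direction of its gradient, along a segment whose
   length is controlled by the metric at its origin. *)
Lemma grad_lip u x (L : R) : 0 <= L -> (\forall y \near x, `|u y - u x| <= L * dist x y) ->
  inner g x (grad g u x) (grad g u x) <= L ^+ 2.
Proof.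
move=> L0 uL; have [dx|ndx] := pselect (diffat g u x); last first.
  by rewrite /grad asboolF// inner0l sqr_ge0.
set i := rm_chart_at g x in dx; have xi : rm_dom i x by exact: rm_chart_atP.
set y0 := rm_coord i x; set G := rm_metric i y0; set q := cograd i u x.
pose v := q *m invmx G.
have vG : v *m G = q by rewrite mulmxKV// metric_unitmx.
have -> : inner g x (grad g u x) (grad g u x) = quad G v.
  by rewrite grad_cograd.
have q0 : 0 <= quad G v by have := inner_ge0 g x v.
set N := Num.sqrt (quad G v).
have NE : quad G v = N ^+ 2 by rewrite sqr_sqrtr.
have N0 : 0 <= N by exact: sqrtr_ge0.
have dN : 'd (lrep i u) y0 v = N ^+ 2 by rewrite -dot_cograd// -NE quadE vG.
(* N is the length of the gradient v, and the derivative of u along v equals N^2; the Lipschitz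
   bound along v therefore reads N^2 <= L N. *)
suff H : N ^+ 2 <= L * N.
  rewrite NE ler_sqr ?nnegrE//.
  by move: N0; rewrite le_eqVlt => /orP[/eqP <- //|N0]; move: H; rewrite expr2 ler_pM2r.
apply/ler_addgt0Pr => e' e'0.
(* It pays for e L, from the speed N + e along the segment, and for e |v|, from the
   differentiability error. *)
pose e := e' / (L + `|v| + 1).
have Lv : 0 < L + `|v| + 1 by rewrite ltr_wpDl// addr_ge0.
have e0 : 0 < e by exact: divr_gt0.
have /near0P[d1 d10 H1] := differentiable_eps dx e0.
have [d2 d20 H2] : exists2 d2 : R, 0 < d2 & forall w : 'rV[R]_n, `|w| < d2 ->
    [/\ cod i (y0 + w), quad (rm_metric i (y0 + w)) v <= (N + e) ^+ 2 &
      `|u (rm_param i (y0 + w)) - u x| <= L * dist x (rm_param i (y0 + w))].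
  have n1 : nbhs y0 (cod i) by apply: open_nbhs_nbhs; split; [exact: rm_cod_open|exact: cod_coord].
  have n2 : \forall w \near y0, quad (rm_metric i w) v <= (N + e) ^+ 2.
    have c := @cvg_quadratic R _ _ n (fun=> v) (rm_metric i) v G (nbhs_filter y0)
       (cvg_cst _) (metric_continuous (cod_coord xi)).
    have lt1 : quad G v < (N + e) ^+ 2.
      by rewrite NE ltr_sqr ?nnegrE ?addr_ge0// ?(ltW e0)// ltrDl.
    have e1 : 0 < (N + e) ^+ 2 - quad G v by rewrite subr_gt0.
    have /cvgrPdist_lt/(_ _ e1) := c (nbhs_filter y0); apply: filterS => w.
    rewrite -/(quad G v) -/(quad (rm_metric i w) v) ltr_norml; lra.
  have n3 : \forall w \near y0, `|u (rm_param i w) - u x| <= L * dist x (rm_param i w).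
    have cp : rm_param i @ y0 --> x.
      by have := @rm_param_continuous _ _ _ g i y0 (cod_coord xi); rewrite /prop_for /continuous_at rm_coordK.
    exact: (cp _ uL).
  have n123 : nbhs (y0 : 'rV[R]_n) [set w : 'rV[R]_n | cod i w /\ (quad (rm_metric i w) v <= (N + e) ^+ 2 /\
      `|u (rm_param i w) - u x| <= L * dist x (rm_param i w))].
    exact: filterI n1 (filterI n2 n3).
  have /nbhs_ballP[d2 /= d20 Hd2] := n123.
  exists d2 => // w wd; have [] := Hd2 (y0 + w); last by move=> ? [].
  by apply/ball_normP; rewrite opprD addNKr normrN.
have v1 : 0 < `|v| + 1 by rewrite ltr_wpDl.
pose s := Num.min d1 d2 / (`|v| + 1) / 2.
have s0 : 0 < s by rewrite !divr_gt0// lt_min d10.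
have sv : `|s *: v| < Num.min d1 d2.
  rewrite normrZ (gtr0_norm s0) /s.
  set m := Num.min d1 d2; have m0 : 0 < m by rewrite lt_min d10.
  have : `|v| / (`|v| + 1) < 1 by rewrite ltr_pdivrMr// mul1r ltrDl.
  rewrite (_ : m * (`|v| + 1)^-1 / 2 * `|v| = m * ((`|v| / (`|v| + 1)) / 2)); last ring.
  have : 0 <= `|v| / (`|v| + 1) by rewrite divr_ge0// ltW.
  nra.
move: sv; rewrite lt_min => /andP[sv1 sv2].
have [_ _ h3] := H2 _ sv2.
have := H1 _ sv1; rewrite -/y0 (addrC (s *: v) y0) linearZ/= dN => h4.
have h5 : dist x (rm_param i (y0 + s *: v)) <= s * (N + e).
  have [||l cl ls] := @curve_segment _ _ _ g i y0 (s *: v) (s * (N + e)).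
  - by rewrite mulr_ge0 ?(ltW s0)// addr_ge0// ltW.
  - move=> t /andP[t0 t1].
    have [|c1 c2 _] := H2 (t *: (s *: v)).
      apply: le_lt_trans sv2; rewrite normrZ (ger0_norm t0) ler_piMl//.
    by split => //; rewrite quadZ [leRHS]exprMn ler_wpM2l// sqr_ge0.
  by apply: le_trans ls; apply: rdist_le; rewrite rm_coordK// in cl.
have h6 : s * N ^+ 2 <= s * (L * (N + e) + e * `|v|).
  move: h3 h4; rewrite /lrep/= rm_coordK// normrZ (gtr0_norm s0) !ler_norml => /andP[_ h3] /andP[h4 _].
  move: h4; rewrite -[_ *: N ^+ 2]/(s * N ^+ 2) => h4.
  have h7 : L * dist x (rm_param i (y0 + s *: v)) <= L * (s * (N + e)) by rewrite ler_wpM2l.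
  lra.
move: h6; rewrite ler_pM2l// => /le_trans; apply.
rewrite mulrDr -addrA lerD2l.
have -> : e' = e * (L + `|v| + 1) by rewrite divfK// gt_eqF.
by rewrite (mulrC L) -mulrDr ler_pM2l// lerDl.
Qed.

End LipschitzCalculus.

(** * The Riemannian measure *)

Section MatrixLimits.
Context {R : realType} {T : Type} (F : set_system T) {FF : Filter F}.

Lemma cvg_det n (A : T -> 'M[R]_n) (A0 : 'M[R]_n) :
  (forall i j, A t i j @[t --> F] --> A0 i j) -> \det (A t) @[t --> F] --> \det A0.
Proof.
move=> cA; rewrite /determinant; apply: cvg_big => [|s _]; first exact: add_continuous.
apply: cvgM; first exact: cvg_cst.
by apply: cvg_big => [|i _]; [exact: mul_continuous|exact: cA].
Qed.

Lemma cvg_cofactor n (A : T -> 'M[R]_n) (A0 : 'M[R]_n) i j :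
  (forall i j, A t i j @[t --> F] --> A0 i j) -> cofactor (A t) i j @[t --> F] --> cofactor A0 i j.
Proof.
move=> cA; rewrite /cofactor; apply: cvgM; first exact: cvg_cst.
apply: cvg_det => k l; rewrite !mxE; under eq_fun do rewrite !mxE.
exact: cA.
Qed.

End MatrixLimits.

Lemma posdef_det_gt0 (R : realType) n (G : 'M[R]_n) :
  (forall v : 'rV[R]_n, v != 0 -> 0 < (v *m G *m v^T) 0 0) -> 0 < \det G.
Proof.
move=> pG; rewrite ltNge; apply/negP => G0.
(* The determinant does not vanish along the segment from the identity to G. *)
pose A (t : R) := (1 - t)%:M + t *: G.
have cA : {within `[0%R, 1%R], continuous (fun t : R => \det (A t))}.
  apply: continuous_subspaceT => t; apply: cvg_det => i j.
  rewrite /A !mxE; under eq_fun do rewrite !mxE.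
  apply: cvgD; last by apply: cvgM; [exact: cvg_id|exact: cvg_cst].
  by apply: cvgMn; apply: cvgB; [exact: cvg_cst|exact: cvg_id].
have A0 : \det (A 0) = 1 by rewrite /A subr0 scale0r addr0 det1.
have A1 : \det (A 1) = \det G by rewrite /A subrr scale1r -scalemx1 scale0r add0r.
have [|t] := IVT ler01 cA (v := 0).
  by rewrite A0 A1 min_r ?max_l ?ler01 ?G0 ?(le_trans G0 ler01).
rewrite in_itv/= => /andP[t0 t1] dt.
have : A t \in unitmx.
  apply: posdef_unitmx => v v0.
  rewrite mulmxDr mulmxDl mxE -scalemxAr -scalemxAl [in X in _ + X]mxE mul_mx_scalar -scalemxAl [in X in X + _]mxE.
  have vv : 0 < (v *m v^T) 0 0.
    rewrite -[(_ *m _) 0 0]/(dot v v) dotE lt0r sumr_ge0 ?andbT => [|k _]; last exact: sqr_ge0.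
    apply: contraNneq v0 => /eqP; rewrite psumr_eq0 => [/allP h|k _]; last exact: sqr_ge0.
    apply/eqP/rowP => k; rewrite mxE; apply/eqP; have := h k (mem_index_enum k).
    by rewrite mulf_eq0 orbb.
  have := pG v v0; nra.
by rewrite unitmxE dt unitr0.
Qed.

Lemma open_measurable_fun (R : realType) (T : ptopologicalType) (D : set T) (f : T -> R) :
  open D -> (forall x, D x -> {for x, continuous f}) ->
  measurable_fun (D : set (borelType T)) (f : borelType T -> measurableTypeR R).
Proof.
move=> oD cf; apply: (measurability (RGenOInfty.G (R:=R)) (RGenOInfty.measurableE R)) => _ [_ [a ->] <-].
apply: borel_open; rewrite openE => x [Dx]; rewrite /= in_itv/= andbT => ax.
apply: filterI; first exact: open_nbhs_nbhs.
have := cf x Dx => /cvgrPdist_lt/(_ (f x - a)); rewrite subr_gt0 => /(_ ax); apply: filterS => y.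
by rewrite /= in_itv/= andbT ltr_norml; lra.
Qed.

Lemma countable_cover (M : topologicalType) (W : M -> set M) (x0 : M) : @second_countable M ->
  (forall x, nbhs x (W x)) -> exists s : nat -> M, forall z, exists k, W (s k) z.
Proof.
move=> [B cB [_ bB]] nW.
have /countable_injP[h hI] := cB.
have /choice[s Hs] : forall k, exists x, forall b, B b -> h b = k -> (exists x, b `<=` W x) -> b `<=` W x.
  move=> k; have [[b [Bb hb [x bx]]]|nb] := pselect (exists b, [/\ B b, h b = k & exists x, b `<=` W x]).
    exists x => b' Bb' hb' _; suff -> : b' = b by [].
    by apply: hI; rewrite ?inE// hb hb'.
  by exists x0 => b Bb hb bx; exfalso; apply: nb; exists b.
exists s => z; have [b [Bb bz] bW] := bB z _ (nW z).
by exists (h b); apply: (Hs _ b) => //; exists z.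
Qed.

Section Measure.
Context {R : realType} {n : nat} {M : ptopologicalType} (g : riemannian_manifold R n M).
Variable mu : {measure set (borelType M) -> \bar R}.
Hypothesis hmu : is_volume g mu.
Implicit Types (i j : rm_index g) (x y z : M) (u w : M -> R).
Local Notation bM := (borelType M).
Local Notation bV := (borelType 'rV[R]_n).

Lemma measurable_coord i : measurable_fun (rm_dom i : set bM) (rm_coord i : bM -> bV).
Proof.
apply: (measurability (@open 'rV[R]_n : set (set bV)) (erefl _)) => _ [B oB <-].
apply: borel_open; rewrite openE => x [xi Bx]; apply: filterI.
  by apply: open_nbhs_nbhs; split => //; exact: rm_dom_open.
by apply: (rm_coord_continuous xi); exact: open_nbhs_nbhs.
Qed.

Lemma measurable_dom i : measurable (rm_dom i : set bM).
Proof. by apply: borel_open; exact: rm_dom_open. Qed.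

Lemma measurable_cod i : measurable (cod i : set bV).
Proof. by apply: borel_open; exact: rm_cod_open. Qed.

Definition chart_set i (E : set 'rV[R]_n) : set M := rm_dom i `&` rm_coord i @^-1` E.

Lemma measurable_chart_set i (E : set bV) : measurable E -> measurable (chart_set i E : set bM).
Proof. by move=> mE; apply: measurable_coord => //; exact: measurable_dom. Qed.

Lemma coord_chart_set i (E : set 'rV[R]_n) : E `<=` cod i -> rm_coord i @` chart_set i E = E.
Proof.
move=> Ei; apply/seteqP; split => [_ [x [_ Ex] <-] //|y Ey].
exists (rm_param i y); last by rewrite paramK//; exact: Ei.
by split; [apply: dom_param; exact: Ei|rewrite /= paramK//; exact: Ei].
Qed.

Definition vol i (y : 'rV[R]_n) := Num.sqrt (\det (rm_metric i y)).

Lemma vol_gt0 i (y : 'rV[R]_n) : cod i y -> 0 < vol i y.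
Proof. by move=> yi; rewrite sqrtr_gt0 posdef_det_gt0// => v; exact: rm_metric_pos. Qed.

Lemma metric_entry_cvg i (y : 'rV[R]_n) (j k : 'I_n) : cod i y -> rm_metric i z j k @[z --> y] --> rm_metric i y j k.
Proof.
move=> yi; exact: (cvg_comp _ _ (metric_continuous yi) (@coord_continuous _ _ _ j k _)).
Qed.

Lemma vol_continuous i (y : 'rV[R]_n) : cod i y -> {for y, continuous (vol i)}.
Proof.
move=> yi; have c : \det (rm_metric i z) @[z --> y] --> \det (rm_metric i y).
  by apply: (@cvg_det R _ (nbhs y) (nbhs_filter y)) => j k; exact: metric_entry_cvg.
exact: (cvg_comp _ _ c (@sqrt_continuous R _)).
Qed.

Lemma measurable_vol i : measurable_fun (cod i : set bV) (vol i : bV -> measurableTypeR R).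
Proof. by apply: open_measurable_fun; [exact: rm_cod_open|exact: vol_continuous]. Qed.

Lemma measurable_volE i (E : set bV) : E `<=` cod i ->
  measurable_fun E (fun y : bV => (vol i y)%:E).
Proof.
by move=> Ei; apply/measurable_EFinP; apply: (measurable_funS (measurable_cod i) Ei); exact: measurable_vol.
Qed.

Lemma mu_chart_set i (E : set bV) : measurable E -> E `<=` cod i ->
  mu (chart_set i E) = (\int[lebV n]_(y in E) (vol i y)%:E)%E.
Proof.
move=> mE Ei; rewrite (@hmu i); [|exact: measurable_chart_set|by move=> x []].
rewrite coord_chart_set// integral_mkcond lebV_integral.
- congr lebesgue_integral_rV; apply/funext => y; rewrite patchE indicE.
  by case: ifPn => yE; rewrite ?mul1r ?mul0r.
- exact: (measurable_restrictT _ mE).1 (measurable_volE Ei).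
- by move=> y; rewrite patchE; case: ifPn => // _; rewrite lee_fin sqrtr_ge0.
Qed.

(** The density of mu in a chart is positive, so null sets can be carried in both directions:
    forward for Rademacher, backward for [flat_const]. *)
Lemma mu_chart_set0 i (E : set bV) : measurable E -> E `<=` cod i ->
  mu (chart_set i E) = 0%E <-> lebV n E = 0%E.
Proof.
move=> mE Ei; rewrite mu_chart_set//.
have mv := measurable_volE Ei.
split=> [h|]; last exact: null_set_integral.
have := (ae_eq_integral_abs (lebV n) mE mv).1.
case=> [|N [mN N0 HN]].
  by rewrite -[RHS]h; apply: eq_integral => y _; rewrite gee0_abs// lee_fin sqrtr_ge0.
apply/le_anti; rewrite measure_ge0 andbT -N0; apply: le_measure; rewrite ?inE// => y Ey.
apply: HN => /(_ Ey)/= []; apply/eqP; rewrite gt_eqF//; apply: vol_gt0; exact: Ei.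
Qed.

Lemma chart_null i (E : set bV) (N : set M) : measurable E -> E `<=` cod i -> lebV n E = 0%E ->
  N `<=` chart_set i E -> mu.-negligible (N : set bM).
Proof.
move=> mE Ei E0 NE; exists (chart_set i E); split => //; first exact: measurable_chart_set.
exact/mu_chart_set0.
Qed.

Lemma negligible_local (N : set M) :
  (forall x, exists2 U : set M, nbhs x U & mu.-negligible (N `&` U : set bM)) ->
  mu.-negligible (N : set bM).
Proof.
move=> H; have /choice[U HU] : forall x, exists U, nbhs x U /\ mu.-negligible (N `&` U : set bM).
  by move=> x; have [U nU hU] := H x; exists U.
have [s Hs] := countable_cover (point : M) (rm_second_countable g) (fun x => (HU x).1).
apply: (@negligibleS _ _ _ mu (\bigcup_k (N `&` U (s k) : set bM))).
  by move=> z Nz; have [k kz] := Hs z; exists k.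
by apply: negligible_bigcup => k; exact: (HU _).2.
Qed.

Lemma measurable_fun_local d (T : measurableType d) (f : M -> T) :
  (forall x, exists U : set M, [/\ open U, U x & measurable_fun (U : set bM) (f : bM -> T)]) ->
  measurable_fun [set: bM] (f : bM -> T).
Proof.
move=> /choice[U HU].
have nU x : nbhs x (U x) by have [oU Ux _] := HU x; exact: open_nbhs_nbhs.
have [s Hs] := countable_cover (point : M) (rm_second_countable g) nU.
have -> : [set: bM] = \bigcup_k (U (s k) : set bM).
  by apply/seteqP; split => // z _; have [k kz] := Hs z; exists k.
apply/measurable_fun_bigcup => k; first by apply: borel_open; have [] := HU (s k).
by have [] := HU (s k).
Qed.

Lemma mu_locally_finite x : exists2 U : set M, open U /\ U x & (mu (U : set bM) < +oo)%E.
Proof.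
set i := rm_chart_at g x; have xi : rm_dom i x by exact: rm_chart_atP.
set y0 := rm_coord i x.
have n1 : nbhs (y0 : 'rV[R]_n) (cod i) by apply: open_nbhs_nbhs; split; [exact: rm_cod_open|exact: cod_coord].
have n2 : nbhs (y0 : 'rV[R]_n) [set y | vol i y < vol i y0 + 1].
  have /cvgrPdist_lt/(_ _ ltr01) := vol_continuous (cod_coord xi); apply: filterS => y.
  by rewrite /= ltr_norml; lra.
have n12 : nbhs (y0 : 'rV[R]_n) [set y : 'rV[R]_n | cod i y /\ vol i y < vol i y0 + 1].
  exact: (@filterI _ _ (nbhs_filter y0) _ _ n1 n2).
have /nbhs_ballP[r /= r0 Hr] := n12.
pose E : set bV := ball y0 r.
have mE : measurable E by exact: borel_ball.
have Ei : E `<=` cod i by move=> y /Hr[].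
exists (chart_set i E).
  split; last by split => //; exact: ballxx.
  rewrite openE => z [zi Ez]; apply: filterI; first by apply: open_nbhs_nbhs; split => //; exact: rm_dom_open.
  by apply: (rm_coord_continuous zi); apply: open_nbhs_nbhs; split => //; exact: ball_open.
rewrite mu_chart_set//.
apply: (@le_lt_trans _ _ (\int[lebV n]_(y in E) (vol i y0 + 1)%:E)%E).
  apply: ge0_le_integral => //.
  - by move=> y _; rewrite lee_fin sqrtr_ge0.
  - exact: measurable_volE.
  - by move=> y Ey; rewrite lee_fin; have [_ /ltW] := Hr y Ey.
rewrite integral_cst// lte_mul_pinfty ?lee_fin ?addr_ge0 ?sqrtr_ge0//.
apply: le_lt_trans (lebV_ball n (`|y0| + r)); apply: le_measure; rewrite ?inE//; first exact: borel_ball.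
move=> y /ball_normP yr; apply/ball_normP; rewrite sub0r normrN -(subrK y0 y).
by apply: le_lt_trans (ler_normD _ _) _; rewrite addrC ltrD2l distrC.
Qed.

Lemma mu_compact (K : set M) : compact K -> (mu (K : set bM) < +oo)%E.
Proof.
move=> cK.
have mK : measurable (K : set bM) by apply: borel_closed; apply: compact_closed => //; exact: (rm_hausdorff g).
have /choice[U HU] : forall x, exists U : set M, [/\ open U, U x & (mu (U : set bM) < +oo)%E].
  by move=> x; have [U [oU Ux] fU] := mu_locally_finite x; exists U.
move: cK; rewrite compact_cover => /(_ M K U)[|x Kx|D sD KD].
- by move=> x _; have [] := HU x.
- by exists x => //; have [] := HU x.
have mU x : measurable (U x : set bM) by apply: borel_open; have [] := HU x.
have KU : K `<=` \big[setU/set0]_(x <- finmap.enum_fset D) U x.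
  by move=> z /KD[x xD xz]; rewrite -bigcup_seq; exists x.
have : (mu (\big[setU/set0]_(x <- finmap.enum_fset D) U x : set bM) < +oo)%E /\
    measurable (\big[setU/set0]_(x <- finmap.enum_fset D) U x : set bM).
  elim: (finmap.enum_fset D) => [|x s [IH mIH]].
    by rewrite big_nil measure0; split => //; exact: measurable0.
  rewrite big_cons; split; last exact: measurableU.
  apply: le_lt_trans (measureU2 _ _ _) _ => //.
  by rewrite lte_add_pinfty//; have [] := HU x.
move=> [fin mD]; apply: le_lt_trans fin; apply: le_measure; rewrite ?inE//.
Qed.

End Measure.

(** * Gradients almost everywhere *)

(** The extension is the infimum over z in B of f z + L |y - z|. It reduces functions that are
    Lipschitz on a coordinate ball to the globally Lipschitz functions of Rademacher's theorem and
    of [flat_const]. *)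
Lemma mcshane (R : realType) k (f : 'rV[R]_k -> R) (B : set 'rV[R]_k) z0 (L : R) : 0 < L -> B z0 ->
  (forall y z : 'rV[R]_k, B y -> B z -> `|f y - f z| <= L * `|y - z|) ->
  exists2 F : 'rV[R]_k -> R, (forall y z : 'rV[R]_k, `|F y - F z| <= L * `|y - z|) &
    forall y, B y -> F y = f y.
Proof.
move=> L0 Bz0 fL; pose S y := [set f z + L * `|y - z| | z in B].
have lbS y : lbound (S y) (f z0 - L * `|y - z0|).
  move=> _ [z Bz <-]; have := fL z0 z Bz0 Bz; rewrite ler_norml => /andP[_ h].
  have := ler_distD y z0 z; rewrite (distrC z0 y); nra.
have hS y : has_inf (S y) by split; [exists (f z0 + L * `|y - z0|), z0|exists (f z0 - L * `|y - z0|)].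
have le1 y y' : inf (S y) <= inf (S y') + L * `|y - y'|.
  rewrite -lerBlDr; apply: lb_le_inf; first by have [] := hS y'.
  move=> _ [z Bz <-]; rewrite lerBlDr -addrA -mulrDr.
  apply: (@le_trans _ _ (f z + L * `|y - z|)); first by apply: ge_inf; [have [] := hS y|exists z].
  by rewrite lerD2l ler_pM2l// [leRHS]addrC ler_distD.
exists (fun y => inf (S y)) => [y z|y By].
  by rewrite ler_norml; have := le1 y z; have := le1 z y; rewrite (distrC z y); lra.
apply/le_anti/andP; split.
  by apply: ge_inf; [have [] := hS y|exists y => //; rewrite subrr normr0 mulr0 addr0].
apply: lb_le_inf; first by have [] := hS y.
by move=> _ [z Bz <-]; have := fL y z By Bz; rewrite ler_norml; lra.
Qed.

Lemma cvg_inv_entry (R : realType) (T : Type) (F : set_system T) (FF : Filter F) n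
  (A : T -> 'M[R]_n) (A0 : 'M[R]_n) i j : \det A0 != 0 -> (forall i j, A t i j @[t --> F] --> A0 i j) ->
  (\det (A t))^-1 * cofactor (A t) i j @[t --> F] --> (\det A0)^-1 * cofactor A0 i j.
Proof.
by move=> d0 cA; apply: cvgM; [apply: cvgV => //; exact: cvg_det|exact: cvg_cofactor].
Qed.

Section PartialDerivative.
Context {R : realType} {k : nat}.
Variables (F : 'rV[R]_k -> R) (L : R).
Hypotheses (L0 : 0 < L) (FL : forall y z : 'rV[R]_k, `|F y - F z| <= L * `|y - z|).

Definition partial_or0 v y := if `[< differentiable F y >] then 'D_v F y else 0.

Lemma measurable_differentiable : measurable ([set y | differentiable F y] : set (borelType 'rV[R]_k)).
Proof.
rewrite (_ : [set y | _] = [set y | almost_diff F y]).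
  by apply: measurable_almost_diff; exact: lip_continuous L0 FL.
apply/seteqP; split => y; first exact: differentiable_almost.
exact: almost_differentiable.
Qed.

(** On the Borel set of differentiability points the partial derivative is a limit of difference
    quotients with steps 1 / (m + 1), which are continuous. *)
Lemma measurable_partial v :
  measurable_fun [set: borelType 'rV[R]_k] (partial_or0 v : borelType 'rV[R]_k -> measurableTypeR R).
Proof.
have cF := lip_continuous L0 FL.
have -> : partial_or0 v = (fun y => 'D_v F y) \_ [set y | differentiable F y].
  apply/funext => y; rewrite patchE /partial_or0; case: asboolP => dy.
    by rewrite mem_set.
  by rewrite memNset.
apply: (measurable_restrictT _ measurable_differentiable).1.
apply: (@measurable_fun_cvg _ _ _ _ (fun (m : nat) (y : borelType 'rV[R]_k) => m.+1%:R * (F (m.+1%:R^-1 *: v + y) - F y))) => [m|y dy].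
  apply: (@measurable_funS _ _ _ _ [set: borelType 'rV[R]_k]) => //.
  have cc : continuous (fun y : 'rV[R]_k => m.+1%:R * (F (m.+1%:R^-1 *: v + y) - F y)).
    have m0 : 0 < m.+1%:R :> R by [].
    have Lm : 0 < m.+1%:R * (2 * L) by rewrite !mulr_gt0.
    apply: (@lip_continuous R k _ _ Lm) => p q.
    rewrite -mulrBr normrM (gtr0_norm m0) -mulrA ler_pM2l//.
    have h1 := FL (m.+1%:R^-1 *: v + p) (m.+1%:R^-1 *: v + q).
    rewrite opprD addrACA subrr add0r in h1; have h2 := FL p q.
    rewrite (_ : _ - _ - _ = (F (m.+1%:R^-1 *: v + p) - F (m.+1%:R^-1 *: v + q)) - (F p - F q)); last ring.
    by apply: le_trans (ler_normB _ _) _; lra.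
  by apply: open_measurable_fun => [|y _]; [exact: openT|exact: cc].
apply/cvgrPdist_le => e e0.
have v1 : 0 < `|v| + 1 by rewrite ltr_wpDl.
have /near0P[d d0 Hd] := differentiable_eps dy (divr_gt0 e0 v1).
have [N _ HN] := near_infty_natSinv_lt (PosNum (divr_gt0 d0 v1)).
exists N => // m /HN /= md.
have m0 : 0 < m.+1%:R :> R by [].
have hd : `|m.+1%:R^-1 *: v| < d.
  rewrite normrZ gtr0_norm ?invr_gt0//.
  apply: (@le_lt_trans _ _ (m.+1%:R^-1 * (`|v| + 1))); first by rewrite ler_pM2l ?invr_gt0// lerDl.
  by rewrite -ltr_pdivlMr.
have := Hd _ hd; rewrite linearZ/= normrZ (gtr0_norm (x := m.+1%:R^-1)) ?invr_gt0// => h.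
rewrite deriveE// distrC -[X in `|_ - X|](mulVKf (lt0r_neq0 m0)) -mulrBr normrM (gtr0_norm m0).
rewrite mulrC -ler_pdivlMr//; apply: le_trans h _.
rewrite mulrCA [leRHS]mulrC ler_pM2l ?invr_gt0// mulrAC ler_pdivrMr//.
by rewrite ler_pM2l// lerDl.
Qed.

End PartialDerivative.

Section GradientMeasure.
Context {R : realType} {n : nat} {M : ptopologicalType} (g : riemannian_manifold R n M).
Variable mu : {measure set (borelType M) -> \bar R}.
Hypothesis hmu : is_volume g mu.
Implicit Types (i j : rm_index g) (x y z : M) (u w : M -> R).
Local Notation bM := (borelType M).
Local Notation bV := (borelType 'rV[R]_n).

Definition carre_champ u w x := inner g x (grad g u x) (grad g w x).

Lemma open_chart_set i (E : set 'rV[R]_n) : open E -> open (chart_set i E).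
Proof.
move=> oE; rewrite openE => z [zi Ez]; apply: filterI.
  by apply: open_nbhs_nbhs; split => //; exact: rm_dom_open.
by apply: (rm_coord_continuous zi); exact: open_nbhs_nbhs.
Qed.

Lemma chart_ext i u x : Lip_loc g u -> rm_dom i x ->
  exists2 L : R, 0 < L & exists2 r : R, 0 < r & exists2 F : 'rV[R]_n -> R,
    (forall y z : 'rV[R]_n, `|F y - F z| <= L * `|y - z|) &
    forall y : 'rV[R]_n, ball (rm_coord i x) r y -> cod i y /\ F y = lrep i u y.
Proof.
move=> lu xi; have [L L0 [r r0 H]] := Lip_loc_lrep lu xi.
exists L => //; exists r => //.
have sym (y : 'rV[R]_n) : ball (rm_coord i x) r y -> `|y - rm_coord i x| < r.
  by move=> /ball_normP; rewrite distrC.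
have [|F FL FE] := @mcshane R n (lrep i u) (ball (rm_coord i x) r) (rm_coord i x) L L0 (ballxx _ r0).
  by move=> y z /sym yr /sym zr; have [] := H y z yr zr.
exists F => // y yr; split; last exact: FE.
by have [] := H y y (sym _ yr) (sym _ yr).
Qed.

Section Extension.
Variables (i : rm_index g) (u : M -> R) (y0 : 'rV[R]_n) (r : R) (F : 'rV[R]_n -> R).
Hypothesis FE : forall y : 'rV[R]_n, ball y0 r y -> cod i y /\ F y = lrep i u y.

Lemma near_ext (y : 'rV[R]_n) : ball y0 r y -> \forall z \near y, F z = lrep i u z.
Proof.
move=> yb; have : nbhs y (ball y0 r) by apply: open_nbhs_nbhs; split => //; exact: ball_open.
by apply: filterS => z /FE[].
Qed.

Lemma ext_differentiable (y : 'rV[R]_n) : ball y0 r y -> differentiable F y <-> differentiable (lrep i u) y.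
Proof.
move=> yb; have nFE := near_ext yb; split => h.
  by have [] := near_eq_is_diff nFE (differentiableP h).
have nEF : \forall z \near y, lrep i u z = F z by apply: filterS nFE.
by have [] := near_eq_is_diff nEF (differentiableP h).
Qed.

Lemma ext_diff (y : 'rV[R]_n) v : ball y0 r y -> differentiable F y -> 'd (lrep i u) y v = 'd F y v.
Proof.
move=> yb h; have D := near_eq_is_diff (near_ext yb) (differentiableP h).
have E : 'd (lrep i u) y = 'd F y :> ('rV[R]_n -> R) by case: D.
by rewrite E.
Qed.

Lemma diffat_ext z : chart_set i (ball y0 r) z -> diffat g u z <-> differentiable F (rm_coord i z).
Proof.
move=> [zi zb]; rewrite ext_differentiable//; split => h; last first.
  by apply: (differentiable_chart _ zi h); exact: rm_chart_atP.
by apply: (differentiable_chart zi _ h); exact: rm_chart_atP.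
Qed.

Lemma cograd_ext z k : chart_set i (ball y0 r) z ->
  cograd i u z 0 k = partial_or0 F (delta_mx 0 k) (rm_coord i z).
Proof.
move=> [zi zb]; rewrite /cograd /partial_or0; case: asboolP => h.
  have dF := (ext_differentiable zb).2 h.
  by rewrite asboolT// mxE (deriveE _ h) (deriveE _ dF); exact: ext_diff.
by rewrite asboolF ?mxE// => dF; apply: h; exact: (ext_differentiable zb).1.
Qed.

End Extension.

(** Hence the conventional value of [grad] occurs on a null set only, and the product and chain
    rules may be used under integrals. *)
Lemma ae_diffat u : Lip_loc g u -> {ae mu, forall x : bM, diffat g u x}.
Proof.
move=> lu; apply: (@negligible_local R n M g mu (~` [set x | diffat g u x])) => x.
set i := rm_chart_at g x; have xi : rm_dom i x by exact: rm_chart_atP.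
have [L L0 [r r0 [F FL FE]]] := chart_ext lu xi.
set y0 := rm_coord i x in FE.
exists (chart_set i (ball y0 r)).
  by apply: open_nbhs_nbhs; split; [apply: open_chart_set; exact: ball_open|split => //; exact: ballxx].
have mD := measurable_differentiable L0 FL.
pose E : set bV := ball y0 r `\` [set y | differentiable F y].
have mE : measurable E by apply: measurableD => //; exact: borel_ball.
apply: (chart_null hmu (i := i) mE) => [y [/FE[]]//||z [nz zb]]; last first.
  by split; [exact: zb.1|split; [exact: zb.2|move=> h; apply: nz; exact/(diffat_ext FE)]].
apply/le_anti; rewrite measure_ge0 andbT -(rademacher L0 FL); apply: le_measure; rewrite ?inE//.
  by apply: measurableC; apply: measurable_almost_diff; exact: lip_continuous L0 FL.
by move=> y [_ nd] h; apply: nd; exact: almost_differentiable.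
Qed.

Lemma measurable_invmetric i (j k : 'I_n) : measurable_fun (rm_dom i : set bM)
  (fun z : bM => invmx (rm_metric i (rm_coord i z)) j k : measurableTypeR R).
Proof.
(* The adjugate formula is continuous on the chart, whereas [invmx] is defined by cases. *)
pose f (y : 'rV[R]_n) := (\det (rm_metric i y))^-1 * cofactor (rm_metric i y) k j.
have mf : measurable_fun (cod i : set bV) (f : bV -> measurableTypeR R).
  apply: open_measurable_fun => [|y yi]; first exact: rm_cod_open.
  apply: (@cvg_inv_entry R _ (nbhs y) (nbhs_filter y)) => [|a b]; last exact: metric_entry_cvg.
  by rewrite gt_eqF// posdef_det_gt0// => v; exact: rm_metric_pos.
have := measurable_comp (measurable_cod i) _ mf (@measurable_coord _ _ _ g i).
move=> /(_ (@subset_refl _ (cod i))); apply: eq_measurable_fun => z; rewrite inE => zi.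
by rewrite /f /= /invmx metric_unitmx// !mxE.
Qed.

(** Measurability is checked near each x in the single chart chosen at x, which [inner_gradE]
    permits; there the function is a polynomial in partial derivatives and entries of the inverse
    metric. *)
Lemma measurable_carre_champ u w : Lip_loc g u -> Lip_loc g w ->
  measurable_fun [set: bM] (carre_champ u w : bM -> measurableTypeR R).
Proof.
move=> lu lw; apply: (measurable_fun_local g) => x.
set i := rm_chart_at g x; have xi : rm_dom i x by exact: rm_chart_atP.
have [L L0 [r r0 [F FL FE]]] := chart_ext lu xi.
have [L' L'0 [r' r'0 [F' FL' FE']]] := chart_ext lw xi.
set y0 := rm_coord i x in FE FE'.
pose U := chart_set i (ball y0 r) `&` chart_set i (ball y0 r').
have mU : measurable (U : set bM).
  by apply: measurableI; apply: measurable_chart_set; exact: borel_ball.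
have Ui : U `<=` rm_dom i by move=> z [[]].
have mc : measurable_fun (U : set bM) (rm_coord i : bM -> bV).
  by apply: (measurable_funS (measurable_dom i) Ui); exact: measurable_coord.
exists U; split.
- by apply: openI; apply: open_chart_set; exact: ball_open.
- by split; split => //; exact: ballxx.
have m1 (j : 'I_n) : measurable_fun (U : set bM) (fun z : bM => cograd i u z 0 j : measurableTypeR R).
  have := measurableT_comp (measurable_partial L0 FL (delta_mx 0 j)) mc.
  apply: eq_measurable_fun => z; rewrite inE => -[zr _].
  by rewrite (cograd_ext FE).
have m2 (j : 'I_n) : measurable_fun (U : set bM) (fun z : bM => cograd i w z 0 j : measurableTypeR R).
  have := measurableT_comp (measurable_partial L'0 FL' (delta_mx 0 j)) mc.
  apply: eq_measurable_fun => z; rewrite inE => -[_ zr].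
  by rewrite (cograd_ext FE').
have m3 (k : 'I_n) : measurable_fun (U : set bM) (fun z : bM => \sum_j cograd i u z 0 j *
    invmx (rm_metric i (rm_coord i z)) j k : measurableTypeR R).
  apply: measurable_sum => j; apply: measurable_funM; first exact: m1.
  by apply: (measurable_funS (measurable_dom i) Ui); exact: measurable_invmetric.
have : measurable_fun (U : set bM) (fun z : bM => \sum_k (\sum_j cograd i u z 0 j *
    invmx (rm_metric i (rm_coord i z)) j k) * cograd i w z 0 k : measurableTypeR R).
  by apply: measurable_sum => k; apply: measurable_funM; [exact: m3|exact: m2].
apply: eq_measurable_fun => z; rewrite inE => zU.
rewrite /carre_champ (inner_gradE _ _ (Ui _ zU)) /pairing mxE.
by apply: eq_bigr => k _; rewrite !mxE.
Qed.

Lemma carre_champ_eq0 u z : diffat g u z -> carre_champ u u z = 0 -> cograd (rm_chart_at g z) u z = 0.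
Proof.
move=> dz Gz; set i := rm_chart_at g z; have zi : rm_dom i z by exact: rm_chart_atP.
have g0 : grad g u z = 0.
  apply/eqP; apply: contraPT Gz => g0; apply/eqP; rewrite gt_eqF//.
  exact: (rm_metric_pos (cod_coord zi) g0).
have := grad_cograd g u z; rewrite g0 => /(congr1 (mulmx^~ (rm_metric i (rm_coord i z)))).
by rewrite /= mul0mx mulmxKV ?metric_unitmx.
Qed.

(** In a chart the differential vanishes almost everywhere, so u is locally constant by
    [flat_const], and connectedness concludes. *)
Lemma carre_champ0_const u : Lip_loc g u -> {ae mu, forall x : bM, carre_champ u u x = 0} ->
  exists c : R, forall x, u x = c.
Proof.
move=> lu G0.
have loc x : \forall z \near x, u z = u x.
  set i := rm_chart_at g x; have xi : rm_dom i x by exact: rm_chart_atP.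
  have [L L0 [r r0 [F FL FE]]] := chart_ext lu xi.
  set y0 := rm_coord i x in FE.
  pose E : set bV := ball y0 r `&` ~` [set z | flat F z].
  have mE : measurable E.
    apply: measurableI; first exact: borel_ball.
    by apply: measurableC; apply: measurable_flat; exact: lip_continuous L0 FL.
  have Ei : E `<=` cod i by move=> y [/FE[]].
  have mE0 : mu (chart_set i E) = 0%E.
    apply/negligibleP; first exact: measurable_chart_set.
    (* In the chart, a point where F is not flat is a point where u is not differentiable or where
       its gradient is not 0. *)
    apply: negligibleS (negligibleU (ae_diffat lu) G0) => z [zi [zb nf]].
    have [dz|] := pselect (diffat g u z); last by left.
    right => Gz; apply: nf.
    have zU : chart_set i (ball y0 r) z by [].
    have dF := (diffat_ext FE zU).1 dz.
    have c0 : cograd i u z = 0.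
      by rewrite (cograd_change u zi (rm_chart_atP g z)) (carre_champ_eq0 dz Gz) mul0mx.
    move=> e e0; have /near0P[d d0 Hd] := differentiable_eps dF e0.
    exists d => // h hd; have := Hd h hd.
    have dl : differentiable (lrep i u) (rm_coord i z) by exact/(ext_differentiable FE).
    by rewrite -(ext_diff FE) // -dot_cograd// c0 /dot mul0mx mxE subr0 (addrC h).
  have E0 := (mu_chart_set0 hmu mE Ei).1 mE0.
  have H := flat_const L0 FL E0.
  have : nbhs x (chart_set i (ball y0 r)).
    by apply: open_nbhs_nbhs; split; [apply: open_chart_set; exact: ball_open|split => //; exact: ballxx].
  apply: filterS => z [zi zb].
  rewrite -(lrep_coord u zi) -(lrep_coord u xi) -(FE _ zb).2 -(FE _ (ballxx _ r0)).2.
  by apply: H => //; exact: ballxx.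
pose o : M := point.
exists (u o); pose B := [set z | u z = u o].
suff : B = setT by move=> /seteqP[_ h] x; exact: (h x I).
apply: (@rm_connected _ _ _ g); first by exists o.
- exists B; last by rewrite setTI.
  by rewrite openE => z zo; apply: filterS (loc z) => y yz; rewrite /B/= yz.
- exists B; last by rewrite setTI.
  rewrite -[B]setCK; apply: open_closedC.
  by rewrite openE => z zo; apply: filterS (loc z) => y yz yo; apply: zo; rewrite /B/= -yz.
Qed.

End GradientMeasure.

(** * Compactly supported bounded functions *)

Section Integrable.
Context {R : realType} {n : nat} {M : ptopologicalType} (g : riemannian_manifold R n M).
Variable mu : {measure set (borelType M) -> \bar R}.
Hypothesis hmu : is_volume g mu.
Implicit Types (x y z : M) (u w f h : M -> R).
Local Notation bM := (borelType M).

Definition loc_bounded f := measurable_fun [set: bM] (f : bM -> measurableTypeR R) /\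
  forall K : set M, compact K -> exists B : R, forall x, K x -> `|f x| <= B.

(** A class that is stable under sums and under products with locally bounded functions, and
    contained in the integrable functions because compact sets have finite measure. It makes every
    linearity step for the real integral legitimate. *)
Definition bounded_csupp f := loc_bounded f /\ exists2 K : set M, compact K & forall x, ~ K x -> f x = 0.

Lemma eq_loc_bounded f h : (forall x, f x = h x) -> loc_bounded f -> loc_bounded h.
Proof. by move=> /funext ->. Qed.

Lemma eq_bounded_csupp f h : (forall x, f x = h x) -> bounded_csupp f -> bounded_csupp h.
Proof. by move=> /funext ->. Qed.

Lemma loc_bounded_cst (c : R) : loc_bounded (fun=> c).
Proof. by split=> [|K _]; [exact: measurable_cst|exists `|c|]. Qed.

Lemma loc_boundedD f h : loc_bounded f -> loc_bounded h -> loc_bounded (fun x => f x + h x).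
Proof.
move=> [mf bf] [mh bh]; split=> [|K cK]; first exact: measurable_funD.
have [B HB] := bf K cK; have [B' HB'] := bh K cK.
by exists (B + B') => x Kx; apply: le_trans (ler_normD _ _) (lerD (HB x Kx) (HB' x Kx)).
Qed.

Lemma loc_boundedM f h : loc_bounded f -> loc_bounded h -> loc_bounded (fun x => f x * h x).
Proof.
move=> [mf bf] [mh bh]; split=> [|K cK]; first exact: measurable_funM.
have [B HB] := bf K cK; have [B' HB'] := bh K cK.
by exists (B * B') => x Kx; rewrite normrM ler_pM// ?HB ?HB'.
Qed.

Lemma loc_boundedZ (c : R) f : loc_bounded f -> loc_bounded (fun x => c * f x).
Proof. exact: loc_boundedM (loc_bounded_cst c). Qed.

Lemma loc_boundedN f : loc_bounded f -> loc_bounded (fun x => - f x).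
Proof. by move=> /(loc_boundedZ (-1)); apply: eq_loc_bounded => x; rewrite mulN1r. Qed.

Lemma loc_boundedB f h : loc_bounded f -> loc_bounded h -> loc_bounded (fun x => f x - h x).
Proof. by move=> lf /loc_boundedN; exact: loc_boundedD. Qed.

Lemma loc_bounded_continuous f : continuous f -> loc_bounded f.
Proof.
move=> cf; split=> [|K cK]; first by apply: open_measurable_fun => [|x _]; [exact: openT|exact: cf].
by have [B _ HB] := compact_bounded cK cf; exists B.
Qed.

Lemma compact_local_bound (K : set M) f : compact K ->
  (forall x, K x -> exists N : R, \forall z \near x, f z <= N) -> exists B : R, forall x, K x -> f x <= B.
Proof.
move=> cK loc.
have := (compact_near_coveringP _).1 cK _ +oo_R (fun N z => f z <= N) _.
case=> [x Kx|N [Nr HN]].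
  have [N HN] := loc x Kx.
  exists ([set z | f z <= N], [set N' | N < N']) => /=.
    by split => //; apply: nbhs_pinfty_gt; exact: num_real.
  by move=> [z N'] /= [zx Nx]; exact: le_trans zx (ltW Nx).
by exists (N + 1); apply: HN; rewrite ltrDl.
Qed.

Lemma carre_champ_ge0 u x : 0 <= carre_champ g u u x.
Proof. exact: inner_ge0. Qed.

Lemma inner_sqr x (v w : 'rV[R]_n) (c d : R) :
  inner g x (c *: v + d *: w) (c *: v + d *: w) =
  c ^+ 2 * inner g x v v + 2 * (c * d) * inner g x v w + d ^+ 2 * inner g x w w.
Proof.
rewrite innerDl !innerDr !innerZl !innerZr (innerC g x w v).
by move: (inner g x v v) (inner g x v w) (inner g x w w) => b e f; ring.
Qed.

Lemma inner_quad x (v w : 'rV[R]_n) (c d : R) :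
  0 <= c ^+ 2 * inner g x v v + 2 * (c * d) * inner g x v w + d ^+ 2 * inner g x w w.
Proof. by rewrite -inner_sqr inner_ge0. Qed.

(** The form in which the Cauchy-Schwarz inequality is used: the scalar lemmas below instantiate c
    and d instead of taking square roots. *)
Lemma carre_champ_quad u w x (c d : R) :
  0 <= c ^+ 2 * carre_champ g u u x + 2 * (c * d) * carre_champ g u w x + d ^+ 2 * carre_champ g w w x.
Proof. exact: inner_quad. Qed.

Lemma carre_champ_le u w x : `|2 * carre_champ g u w x| <= carre_champ g u u x + carre_champ g w w x.
Proof.
have := carre_champ_quad u w x 1 1; have := carre_champ_quad u w x 1 (-1).
move: (carre_champ g u u x) (carre_champ g u w x) (carre_champ g w w x) => a b c; rewrite sqrrN expr1n => h1 h2.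
by rewrite ler_norml; lra.
Qed.

(** [grad_lip] bounds the diagonal terms by local Lipschitz constants, and [carre_champ_le] the
    mixed one. *)
Lemma loc_bounded_carre_champ u w : Lip_loc g u -> Lip_loc g w -> loc_bounded (carre_champ g u w).
Proof.
move=> lu lw; split=> [|K cK]; first exact: measurable_carre_champ.
have bnd v : Lip_loc g v -> exists B : R, forall x, K x -> carre_champ g v v x <= B.
  move=> /Lip_locP lv; apply: compact_local_bound => // x _.
  have [L L0 [d d0 HL]] := lv x; exists (L ^+ 2); apply/(nbhs_rdist g); exists d => // z xz.
  apply: grad_lip; first exact: ltW.
  apply/(nbhs_rdist g); exists (d - rdist g x z); first by rewrite subr_gt0.
  move=> y zy; rewrite distrC; apply: HL => //.
  by apply: le_lt_trans (rdist_triangle g _ z _) _; rewrite -ltrBrDl.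
have [B HB] := bnd u lu; have [B' HB'] := bnd w lw.
exists (B + B') => x Kx; have h := HB x Kx; have h' := HB' x Kx.
have := carre_champ_ge0 u x; have := carre_champ_ge0 w x; have := carre_champ_le u w x.
move: h h'; move: (carre_champ g u u x) (carre_champ g u w x) (carre_champ g w w x) => a b c.
by rewrite !ler_norml; lra.
Qed.

Lemma bounded_csupp_loc_bounded f : bounded_csupp f -> loc_bounded f. Proof. by case. Qed.

Lemma bounded_csuppM f h : loc_bounded f -> bounded_csupp h -> bounded_csupp (fun x => f x * h x).
Proof.
move=> lf [lh [K cK HK]]; split; first exact: loc_boundedM.
by exists K => // x /HK ->; rewrite mulr0.
Qed.

Lemma bounded_csuppZ (c : R) f : bounded_csupp f -> bounded_csupp (fun x => c * f x).
Proof. exact: bounded_csuppM (loc_bounded_cst c). Qed.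

Lemma bounded_csuppD f h : bounded_csupp f -> bounded_csupp h -> bounded_csupp (fun x => f x + h x).
Proof.
move=> [lf [K cK HK]] [lh [K' cK' HK']]; split; first exact: loc_boundedD.
exists (K `|` K'); first exact: compactU.
by move=> x nK; rewrite HK ?HK' ?addr0// => Kx; apply: nK; [right|left].
Qed.

Lemma bounded_csuppN f : bounded_csupp f -> bounded_csupp (fun x => - f x).
Proof. by move=> /(bounded_csuppZ (-1)); apply: eq_bounded_csupp => x; rewrite mulN1r. Qed.

Lemma bounded_csuppB f h : bounded_csupp f -> bounded_csupp h -> bounded_csupp (fun x => f x - h x).
Proof. by move=> lf /bounded_csuppN; exact: bounded_csuppD. Qed.

Lemma loc_bounded_bounded_csupp (K : set M) f : loc_bounded f -> compact K -> (forall x, ~ K x -> f x = 0) -> bounded_csupp f.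
Proof. by move=> lf cK HK; split => //; exists K. Qed.

Lemma loc_bounded_Lip_loc u : Lip_loc g u -> loc_bounded u.
Proof. by move=> /Lip_loc_continuous/loc_bounded_continuous. Qed.

Lemma bounded_csupp_Lip_c u : Lip_c g u -> bounded_csupp u.
Proof.
move=> lu; apply: (@loc_bounded_bounded_csupp (supp u)); [exact/loc_bounded_Lip_loc/Lip_c_loc|exact: lu.2|].
by move=> x; exact: supp0.
Qed.

(** Outside its support the nonnegative function u attains its minimum 0, so its gradient vanishes
    there by [grad_min0]. *)
Lemma bounded_csupp_carre_champ u w : Lip_c g u -> (forall x, 0 <= u x) -> Lip_loc g w -> bounded_csupp (carre_champ g u w).
Proof.
move=> lu u0 lw; apply: (@loc_bounded_bounded_csupp (supp u)); [|exact: lu.2|].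
  by apply: loc_bounded_carre_champ => //; exact: Lip_c_loc.
by move=> x /supp0 ux; rewrite /carre_champ grad_min0// inner0l.
Qed.

Lemma bounded_csupp_integrable f : bounded_csupp f -> mu.-integrable [set: bM] (EFin \o f).
Proof.
move=> [[mf bf] [K cK HK]]; have [B HB] := bf K cK.
apply/integrableP; split; first exact/measurable_EFinP.
have mK : measurable (K : set bM) by apply: borel_closed; apply: compact_closed => //; exact: (rm_hausdorff g).
pose C := Num.max B 0.
apply: (@le_lt_trans _ _ (\int[mu]_(x in (K : set bM)) C%:E)%E).
  rewrite [leRHS]integral_mkcond; apply: ge0_le_integral => //.
  - by apply: measurableT_comp => //; exact/measurable_EFinP.
  - by apply: (measurable_restrictT _ mK).1; exact: measurable_cst.
  - move=> x _ /=; rewrite patchE; case: ifPn => [|nKx].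
      by rewrite inE => Kx; rewrite lee_fin le_max HB.
    by rewrite HK ?normr0// => Kx; rewrite mem_set in nKx.
rewrite integral_cst// lte_mul_pinfty ?lee_fin ?le_max ?lexx ?orbT//.
exact: (mu_compact hmu).
Qed.

Lemma RintD f h : bounded_csupp f -> bounded_csupp h ->
  \int[mu]_x (f x + h x) = \int[mu]_x f x + \int[mu]_x h x.
Proof. by move=> cf ch; rewrite RintegralD//; exact: bounded_csupp_integrable. Qed.

Lemma RintB f h : bounded_csupp f -> bounded_csupp h ->
  \int[mu]_x (f x - h x) = \int[mu]_x f x - \int[mu]_x h x.
Proof. by move=> cf ch; rewrite RintegralB//; exact: bounded_csupp_integrable. Qed.

Lemma RintZ (c : R) f : bounded_csupp f -> \int[mu]_x (c * f x) = c * \int[mu]_x f x.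
Proof. by move=> cf; rewrite RintegralZl//; exact: bounded_csupp_integrable. Qed.

Lemma Rint_ae_ge0 f : bounded_csupp f -> {ae mu, forall x : bM, 0 <= f x} -> 0 <= \int[mu]_x f x.
Proof.
move=> [[mf bf] _] f0.
have E : (\int[mu]_x (f x)%:E = \int[mu]_x (Num.max (f x) 0)%:E)%E.
  apply: ae_eq_integral => //.
  - exact/measurable_EFinP.
  - by apply/measurable_EFinP; apply: measurable_maxr => //; exact: measurable_cst.
  - by apply: filterS f0 => x fx _; rewrite max_l.
rewrite /Rintegral E; apply: fine_ge0; apply: integral_ge0 => x _.
by rewrite lee_fin le_max lexx orbT.
Qed.

Lemma Rint_ae_le f h : bounded_csupp f -> bounded_csupp h -> {ae mu, forall x : bM, f x <= h x} ->
  \int[mu]_x f x <= \int[mu]_x h x.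
Proof.
move=> cf ch fh; rewrite -subr_ge0 -RintB//; apply: Rint_ae_ge0; first exact: bounded_csuppB.
by apply: filterS fh => x; rewrite subr_ge0.
Qed.

Lemma Rint_ae_eq f h : bounded_csupp f -> bounded_csupp h -> {ae mu, forall x : bM, f x = h x} ->
  \int[mu]_x f x = \int[mu]_x h x.
Proof.
by move=> cf ch fh; apply/le_anti; rewrite !Rint_ae_le//; apply: filterS fh => x ->.
Qed.

Lemma Rint_eq0 f : bounded_csupp f -> (forall x, 0 <= f x) -> \int[mu]_x f x = 0 ->
  {ae mu, forall x : bM, f x = 0}.
Proof.
move=> cf f0 If; have [[mf _] _] := cf.
have mE : measurable_fun [set: bM] (EFin \o f : bM -> \bar R) by exact/measurable_EFinP.
have fin := integrable_fin_num measurableT (bounded_csupp_integrable cf).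
have := (ae_eq_integral_abs mu measurableT mE).1; case=> [|N [mN N0 HN]].
  rewrite -[RHS](_ : (\int[mu]_x (f x)%:E)%E = 0%E).
    by apply: eq_integral => x _; rewrite gee0_abs// lee_fin.
  by rewrite -[LHS]fineK//; move: If; rewrite /Rintegral => ->.
exists N; split => // x nf; apply: HN => h; apply: nf.
by have /(_ I)[] := h.
Qed.

End Integrable.

(** * The main estimate *)

Section Estimate.
Context {R : realType} {n : nat} {M : ptopologicalType} (g : riemannian_manifold R n M).
Variable mu : {measure set (borelType M) -> \bar R}.
Hypothesis hmu : is_volume g mu.
Implicit Types (x y z : M) (u w f h eta rho : M -> R).
Local Notation bM := (borelType M).
Variables (psi a : M -> R) (A : R).
Hypotheses (psi_ge0 : forall x, 0 <= psi x) (psi_lip : Lip_loc g psi).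
Hypotheses (a_ge0 : forall x, 0 <= a x) (a_cont : continuous a).
Local Notation weak := (weak_form g mu a A psi).
Local Notation Gam := (carre_champ g).

(** The product rule for grad (eta psi) takes one copy of eta |grad psi|^2 away from the term with
    coefficient A, hence A - 1. *)
Definition weak_integrand eta x := a x * eta x * psi x ^+ 2 + (A - 1) * (eta x * Gam psi psi x) - psi x * Gam eta psi x.

Lemma bounded_csupp_aterm eta : bounded_csupp eta -> bounded_csupp (fun x => a x * eta x * psi x ^+ 2).
Proof.
move=> ce; have lp := loc_bounded_Lip_loc psi_lip.
apply: eq_bounded_csupp (bounded_csuppM (loc_boundedM (loc_bounded_continuous a_cont) (loc_boundedM lp lp)) ce) => x.
by rewrite expr2; ring.
Qed.

Lemma bounded_csupp_gterm eta : bounded_csupp eta -> bounded_csupp (fun x => eta x * Gam psi psi x).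
Proof.
move=> ce; apply: eq_bounded_csupp (bounded_csuppM (loc_bounded_carre_champ psi_lip psi_lip) ce) => x.
by rewrite mulrC.
Qed.

Lemma bounded_csupp_Wint eta : Lip_c g eta -> (forall x, 0 <= eta x) -> bounded_csupp (weak_integrand eta).
Proof.
move=> le e0; have ce := bounded_csupp_Lip_c le.
apply: bounded_csuppB; first by apply: bounded_csuppD; [exact: bounded_csupp_aterm|apply: bounded_csuppZ; exact: bounded_csupp_gterm].
by apply: bounded_csuppM; [exact: loc_bounded_Lip_loc psi_lip|exact: bounded_csupp_carre_champ].
Qed.

Lemma weak_formE eta : Lip_c g eta -> (forall x, 0 <= eta x) -> weak eta = \int[mu]_x weak_integrand eta x.
Proof.
move=> le e0; have ce := bounded_csupp_Lip_c le.
have c1 := bounded_csupp_aterm ce.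
have c2 : bounded_csupp (fun x => A * eta x * inner g x (grad g psi x) (grad g psi x)).
  by apply: eq_bounded_csupp (bounded_csuppZ A (bounded_csupp_gterm ce)) => x; rewrite mulrA.
have lep : Lip_c g (eta \* psi) by exact: Lip_c_mul.
have ep0 x : 0 <= (eta \* psi) x by exact: mulr_ge0.
have c3 : bounded_csupp (fun x => inner g x (grad g (eta \* psi) x) (grad g psi x)).
  exact: bounded_csupp_carre_champ lep ep0 psi_lip.
rewrite /weak_form -(RintD hmu c1 c2) -(RintB hmu (bounded_csuppD c1 c2) c3).
apply: (Rint_ae_eq hmu); [exact: bounded_csuppB (bounded_csuppD c1 c2) c3|exact: bounded_csupp_Wint|].
apply: ae_imp2 (ae_diffat hmu (Lip_c_loc le)) (ae_diffat hmu psi_lip) => x dx px.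
rewrite grad_mul// innerDl !innerZl /weak_integrand -/(Gam psi psi x) -/(Gam eta psi x).
by move: (Gam psi psi x) (Gam eta psi x) => b c; ring.
Qed.

Lemma Lip_c_lin (c d : R) u w : Lip_c g u -> Lip_c g w -> Lip_c g (fun x => c * u x + d * w x).
Proof.
move=> lu lw; apply: Lip_loc_c; first by apply: Lip_loc_lin; exact: Lip_c_loc.
apply: (@subclosed_compact _ _ (supp u `|` supp w)).
- exact: closed_closure.
- by apply: compactU; [exact: lu.2|exact: lw.2].
rewrite /supp -closureU; apply: closure_subset => x /=.
have [->|ux _] := eqVneq (u x) 0; last by left.
by rewrite mulr0 add0r mulf_eq0 negb_or => /andP[_]; right.
Qed.

(** Coefficients may be negative as long as the combination is nonnegative; the final comparison
    applies it to a difference of two test functions. *)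
Lemma weak_form_lin (c d : R) u w : Lip_c g u -> Lip_c g w -> (forall x, 0 <= u x) -> (forall x, 0 <= w x) ->
  (forall x, 0 <= c * u x + d * w x) ->
  weak (fun x => c * u x + d * w x) = c * weak u + d * weak w.
Proof.
move=> lu lw u0 w0 uw0; have luw := Lip_c_lin c d lu lw.
rewrite !weak_formE//; have cu := bounded_csupp_Wint lu u0; have cw := bounded_csupp_Wint lw w0.
rewrite -(RintZ hmu c cu) -(RintZ hmu d cw) -(RintD hmu (bounded_csuppZ c cu) (bounded_csuppZ d cw)).
apply: (Rint_ae_eq hmu); [exact: bounded_csupp_Wint|by apply: bounded_csuppD; exact: bounded_csuppZ|].
apply: ae_imp2 (ae_diffat hmu (Lip_c_loc lu)) (ae_diffat hmu (Lip_c_loc lw)) => x dx px.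
rewrite /weak_integrand /carre_champ (grad_lin c d dx px) innerDl !innerZl.
move: (inner g x (grad g psi x) _) (inner g x (grad g u x) _) (inner g x (grad g w x) _) => b e f.
by ring.
Qed.

Section Power.
Variables (d : R) (d0 : 0 < d).

Lemma shift_gt0 x : 0 < psi x + d.
Proof. by rewrite ltr_wpDl. Qed.

Lemma Lip_loc_shift_powR q : Lip_loc g (fun x => (psi x + d) `^ q).
Proof. by apply: Lip_loc_powR => [|x]; [exact: Lip_loc_shift|exact: shift_gt0]. Qed.

Lemma is_derive_shift_powR (q t : R) : 0 < t + d ->
  is_derive t 1 (fun t => (t + d) `^ q) (q * (t + d) `^ (q - 1)).
Proof.
move=> td; have h := is_derive1_powR q td.
have h' : is_derive t 1 (fun t => t + d) (1 : R).
  by have := is_deriveD (is_derive_id t 1) (is_derive_cst d t 1); rewrite addr0.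
by have := @is_derive1_comp R (fun t => t `^ q) (fun t => t + d) t _ _ h h'; rewrite mulr1.
Qed.

Lemma grad_shift_powR q x : diffat g psi x ->
  diffat g (fun x => (psi x + d) `^ q) x /\
  grad g (fun x => (psi x + d) `^ q) x = (q * (psi x + d) `^ (q - 1)) *: grad g psi x.
Proof.
move=> dx; have D := is_derive_shift_powR q (shift_gt0 x).
have dh : derivable (fun t => (t + d) `^ q) (psi x) 1 by case: D.
split; first exact: (diffat_comp dh dx).
by have := grad_comp dh dx; rewrite derive1E derive_val.
Qed.

End Power.

Variables (H p : R).
Definition disc := p ^+ 2 - 2 * H * p + H * (A + 1).
Definition estimate_integrand d rho x := (psi x + d) `^ (2 * p - 2) * ((psi x + d) ^+ 2 * Gam rho rho x
  + 2 * rho x * (p * (psi x + d) - H * psi x) * Gam rho psi x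
  + rho x ^+ 2 * Gam psi psi x * (disc + H * (2 * p - 2) * (d / (psi x + d)))).
Definition test_fun d rho : M -> R := rho \* (rho \* (fun x => (psi x + d) `^ (2 * p - 2))).

Lemma Lip_c_test d rho : 0 < d -> Lip_c g rho -> Lip_c g (test_fun d rho).
Proof.
move=> d0 lr; apply: Lip_c_mul => //; apply: Lip_loc_mul; first exact: Lip_c_loc.
exact: Lip_loc_shift_powR.
Qed.

Lemma test_ge0 d rho x : (forall x, 0 <= rho x) -> 0 <= test_fun d rho x.
Proof. by move=> r0; rewrite /test_fun /= !mulr_ge0 ?powR_ge0. Qed.

Lemma powR_sq (s : R) : 0 < s -> [/\ s `^ (2 * p - 2) = s `^ (p - 1) * s `^ (p - 1),
  s `^ p = s `^ (p - 1) * s & s `^ (2 * p - 2 - 1) = s `^ (2 * p - 2) / s].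
Proof.
move=> s0; have sn : s != 0 by rewrite gt_eqF.
have E (b c : R) : s `^ (b + c) = s `^ b * s `^ c by rewrite powRD// sn implybT.
split.
- by rewrite -E; congr (_ `^ _); ring.
- by rewrite -{3}(powRr1 (ltW s0)) -E; congr (_ `^ _); ring.
- by rewrite E -powR_inv1 ?ltW.
Qed.

Lemma bounded_csupp_Iint d rho : 0 < d -> Lip_c g rho -> (forall x, 0 <= rho x) -> bounded_csupp (estimate_integrand d rho).
Proof.
move=> d0 lr r0; have lp := loc_bounded_Lip_loc psi_lip.
have ls : loc_bounded (fun x => psi x + d) by apply: loc_boundedD => //; exact: loc_bounded_cst.
have lq q := loc_bounded_Lip_loc (Lip_loc_shift_powR d0 q).
have cr := bounded_csupp_Lip_c lr; have lr' := Lip_c_loc lr.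
have c1 : bounded_csupp (fun x => (psi x + d) ^+ 2 * Gam rho rho x).
  apply: bounded_csuppM; last exact: bounded_csupp_carre_champ.
  by apply: eq_loc_bounded (loc_boundedM ls ls) => x; rewrite expr2.
have c2 : bounded_csupp (fun x => 2 * rho x * (p * (psi x + d) - H * psi x) * Gam rho psi x).
  apply: bounded_csuppM; last exact: bounded_csupp_carre_champ.
  apply: loc_boundedM; first by apply: loc_boundedZ; exact: bounded_csupp_loc_bounded.
  by apply: loc_boundedB; exact: loc_boundedZ.
have c3 : bounded_csupp (fun x => rho x ^+ 2 * Gam psi psi x * (disc + H * (2 * p - 2) * (d / (psi x + d)))).
  have l1 : loc_bounded (fun x => disc + H * (2 * p - 2) * (d / (psi x + d))).
    apply: loc_boundedD; first exact: loc_bounded_cst.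
    apply: loc_boundedZ; apply: loc_boundedZ; apply: eq_loc_bounded (lq (-1)) => x.
    by rewrite powR_inv1// ltW// shift_gt0.
  apply: eq_bounded_csupp (bounded_csuppM l1 (bounded_csuppM (bounded_csupp_loc_bounded cr) (bounded_csuppM (loc_bounded_carre_champ psi_lip psi_lip) cr))) => x.
  by rewrite expr2; ring.
by apply: bounded_csuppM; [exact: lq|apply: bounded_csuppD => //; exact: bounded_csuppD].
Qed.

(* As 0 <= a and psi <= psi + d, the spectral inequality may be tested with
   rho * (psi + d) ^ p instead of rho * psi * (psi + d) ^ (p - 1); then no
   passage to the limit in d is needed in the quadratic term. *)
Lemma main_estimate d rho : 0 < d -> 0 <= H -> Lip_c g rho -> (forall x, 0 <= rho x) ->
  schroedinger_nonneg g mu (fun x => H * a x) ->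
  H * weak (test_fun d rho) <= \int[mu]_x estimate_integrand d rho x.
Proof.
move=> d0 H0 lr r0 spec; have lt := Lip_c_test d0 lr.
pose phi := rho \* (fun x => (psi x + d) `^ p).
have lphi : Lip_c g phi by apply: Lip_c_mul => //; exact: Lip_loc_shift_powR.
have phi0 x : 0 <= phi x by rewrite /phi /= mulr_ge0 ?powR_ge0.
have cphi := bounded_csupp_Lip_c lphi.
have cW := bounded_csupp_Wint lt (fun x => test_ge0 d x r0).
have c1 : bounded_csupp (fun x => H * a x * phi x ^+ 2).
  apply: eq_bounded_csupp (bounded_csuppM (loc_boundedZ H (loc_bounded_continuous a_cont)) (bounded_csuppM (bounded_csupp_loc_bounded cphi) cphi)) => x.
  by rewrite expr2.
have c2 := bounded_csupp_carre_champ lphi phi0 (Lip_c_loc lphi).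
have := spec _ lphi; rewrite -subr_ge0 -(RintB hmu c2 c1) => sp.
rewrite weak_formE//; last by move=> x; exact: test_ge0.
rewrite -(RintZ hmu H cW).
apply: (@le_trans _ _ (\int[mu]_x (H * weak_integrand (test_fun d rho) x + (Gam phi phi x - H * a x * phi x ^+ 2)))).
  by rewrite (RintD hmu (bounded_csuppZ H cW) (bounded_csuppB c2 c1)) lerDl.
apply: (Rint_ae_le hmu); [by apply: bounded_csuppD; [exact: bounded_csuppZ|exact: bounded_csuppB]|exact: bounded_csupp_Iint|].
apply: ae_imp2 (ae_diffat hmu (Lip_c_loc lr)) (ae_diffat hmu psi_lip) => x dx px.
have s0 := shift_gt0 d0 x; set s := psi x + d in s0.
have [XE sE kE] := powR_sq s0.
have [dp gp] := grad_shift_powR d0 p px.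
have [dk gk] := grad_shift_powR d0 (2 * p - 2) px.
have Gphi : Gam phi phi x = (s `^ p) ^+ 2 * Gam rho rho x
    + 2 * (s `^ p * (rho x * (p * s `^ (p - 1)))) * Gam rho psi x + (rho x * (p * s `^ (p - 1))) ^+ 2 * Gam psi psi x.
  by rewrite /carre_champ /phi (grad_mul dx dp) gp scalerA addrC inner_sqr.
have Geta : Gam (test_fun d rho) psi x = 2 * rho x * s `^ (2 * p - 2) * Gam rho psi x
    + rho x ^+ 2 * ((2 * p - 2) * s `^ (2 * p - 2 - 1)) * Gam psi psi x.
  rewrite /carre_champ /test_fun (grad_mul dx (diffatM dx dk)) (grad_mul dx dk) gk scalerDr !scalerA !innerDl !innerZl /= -/s.
  by move: (inner g x _ _) (inner g x _ _) => b c; ring.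
rewrite /weak_integrand /estimate_integrand Gphi Geta -/s kE sE XE /test_fun /phi /= -/s sE XE.
have := a_ge0 x; have := psi_ge0 x.
have -> : psi x = s - d by rewrite /s addrK.
rewrite /disc; move: (Gam rho rho x) (Gam rho psi x) (Gam psi psi x) (s `^ (p - 1)) (rho x) (a x) => b c e Y r aa sd aa0.
(* The gradient terms agree exactly; the two sides differ only in the terms with a, by this multiple
   of s^2 - psi^2. *)
have h : 0 <= H * aa * (r * Y) ^+ 2 * (s ^+ 2 - (s - d) ^+ 2).
  rewrite mulr_ge0//; first by rewrite mulr_ge0 ?sqr_ge0// mulr_ge0.
  by rewrite subr_ge0 ler_sqr ?nnegrE ?(ltW s0)// gerBl ltW.
rewrite -subr_ge0 (_ : _ - _ = H * aa * (r * Y) ^+ 2 * (s ^+ 2 - (s - d) ^+ 2))//.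
by field; rewrite gt_eqF.
Qed.

End Estimate.

(** * Elementary inequalities for the integrand *)

Section Scalars.
Context {R : realType}.

Lemma small_powers (q1 q2 e : R) : 0 < q1 -> 0 < q2 -> 0 < e ->
  exists d : R, [/\ 0 < d, d <= 1, d <= e, d `^ q1 <= e & d `^ q2 <= e].
Proof.
move=> q10 q20 e0; pose d := Num.min (Num.min 1 e) (Num.min (e `^ q1^-1) (e `^ q2^-1)).
have d0 : 0 < d by rewrite !lt_min ltr01 e0 !powR_gt0.
have le_pow q : 0 < q -> d <= e `^ q^-1 -> d `^ q <= e.
  move=> q0 h; have := ge0_ler_powR (ltW q0) _ _ h; rewrite !nnegrE powR_ge0 (ltW d0) => /(_ isT isT).
  by rewrite -powRrM mulVf ?gt_eqF// powRr1// ltW.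
exists d; split=> //.
- by rewrite /d !ge_min lexx.
- by rewrite /d !ge_min lexx orbT.
- by apply: le_pow => //; rewrite /d !ge_min lexx !orbT.
- by apply: le_pow => //; rewrite /d !ge_min lexx !orbT.
Qed.

Lemma powR_mul_le (d s B q : R) : 0 < d -> d <= s -> s <= B -> d * s `^ q <= d `^ (q + 1) + d * B `^ q.
Proof.
move=> d0 ds sB; have := powR_le_sum q d0 ds sB; rewrite -(ler_pM2l d0) => /le_trans; apply.
have dn : d != 0 by rewrite gt_eqF.
by rewrite mulrDr lerD2r powRD ?dn ?implybT// powRr1 ?(ltW d0)// mulrC.
Qed.

Lemma powRD_le (q x y : R) : 0 <= q -> 0 <= x -> 0 <= y -> (x + y) `^ q <= 2 `^ q * (x `^ q + y `^ q).
Proof.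
move=> q0 x0 y0; wlog xy : x y x0 y0 / x <= y.
  by move=> h; have [/h|/ltW/h] := leP x y; [exact|rewrite addrC [X in _ * X]addrC; exact].
apply: (@le_trans _ _ ((2 * y) `^ q)).
  by apply: ge0_ler_powR; rewrite ?nnegrE ?addr_ge0 ?mulr_ge0//; lra.
by rewrite powRM// ler_wpM2l ?powR_ge0// lerDr powR_ge0.
Qed.

(** In the applications these are |grad rho|^2, <grad rho, grad psi> and |grad psi|^2 at a point,
    and the hypothesis is [carre_champ_quad]. *)
Variables (b c0 e : R).
Hypothesis (quad0 : forall al be : R, 0 <= al ^+ 2 * b + 2 * (al * be) * c0 + be ^+ 2 * e).

Lemma quad_b0 : 0 <= b.
Proof. by have := quad0 1 0; rewrite expr1n expr0n/= mulr0 mulr0 !mul0r mul1r !addr0. Qed.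

Lemma quad_e0 : 0 <= e.
Proof. by have := quad0 0 1; rewrite expr1n expr0n/= !mul0r mulr0 mul0r mul1r !add0r. Qed.

(** Here c = - D > 0. Young's inequality with weight 2 m / c spends half of c r^2 e on the cross
    term, leaving the coefficient c / 2; the cost m^2 is at most (p + H)^2 s^2 because 0 <= t <= s.
    The weight w replaces X in the surviving term so that it does not depend on d. *)
Lemma bound_neg (H k c p r s t d X w ep : R) : 0 < c -> 0 <= X -> w <= X -> 0 <= H -> 0 <= p ->
  0 <= t -> t <= s -> 0 <= ep -> H * k * (X * (d / s)) <= ep ->
  X * (s ^+ 2 * b + 2 * r * (p * s - H * t) * c0 + r ^+ 2 * e * (- c + H * k * (d / s))) <=
  (1 + 2 / c * (p + H) ^+ 2) * (X * s ^+ 2 * b) - c / 2 * (w * (r ^+ 2 * e)) + ep * (b + r ^+ 2 * e).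
Proof.
move=> c_gt0 X0 wX H0 p_ge0 t0 ts ep0 hk.
have b0 := quad_b0; have e0 := quad_e0.
have re0 : 0 <= r ^+ 2 * e by rewrite mulr_ge0// sqr_ge0.
set m := p * s - H * t.
have s0 : 0 <= s by exact: le_trans ts.
have t1 : 0 <= X * (2 / c * ((p + H) ^+ 2 * s ^+ 2 - m ^+ 2) * b).
  rewrite mulr_ge0// mulr_ge0// mulr_ge0//; first by rewrite divr_ge0// ltW.
  rewrite (_ : _ - _ = (H * s + H * t) * (2 * p * s + H * (s - t))); last by rewrite /m; ring.
  by rewrite mulr_ge0// addr_ge0// mulr_ge0// ?mulr_ge0// subr_ge0.
have t2 : 0 <= X * (c / 2 * ((2 * m / c) ^+ 2 * b + 2 * ((2 * m / c) * (- r)) * c0 + (- r) ^+ 2 * e)).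
  by rewrite mulr_ge0// mulr_ge0// divr_ge0// ltW.
have t3 : 0 <= c / 2 * (X - w) * (r ^+ 2 * e).
  by rewrite mulr_ge0// mulr_ge0 ?subr_ge0// divr_ge0// ltW.
have t4 : 0 <= (ep - H * k * (X * (d / s))) * (r ^+ 2 * e) by rewrite mulr_ge0// subr_ge0.
have t5 : 0 <= ep * b by rewrite mulr_ge0.
have cn : c != 0 by rewrite gt_eqF.
rewrite -subr_ge0.
rewrite (_ : _ - _ = X * (2 / c * ((p + H) ^+ 2 * s ^+ 2 - m ^+ 2) * b) +
  X * (c / 2 * ((2 * m / c) ^+ 2 * b + 2 * ((2 * m / c) * (- r)) * c0 + (- r) ^+ 2 * e)) +
  c / 2 * (X - w) * (r ^+ 2 * e) + (ep - H * k * (X * (d / s))) * (r ^+ 2 * e) + ep * b).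
  by rewrite !addr_ge0.
by move: (d / s) => ds; field.
Qed.

(** With p = H the cross coefficient p s - H t is H d. The cross term is then small together with X
    d and needs no help from the |grad psi|^2 term, whose leading coefficient D is 0. *)
Lemma bound_zero_pos (H k r s t d X ep : R) : s = t + d -> 0 <= X -> 0 <= H -> 0 <= d ->
  X * H * d <= ep / 2 -> H * k * (X * (d / s)) <= ep / 2 ->
  X * (s ^+ 2 * b + 2 * r * (H * s - H * t) * c0 + r ^+ 2 * e * (0 + H * k * (d / s))) <=
  X * s ^+ 2 * b + ep * (b + r ^+ 2 * e).
Proof.
move=> -> X0 H0 d0 h1 h2.
have b0 := quad_b0; have e0 := quad_e0.
have re0 : 0 <= r ^+ 2 * e by rewrite mulr_ge0// sqr_ge0.
have ep2 : 0 <= ep / 2 by apply: le_trans h1; rewrite !mulr_ge0.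
have t1 : 0 <= (ep / 2 - X * H * d) * (b + r ^+ 2 * e).
  by rewrite mulr_ge0//; [rewrite subr_ge0|rewrite addr_ge0].
have t2 : 0 <= (ep / 2 - H * k * (X * (d / (t + d)))) * (r ^+ 2 * e) by rewrite mulr_ge0// subr_ge0.
have t3 : 0 <= ep / 2 * b by rewrite mulr_ge0.
have t4 : 0 <= X * H * d * (1 ^+ 2 * b + 2 * (1 * (- r)) * c0 + (- r) ^+ 2 * e) by rewrite mulr_ge0// !mulr_ge0.
rewrite -subr_ge0.
rewrite (_ : _ - _ = (ep / 2 - X * H * d) * (b + r ^+ 2 * e) + (ep / 2 - H * k * (X * (d / (t + d)))) * (r ^+ 2 * e) +
  ep / 2 * b + X * H * d * (1 ^+ 2 * b + 2 * (1 * (- r)) * c0 + (- r) ^+ 2 * e)).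
  by rewrite !addr_ge0.
by move: (d / (t + d)) => ds; field.
Qed.

(** For a negative exponent X d need not be small, but then the term with d / s has a favourable
    sign and absorbs the cross term by Young's inequality with weight s / m. What remains involves X
    d s, which can be made small since p > 0. *)
Lemma bound_zero_neg (H m r s t d X ep : R) : s = t + d -> 0 < s -> 0 < m -> 0 <= X -> 0 <= H -> 0 <= d ->
  X * H * d * (s / m) <= ep ->
  X * (s ^+ 2 * b + 2 * r * (H * s - H * t) * c0 + r ^+ 2 * e * (0 + H * (- m) * (d / s))) <=
  X * s ^+ 2 * b + ep * (b + r ^+ 2 * e).
Proof.
move=> sE s0 m0 X0 H0 d0 h1; have -> : t = s - d by rewrite sE addrK.
have b0 := quad_b0; have e0 := quad_e0.
have re0 : 0 <= r ^+ 2 * e by rewrite mulr_ge0// sqr_ge0.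
have sm0 : 0 <= s / m by rewrite divr_ge0// ltW.
have ms0 : 0 <= m / s by rewrite divr_ge0// ltW.
have ep0 : 0 <= ep by apply: le_trans h1; rewrite mulr_ge0// !mulr_ge0.
have t1 : 0 <= (ep - X * H * d * (s / m)) * b by rewrite mulr_ge0// subr_ge0.
have t2 : 0 <= ep * (r ^+ 2 * e) by rewrite mulr_ge0.
have t3 : 0 <= X * H * d * (m / s) * ((s / m) ^+ 2 * b + 2 * ((s / m) * (- r)) * c0 + (- r) ^+ 2 * e).
  by rewrite mulr_ge0// mulr_ge0// !mulr_ge0.
rewrite -subr_ge0.
rewrite (_ : _ - _ = (ep - X * H * d * (s / m)) * b + ep * (r ^+ 2 * e) +
  X * H * d * (m / s) * ((s / m) ^+ 2 * b + 2 * ((s / m) * (- r)) * c0 + (- r) ^+ 2 * e)).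
  by rewrite !addr_ge0.
by field; rewrite !gt_eqF.
Qed.

End Scalars.

(** * Cutoffs at infinity *)

Lemma powR_anti (R : realType) (q x y : R) : q <= 0 -> 0 < x -> x <= y -> y `^ q <= x `^ q.
Proof.
move=> q0 x0 xy; have y0 := lt_le_trans x0 xy.
rewrite -[q]opprK (powRN x) (powRN y) lef_pV2 ?posrE ?powR_gt0//.
by apply: ge0_ler_powR; rewrite ?nnegrE ?oppr_ge0// ltW.
Qed.

Lemma le_powR (R : realType) (q x y : R) : 0 <= q -> 0 <= x -> x <= y -> x `^ q <= y `^ q.
Proof. by move=> q0 x0 xy; apply: ge0_ler_powR; rewrite ?nnegrE// (le_trans x0). Qed.

Section Cutoff.
Context {R : realType} {n : nat} {M : ptopologicalType} (g : riemannian_manifold R n M).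
Variable mu : {measure set (borelType M) -> \bar R}.
Hypotheses (hmu : is_volume g mu) (cM : rm_complete g).
Implicit Types (x y z : M) (u w f h eta rho : M -> R).
Local Notation bM := (borelType M).
Variables (psi a : M -> R) (A H p : R) (o : M).
Hypotheses (psi_ge0 : forall x, 0 <= psi x) (psi_lip : Lip_loc g psi).
Hypotheses (a_ge0 : forall x, 0 <= a x) (a_cont : continuous a).
Hypotheses (p0 : 0 < p) (H0 : 0 < H).
Local Notation weak := (weak_form g mu a A psi).
Local Notation Gam := (carre_champ g).
Local Notation Iint := (estimate_integrand g psi A H p).
Local Notation test := (test_fun psi p).

(* The terms of the integrand which vanish as d tends to 0 are absorbed in ep. *)
Definition integrand_bound (C1 c' : R) w := forall B1 ep : R, 1 <= B1 -> 0 < ep -> exists d : R,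
  [/\ 0 < d, d <= 1, d <= ep, d `^ (2 * p) <= ep & forall rho x, psi x + 1 <= B1 ->
    Iint d rho x <= C1 * ((psi x + d) `^ (2 * p) * Gam rho rho x) - c' * (w x * (rho x ^+ 2 * Gam psi psi x))
      + ep * (Gam rho rho x + rho x ^+ 2 * Gam psi psi x)].

Lemma powR_2p (s : R) : 0 < s -> s `^ (2 * p) = s `^ (2 * p - 2) * s ^+ 2.
Proof.
move=> s0; have sn : s != 0 by rewrite gt_eqF.
by rewrite -(powR_mulrn _ (ltW s0)) -powRD ?sn ?implybT// subrK.
Qed.

Lemma mul_small (e N t : R) : 0 <= N -> 0 < e -> t <= e / (N + 1) -> 0 <= t -> N * t <= e.
Proof.
move=> N0 e0; have N1 : 0 < N + 1 by rewrite ltr_wpDl.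
by rewrite ler_pdivlMr// => h t0; apply: le_trans h; rewrite mulrDr mulr1 mulrC lerDl.
Qed.

(** The error is H k d s^(k - 1), and d s^(k - 1) <= d^k + d B1^(k - 1); this explains the
    denominators. *)
Lemma err_le (k B1 d s e : R) : 0 <= k -> 0 < e -> 0 < d -> d <= s -> s <= B1 -> 0 < B1 ->
  d <= e / (H * k * (1 + B1 `^ (k - 1)) + 1) -> d `^ k <= e / (H * k * (1 + B1 `^ (k - 1)) + 1) ->
  H * k * (s `^ k * (d / s)) <= e.
Proof.
move=> k0 e0 d0 ds sB B10 h1 h2; have s0 := lt_le_trans d0 ds; have sn : s != 0 by rewrite gt_eqF.
have Hk : 0 <= H * k by rewrite mulr_ge0// ltW.
have -> : s `^ k * (d / s) = d * s `^ (k - 1).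
  by rewrite powRD ?sn ?implybT// powR_inv1 ?(ltW s0)//; ring.
set N := H * k * (1 + B1 `^ (k - 1)) in h1 h2.
have N0 : 0 <= N by rewrite /N mulr_ge0// addr_ge0// powR_ge0.
apply: (@le_trans _ _ (H * k * (e / (N + 1) * (1 + B1 `^ (k - 1))))).
  rewrite ler_wpM2l//; apply: le_trans (powR_mul_le (k - 1) d0 ds sB) _.
  rewrite subrK mulrDr mulr1 lerD//; first by rewrite ler_wpM2r// powR_ge0.
rewrite mulrCA -/N mulrC -/N; apply: mul_small => //.
by rewrite divr_ge0 ?ltW// ltr_wpDl.
Qed.

(** The weight is a lower bound of (psi + d)^(2 p - 2) valid for all d in ]0, 1]: the value at d = 1
    for a nonpositive exponent, the value at d = 0 otherwise. *)
Lemma integrand_bound_neg : disc A H p < 0 ->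
  integrand_bound (1 + 2 / (- disc A H p) * (p + H) ^+ 2) (- disc A H p / 2)
    (fun x => if 2 * p - 2 <= 0 then (psi x + 1) `^ (2 * p - 2) else psi x `^ (2 * p - 2)).
Proof.
move=> D0 B1 ep B11 ep0; set c := - disc A H p; set k := 2 * p - 2.
have c0 : 0 < c by rewrite oppr_gt0.
have B10 : 0 < B1 by exact: lt_le_trans B11.
have p20 : 0 < 2 * p by rewrite mulr_gt0.
have DE : disc A H p = - c by rewrite opprK.
(* For k <= 0 the error term with d / s is nonpositive, so nothing has to be made small for it. *)
have [k0|k0] := leP k 0.
  have [d [d0 d1 de dp _]] := small_powers p20 ltr01 ep0.
  exists d; split => // rho x xB.
  have s0 : 0 < psi x + d by rewrite ltr_wpDl.
  rewrite (powR_2p s0) /estimate_integrand DE.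
  have wX : (psi x + 1) `^ k <= (psi x + d) `^ k by apply: powR_anti => //; rewrite lerD2l.
  have ts : psi x <= psi x + d by rewrite lerDl ltW.
  have hk : H * k * ((psi x + d) `^ k * (d / (psi x + d))) <= ep.
    apply: le_trans (ltW ep0); apply: mulr_le0_ge0; first by rewrite pmulr_rle0.
    by rewrite mulr_ge0 ?powR_ge0// divr_ge0// ltW.
  exact: (bound_neg (carre_champ_quad g rho psi x) _ c0 (powR_ge0 _ _) wX (ltW H0) (ltW p0) (psi_ge0 x) ts (ltW ep0) hk).
set N := H * k * (1 + B1 `^ (k - 1)).
have N0 : 0 < N + 1.
  by rewrite ltr_wpDl// mulr_ge0//; [rewrite mulr_ge0// ltW|rewrite addr_ge0// powR_ge0].
have e0 : 0 < Num.min ep (ep / (N + 1)) by rewrite lt_min ep0 divr_gt0.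
have [d [d0 d1]] := small_powers p20 k0 e0.
rewrite !le_min => /andP[de deN] /andP[dp _] /andP[_ dk].
exists d; split => // rho x xB.
have s0 : 0 < psi x + d by rewrite ltr_wpDl.
rewrite (powR_2p s0) /estimate_integrand DE.
have ts : psi x <= psi x + d by rewrite lerDl ltW.
have wX : psi x `^ k <= (psi x + d) `^ k by exact: le_powR (ltW k0) (psi_ge0 x) ts.
have hk : H * k * ((psi x + d) `^ k * (d / (psi x + d))) <= ep.
  apply: (@err_le k B1) => //; rewrite ?(ltW k0)//; first by rewrite lerDr.
  by apply: le_trans xB; rewrite lerD2l.
exact: (bound_neg (carre_champ_quad g rho psi x) _ c0 (powR_ge0 _ _) wX (ltW H0) (ltW p0) (psi_ge0 x) ts (ltW ep0) hk).
Qed.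

Lemma integrand_bound_zero w : p = H -> disc A H p = 0 -> integrand_bound 1 0 w.
Proof.
move=> pH D0 B1 ep B11 ep0; set k := 2 * p - 2.
have B10 : 0 < B1 by exact: lt_le_trans B11.
have p20 : 0 < 2 * p by rewrite mulr_gt0.
have B1p q : 0 <= 1 + B1 `^ q by rewrite addr_ge0// powR_ge0.
have ep2 : 0 < ep / 2 by rewrite divr_gt0.
have [k0|k0] := leP 0 k.
  set N := H * k * (1 + B1 `^ (k - 1)); set N' := H * (1 + B1 `^ k).
  have N0 : 0 <= N by rewrite mulr_ge0// mulr_ge0// ltW.
  have N'0 : 0 <= N' by rewrite mulr_ge0// ltW.
  have e0 : 0 < Num.min ep (Num.min (ep / 2 / (N + 1)) (ep / 2 / (N' + 1))).
    by rewrite !lt_min ep0 !divr_gt0// ltr_wpDl.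
  (* When k = 0 the error to be controlled by d^k has the factor k and vanishes; 1 is a placeholder
     keeping the exponent positive. *)
  pose q := if 0 < k then k else 1.
  have q0 : 0 < q by rewrite /q; case: ifP.
  have [d [d0 d1]] := small_powers p20 q0 e0.
  rewrite !le_min => /andP[de /andP[deN deN']] /andP[dp _] /andP[_ /andP[dk _]].
  exists d; split => // rho x xB.
  have s0 : 0 < psi x + d by rewrite ltr_wpDl.
  have ds : d <= psi x + d by rewrite lerDr.
  have sB : psi x + d <= B1 by apply: le_trans xB; rewrite lerD2l.
  rewrite (powR_2p s0) /estimate_integrand D0 mul0r subr0 mul1r {2}pH -/k.
  apply: (bound_zero_pos (carre_champ_quad g rho psi x) (k := k)) => //; rewrite ?powR_ge0 ?(ltW H0) ?(ltW d0)//.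
    have -> : (psi x + d) `^ k * H * d = H * (d * (psi x + d) `^ k) by ring.
    apply: (@le_trans _ _ (H * (d * (1 + B1 `^ k)))).
      rewrite ler_wpM2l ?(ltW H0)//; apply: le_trans (powR_mul_le k d0 ds sB) _.
      have dn : d != 0 by rewrite gt_eqF.
      rewrite mulrDr mulr1 lerD2r powRD ?dn ?implybT// powRr1 ?(ltW d0)// ger_pMl//.
      by apply: le_trans (le_powR k0 (ltW d0) d1) _; rewrite powR1.
    by rewrite mulrCA -/N' mulrC; apply: mul_small => //; exact: ltW.
  move: dk; rewrite /q; case: ifPn => [kp dk|]; last first.
    by rewrite -leNgt => kn _; have -> : k = 0 by [apply/le_anti; rewrite kn]; rewrite mulr0 mul0r ltW.
  exact: (@err_le k B1).
(* The remaining error is (H / m) d s^(k + 1); since k + 2 = 2 p it is controlled by d^(2 p) and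
   d. *)
set m := - k; have m0 : 0 < m by rewrite oppr_gt0.
set N := H / m * (1 + B1 `^ (k + 1)).
have N0 : 0 <= N by rewrite mulr_ge0// divr_ge0// ltW.
have e0 : 0 < Num.min ep (ep / (N + 1)) by rewrite lt_min ep0 divr_gt0// ltr_wpDl.
have [d [d0 d1]] := small_powers p20 ltr01 e0.
rewrite !le_min => /andP[de deN] /andP[dp dpN] _.
exists d; split => // rho x xB.
have s0 : 0 < psi x + d by rewrite ltr_wpDl.
have ds : d <= psi x + d by rewrite lerDr.
have sB : psi x + d <= B1 by apply: le_trans xB; rewrite lerD2l.
rewrite (powR_2p s0) /estimate_integrand D0 mul0r subr0 mul1r {2}pH -/k.
have -> : H * k = H * (- m) by rewrite opprK.
apply: (bound_zero_neg (carre_champ_quad g rho psi x)) => //; rewrite ?powR_ge0 ?(ltW H0) ?(ltW d0)//.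
set s := psi x + d in s0 ds sB *.
have sn : s != 0 by rewrite gt_eqF.
have -> : s `^ k * H * d * (s / m) = H / m * (d * s `^ (k + 1)).
  have -> : s `^ (k + 1) = s `^ k * s by rewrite [LHS]powRD ?sn ?implybT// powRr1// ltW.
  by ring.
apply: (@le_trans _ _ (H / m * (ep / (N + 1) * (1 + B1 `^ (k + 1))))).
  rewrite ler_wpM2l ?divr_ge0 ?(ltW H0) ?(ltW m0)//; apply: le_trans (powR_mul_le (k + 1) d0 ds sB) _.
  rewrite mulrDr mulr1 lerD//; last by rewrite ler_wpM2r// powR_ge0.
  by rewrite (_ : k + 1 + 1 = 2 * p)// /k; ring.
rewrite mulrCA -/N mulrC; apply: mul_small => //.
by rewrite divr_ge0 ?(ltW ep0)// addr_ge0.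
Qed.

Lemma carre_champ_cutoff_le r x : 0 < r -> Gam (cutoff g o r) (cutoff g o r) x <= 4 / r ^+ 2.
Proof.
move=> r0; have -> : 4 / r ^+ 2 = (2 / r) ^+ 2 by rewrite expr_div_n; congr (_ / _); ring.
apply: grad_lip; first by rewrite divr_ge0// ltW.
by apply: nearW => y; rewrite distrC; exact: cutoff_lip.
Qed.

Lemma carre_champ_eq0_at rho u x : (forall x, 0 <= rho x) -> rho x = 0 -> Gam rho u x = 0.
Proof. by move=> r0 rx; rewrite /carre_champ grad_min0// inner0l. Qed.

Definition ball_indic r : M -> R := \1_(geodesic_ball g o r).

Lemma bounded_csupp_ball_indic r : bounded_csupp (ball_indic r).
Proof.
have mB : measurable (geodesic_ball g o r : set bM) by apply: borel_open; exact: open_geodesic_ball.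
apply: (@loc_bounded_bounded_csupp _ _ (cball g o r)); last 2 first.
- exact: hopf_rinow.
- by move=> x nx; rewrite /ball_indic indicE memNset// => /ltW.
split; first exact: (measurable_indic mB).
by move=> K _; exists 1 => x _; rewrite /ball_indic indicE; case: (_ \in _); rewrite ?normr1 ?normr0.
Qed.

Lemma loc_bounded_powR q : 0 <= q -> loc_bounded (fun x => psi x `^ q).
Proof.
move=> q0; have [mp bp] := loc_bounded_Lip_loc psi_lip; split.
  exact: (measurableT_comp (measurable_powR q) mp).
move=> K cK; have [B HB] := bp K cK; exists (B `^ q) => x Kx.
rewrite ger0_norm ?powR_ge0//; apply: le_powR => //.
by have := HB x Kx; rewrite ger0_norm.
Qed.

Lemma integral_ball_indic f r : bounded_csupp (fun x => f x * ball_indic r x) ->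
  ((\int[mu]_x (f x * ball_indic r x))%:E = \int[mu]_(x in (geodesic_ball g o r : set bM)) (f x)%:E)%E.
Proof.
move=> cf; rewrite /Rintegral fineK; last exact: integrable_fin_num (bounded_csupp_integrable hmu cf).
rewrite [RHS]integral_mkcond; apply: eq_integral => x _.
by rewrite patchE /ball_indic indicE; case: (_ \in _); rewrite ?mulr1 ?mulr0.
Qed.

(** The constant collects 2^(2 p) from splitting (psi + d)^(2 p), 4 / r^2 from the slope of the
    cutoff, and 2 for the two integrals, each at most e r^2. *)
Lemma integral_cutoff_le d r e : 0 < d -> 0 < r ->
  (\int[mu]_(x in (geodesic_ball g o r : set bM)) (psi x `^ (2 * p))%:E <= (e * r ^+ 2)%:E)%E ->
  d `^ (2 * p) * \int[mu]_x ball_indic r x <= e * r ^+ 2 ->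
  \int[mu]_x ((psi x + d) `^ (2 * p) * Gam (cutoff g o r) (cutoff g o r) x) <= 8 * 2 `^ (2 * p) * e.
Proof.
move=> d0 r0 G1 G2; set rho := cutoff g o r.
have lr : Lip_c g rho by exact: cutoff_Lip_c.
have rho0 x : 0 <= rho x by exact: cutoff_ge0.
have p20 : 0 <= 2 * p by rewrite mulr_ge0// ltW.
have ci := bounded_csupp_ball_indic r.
have c1 : bounded_csupp (fun x => psi x `^ (2 * p) * ball_indic r x) by apply: bounded_csuppM => //; exact: loc_bounded_powR.
pose K := 2 `^ (2 * p) * (4 / r ^+ 2).
have r2 : 0 < r ^+ 2 by rewrite exprn_gt0.
have K0 : 0 <= K by rewrite mulr_ge0 ?powR_ge0// divr_ge0// ltW.
have cK := bounded_csuppZ K (bounded_csuppD c1 (bounded_csuppZ (d `^ (2 * p)) ci)).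
apply: (@le_trans _ _ (\int[mu]_x (K * (psi x `^ (2 * p) * ball_indic r x + d `^ (2 * p) * ball_indic r x)))).
  apply: (Rint_ae_le hmu _ cK).
    apply: bounded_csuppM; last by apply: bounded_csupp_carre_champ => //; exact: Lip_c_loc.
    exact: loc_bounded_Lip_loc (Lip_loc_shift_powR psi_ge0 psi_lip d0 _).
  apply: aeW => x; have [xr|xr] := ltP (rdist g o x) r; last first.
    rewrite [X in _ * X]carre_champ_eq0_at ?mulr0//; last exact: cutoff0.
    rewrite mulr_ge0// addr_ge0// mulr_ge0 ?powR_ge0// /ball_indic indicE; by case: (_ \in _).
  have -> : ball_indic r x = 1 by rewrite /ball_indic indicE mem_set.
  rewrite !mulr1 /K mulrAC; apply: ler_pM; rewrite ?powR_ge0//; first exact: carre_champ_ge0.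
    by apply: powRD_le => //; exact: ltW.
  exact: carre_champ_cutoff_le.
rewrite (RintZ hmu K (bounded_csuppD c1 (bounded_csuppZ _ ci))) (RintD hmu c1 (bounded_csuppZ _ ci)) (RintZ hmu _ ci).
have h1 : \int[mu]_x (psi x `^ (2 * p) * ball_indic r x) <= e * r ^+ 2 by rewrite -lee_fin integral_ball_indic.
apply: (@le_trans _ _ (K * (e * r ^+ 2 + e * r ^+ 2))); first by rewrite ler_wpM2l// lerD.
rewrite le_eqVlt; apply/orP; left; apply/eqP; rewrite /K; field.
by rewrite gt_eqF.
Qed.

Hypothesis growth : forall eps : R, 0 < eps -> \forall r \near +oo_R,
  (\int[mu]_(x in (geodesic_ball g o r : set bM)) (psi x `^ (2 * p))%:E <= (eps * r ^+ 2)%:E)%E.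
Hypothesis spec : schroedinger_nonneg g mu (fun x => H * a x).

(** The radius is chosen first, from the growth condition, and d afterwards: how small d must be
    depends on the measure of the ball, on the bound of psi there and on the integral N of the error
    term. *)
Lemma cutoff_bound C1 c' w : integrand_bound C1 c' w -> 0 <= C1 -> loc_bounded w -> forall ep r0 : R, 0 < ep ->
  exists r d : R, [/\ r0 <= r, 0 < r, 0 < d, d <= 1 &
    H * weak (test d (cutoff g o r)) + c' * \int[mu]_x (w x * (cutoff g o r x ^+ 2 * Gam psi psi x)) <= ep].
Proof.
move=> pw C10 lw ep r0 ep0.
pose C0 := 8 * 2 `^ (2 * p); have C00 : 0 <= C0 by rewrite mulr_ge0// powR_ge0.
have ep2 : 0 < ep / 2 by rewrite divr_gt0.
have CC : 0 <= C1 * C0 by rewrite mulr_ge0.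
pose e1 := ep / 2 / (C1 * C0 + 1).
have e10 : 0 < e1 by rewrite divr_gt0// ltr_wpDl.
have [r [G1 rr]] : exists r : R, (\int[mu]_(x in (geodesic_ball g o r : set bM)) (psi x `^ (2 * p))%:E <= (e1 * r ^+ 2)%:E)%E
    /\ Num.max r0 0 < r.
  by have [r []] := filter_ex (filterI (growth e10) (nbhs_pinfty_gt (num_real (Num.max r0 0)))); exists r.
move: rr; rewrite gt_max => /andP[r0r r_gt0].
set rho := cutoff g o r.
have lr : Lip_c g rho by exact: cutoff_Lip_c.
have rho0 x : 0 <= rho x by exact: cutoff_ge0.
have cr := bounded_csupp_Lip_c lr.
have lG := loc_bounded_carre_champ psi_lip psi_lip.
have cG : bounded_csupp (Gam rho rho) by apply: bounded_csupp_carre_champ => //; exact: Lip_c_loc.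
have cP : bounded_csupp (fun x => rho x ^+ 2 * Gam psi psi x).
  by apply: eq_bounded_csupp (bounded_csuppM lG (bounded_csuppM (bounded_csupp_loc_bounded cr) cr)) => x; rewrite expr2 mulrC.
have cF3 := bounded_csuppD cG cP.
have cF2 := bounded_csuppM lw cP.
set N := \int[mu]_x (Gam rho rho x + rho x ^+ 2 * Gam psi psi x).
have N0 : 0 <= N.
  apply: (Rint_ae_ge0 cF3); apply: aeW => x.
  by rewrite addr_ge0 ?carre_champ_ge0// mulr_ge0 ?sqr_ge0// carre_champ_ge0.
set m := \int[mu]_x ball_indic r x.
have m0 : 0 <= m.
  by apply: (Rint_ae_ge0 (bounded_csupp_ball_indic r)); apply: aeW => x; rewrite /ball_indic indicE; case: (_ \in _).
have [B B0 HB] := compact_bounded (@hopf_rinow _ _ _ g o r cM) (Lip_loc_continuous psi_lip).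
have r2 : 0 < r ^+ 2 by rewrite exprn_gt0.
(* The first entry makes the error terms at most ep / 2; the second makes d^(2 p) times the measure
   of the ball at most e1 r^2, as needed in [integral_cutoff_le]. *)
pose e2 := Num.min (ep / 2 / (N + 1)) (e1 * r ^+ 2 / (m + 1)).
have e20 : 0 < e2.
  by rewrite lt_min; apply/andP; split; apply: divr_gt0; rewrite ?ltr_wpDl// mulr_gt0.
have B11 : 1 <= B + 1 by rewrite lerDr ltW.
have [d [d0 d1 de dp Hd]] := pw _ _ B11 e20.
exists r, d; split => //; first exact: ltW.
have G2 : d `^ (2 * p) * m <= e1 * r ^+ 2.
  rewrite mulrC; apply: (mul_small m0 (mulr_gt0 e10 r2)); last exact: powR_ge0.
  by apply: le_trans dp _; rewrite /e2 ge_min lexx orbT.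
have J := integral_cutoff_le d0 r_gt0 G1 G2; rewrite -/rho -/C0 in J.
have cF1 : bounded_csupp (fun x => (psi x + d) `^ (2 * p) * Gam rho rho x).
  apply: bounded_csuppM => //; exact: loc_bounded_Lip_loc (Lip_loc_shift_powR psi_ge0 psi_lip d0 _).
have cI := bounded_csupp_Iint A psi_ge0 psi_lip H p d0 lr rho0.
have E := main_estimate hmu A psi_ge0 psi_lip a_ge0 a_cont p d0 (ltW H0) lr rho0 spec.
have cR := bounded_csuppD (bounded_csuppB (bounded_csuppZ C1 cF1) (bounded_csuppZ c' cF2)) (bounded_csuppZ e2 cF3).
have h : \int[mu]_x Iint d rho x <= \int[mu]_x (C1 * ((psi x + d) `^ (2 * p) * Gam rho rho x)
    - c' * (w x * (rho x ^+ 2 * Gam psi psi x)) + e2 * (Gam rho rho x + rho x ^+ 2 * Gam psi psi x)).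
  apply: (Rint_ae_le hmu cI cR); apply: aeW => x.
  (* The pointwise bound is available only where psi <= B, that is on the ball; elsewhere rho = 0
     and both sides vanish. *)
  have [xr|xr] := leP (rdist g o x) r.
    apply: Hd; rewrite lerD2r; have := HB x xr; exact: le_trans (ler_norm _).
  have rx : rho x = 0 by apply: cutoff0 => //; exact: ltW.
  by rewrite /estimate_integrand !(carre_champ_eq0_at _ rho0 rx) rx expr0n/= !(mul0r, mulr0, addr0, add0r, subr0, oppr0).
move: h.
rewrite (RintD hmu (bounded_csuppB (bounded_csuppZ C1 cF1) (bounded_csuppZ c' cF2)) (bounded_csuppZ e2 cF3)) (RintB hmu (bounded_csuppZ C1 cF1) (bounded_csuppZ c' cF2)).
rewrite (RintZ hmu C1 cF1) (RintZ hmu c' cF2) (RintZ hmu e2 cF3) -/N => h.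
have h1 : C1 * \int[mu]_x ((psi x + d) `^ (2 * p) * Gam rho rho x) <= ep / 2.
  apply: (@le_trans _ _ (C1 * (C0 * e1))); first by rewrite ler_wpM2l.
  by rewrite mulrA; apply: mul_small => //; exact: ltW.
have h2 : e2 * N <= ep / 2.
  rewrite mulrC; apply: mul_small => //; last exact: ltW.
  by rewrite /e2 ge_min lexx.
move: E h h1 h2; set W := weak _; set I1 := \int[mu]_x Iint _ _ _; set J1 := \int[mu]_x (_ * Gam rho rho _).
set J2 := \int[mu]_x (w _ * _); lra.
Qed.

End Cutoff.

(** * The constant case and the equality case *)

Section Conclusion.
Context {R : realType} {n : nat} {M : ptopologicalType} (g : riemannian_manifold R n M).
Variable mu : {measure set (borelType M) -> \bar R}.
Hypotheses (hmu : is_volume g mu) (cM : rm_complete g).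
Implicit Types (x y z : M) (u w f h eta rho : M -> R).
Local Notation bM := (borelType M).
Variables (psi a : M -> R) (A H p : R) (o : M).
Hypotheses (psi_ge0 : forall x, 0 <= psi x) (psi_lip : Lip_loc g psi).
Hypotheses (a_ge0 : forall x, 0 <= a x) (a_cont : continuous a).
Hypotheses (p0 : 0 < p) (H0 : 0 < H).
Hypothesis growth : forall eps : R, 0 < eps -> \forall r \near +oo_R,
  (\int[mu]_(x in (geodesic_ball g o r : set bM)) (psi x `^ (2 * p))%:E <= (eps * r ^+ 2)%:E)%E.
Hypothesis spec : schroedinger_nonneg g mu (fun x => H * a x).
Hypothesis psi_sub : distributional_subsolution g mu a A psi.
Local Notation weak := (weak_form g mu a A psi).
Local Notation Gam := (carre_champ g).
Local Notation test := (test_fun psi p).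

Lemma cutoff_mono (r r' : R) x : 0 < r -> r <= r' -> cutoff g o r x <= cutoff g o r' x.
Proof.
move=> r0 rr'; have r'0 := lt_le_trans r0 rr'.
have h : 2 - 2 * (rdist g o x / r) <= 2 - 2 * (rdist g o x / r').
  rewrite lerD2l lerN2 ler_wpM2l// ler_wpM2l ?rdist_ge0//.
  by rewrite lef_pV2.
rewrite /cutoff ge_max; apply/andP; split; first by rewrite le_max lexx.
rewrite le_max; apply/orP; right; rewrite le_min; apply/andP; split; first by rewrite ge_min lexx.
by rewrite ge_min h orbT.
Qed.

Lemma weak_test_ge0 d rho : 0 < d -> Lip_c g rho -> (forall x, 0 <= rho x) -> 0 <= weak (test d rho).
Proof.
move=> d0 lr rho0; apply: psi_sub; first exact: Lip_c_test.
by move=> x; exact: test_ge0.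
Qed.

(** The weighted energy of psi on a cutoff grows with the radius and is bounded by any ep for
    suitable large radii, so it is 0 for every radius. The weight does not depend on d, which is
    what permits this comparison. *)
Lemma constant_case : disc A H p < 0 -> exists c : R, forall x, psi x = c.
Proof.
move=> D0; have pw := integrand_bound_neg g psi_ge0 p0 H0 D0.
set w := fun x : M => _ in pw.
have w0 x : 0 <= w x by rewrite /w; case: ifP; rewrite powR_ge0.
have lw : loc_bounded w.
  rewrite /w; case: (leP (2 * p - 2) 0) => k0; last by apply: loc_bounded_powR => //; exact: ltW.
  exact: loc_bounded_Lip_loc (Lip_loc_shift_powR psi_ge0 psi_lip ltr01 _).
have c0 : 0 < - disc A H p / 2 by rewrite divr_gt0// oppr_gt0.
have C10 : 0 <= 1 + 2 / - disc A H p * (p + H) ^+ 2.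
  by rewrite addr_ge0// mulr_ge0 ?sqr_ge0// divr_ge0// oppr_ge0 ltW.
have lG := loc_bounded_carre_champ psi_lip psi_lip.
have cF r : 0 < r -> bounded_csupp (fun x => w x * (cutoff g o r x ^+ 2 * Gam psi psi x)).
  move=> r0; apply: bounded_csuppM => //.
  have cr := bounded_csupp_Lip_c (cutoff_Lip_c o cM r0).
  by apply: eq_bounded_csupp (bounded_csuppM lG (bounded_csuppM (bounded_csupp_loc_bounded cr) cr)) => x; rewrite expr2 mulrC.
have F0 r x : 0 <= w x * (cutoff g o r x ^+ 2 * Gam psi psi x).
  by rewrite mulr_ge0// mulr_ge0 ?sqr_ge0// carre_champ_ge0.
have I0 r : 0 < r -> \int[mu]_x (w x * (cutoff g o r x ^+ 2 * Gam psi psi x)) = 0.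
  move=> r0; apply/le_anti/andP; split; last first.
    by apply: (Rint_ae_ge0 (cF r r0)); apply: aeW => x; exact: F0.
  apply/ler_addgt0Pr => ep ep0; rewrite add0r.
  (* The budget is multiplied by the coefficient of the energy, here - D / 2; the weak term has the
     right sign and is dropped. *)
  have [r' [d [rr' r'0 d0 d1]]] := cutoff_bound hmu cM psi_ge0 psi_lip a_ge0 a_cont p0 H0 growth spec pw C10 lw r (mulr_gt0 ep0 c0).
  have W0 : 0 <= H * weak (test d (cutoff g o r')).
    rewrite mulr_ge0 ?(ltW H0)// weak_test_ge0//; first exact: cutoff_Lip_c.
    by move=> x; exact: cutoff_ge0.
  set J := (\int[mu]_x (w x * (cutoff g o r' x ^+ 2 * Gam psi psi x))) => h.
  have : J <= ep.
    have : - disc A H p / 2 * J <= ep * (- disc A H p / 2) by apply: le_trans h; rewrite lerDr.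
    by rewrite (mulrC ep) ler_pM2l.
  apply: le_trans; apply: (Rint_ae_le hmu (cF r r0) (cF r' r'0)); apply: aeW => x.
  rewrite ler_wpM2l// ler_wpM2r ?carre_champ_ge0//.
  by rewrite ler_sqr ?nnegrE ?cutoff_ge0// cutoff_mono.
apply: (carre_champ0_const hmu psi_lip).
have : {ae mu, forall x : bM, forall m : nat, w x * (cutoff g o m.+1%:R x ^+ 2 * Gam psi psi x) = 0}.
  apply: ae_forallc => m; apply: (Rint_eq0 hmu (cF _ _)) => //; exact: I0.
apply: ae_imp => x Hx.
have [m xm] : exists m : nat, rdist g o x <= m.+1%:R / 2.
  exists (Num.truncn (2 * rdist g o x)); rewrite ler_pdivlMr// mulrC.
  exact/ltW/truncnS_gt.
have m0 : 0 < m.+1%:R :> R by [].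
have := Hx m; rewrite cutoff1// expr1n mul1r => /eqP; rewrite mulf_eq0 => /orP[/eqP wx|/eqP//].
(* Where the weight vanishes the energy says nothing, but there psi is at its minimum and has zero
   gradient anyway. *)
suff px : psi x = 0 by rewrite /carre_champ grad_min0// inner0l.
move: wx; rewrite /w; case: (leP (2 * p - 2) 0) => k0 wx.
  have : 0 < (psi x + 1) `^ (2 * p - 2) by rewrite powR_gt0// ltr_wpDl.
  by rewrite wx ltxx.
by apply: (powR_eq0_eq0 wx).
Qed.

(** With C a bound for eta divided by a lower bound of s^(2 A) on its support, the function C test -
    eta is an admissible test function. Hence 0 <= weak eta <= C weak test, and the right-hand side
    is arbitrarily small while C is fixed. *)
Lemma equality_case eta : p = H -> H = A + 1 -> Lip_c g eta -> (forall x, 0 <= eta x) ->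
  (A <= 0 \/ forall x, supp eta x -> 0 < psi x) -> weak eta = 0.
Proof.
move=> pH HA le e0 Apos.
have D0 : disc A H p = 0 by rewrite /disc pH -HA; ring.
have kA : 2 * p - 2 = 2 * A by rewrite pH HA; ring.
have pw := integrand_bound_zero g psi_ge0 p0 H0 (fun=> 0) pH D0.
apply/le_anti/andP; split; last exact: psi_sub.
have cs := le.2; have ce := Lip_loc_continuous (Lip_c_loc le).
have [Be Be0 HBe] := compact_bounded cs ce.
have [r0 r00 Hr0] := compact_bounded cs (@rdist_continuous _ _ _ g o).
have [B B0 HB] := compact_bounded cs (Lip_loc_continuous psi_lip).
(* Uniformity in d in ]0, 1] is essential. For A <= 0 the upper bound B + 1 of psi + d is enough;
   for A > 0 a positive lower bound of psi on the support is needed, and compactness gives it. *)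
have [m m0 Hm] : exists2 m : R, 0 < m & forall x d, supp eta x -> 0 < d -> d <= 1 -> m <= (psi x + d) `^ (2 * p - 2).
  rewrite kA; have [A0|A0] := leP A 0.
    exists ((B + 1) `^ (2 * A)); first by rewrite powR_gt0// addr_gt0.
    move=> x d sx d0 d1; apply: powR_anti; first by rewrite pmulr_rle0.
      by rewrite ltr_wpDl.
    by rewrite lerD//; have := HB x sx; exact: le_trans (ler_norm _).
  case: Apos => [|ppos]; first by rewrite leNgt A0.
  have [N HN] : exists N : R, forall x, supp eta x -> (psi x)^-1 <= N.
    apply: compact_local_bound => // x /ppos px; exists (2 / psi x).
    have p2 : 0 < psi x / 2 by rewrite divr_gt0.
    have cpsi := Lip_loc_continuous psi_lip; have /cvgrPdist_lt/(_ _ p2) := cpsi x; apply: filterS => z.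
    rewrite ltr_norml => /andP[_ h]; have h' : psi x / 2 < psi z by lra.
    by rewrite -[2 / _]invrK invf_div lef_pV2 ?posrE ?(ltW h')// (lt_trans p2).
  pose N1 := Num.max N 1; have N10 : 0 < N1 by rewrite lt_max ltr01 orbT.
  exists (N1^-1 `^ (2 * A)); first by rewrite powR_gt0// invr_gt0.
  move=> x d sx d0 d1; apply: le_powR; rewrite ?mulr_ge0 ?(ltW A0) ?invr_ge0 ?(ltW N10)//.
  apply: (@le_trans _ _ (psi x)); last by rewrite lerDl ltW.
  rewrite -[psi x]invrK lef_pV2 ?posrE ?invr_gt0 ?ppos//.
  by rewrite le_max HN.
pose C := Be / m; have C0 : 0 < C by rewrite divr_gt0.
apply/ler_addgt0Pr => ep ep0; rewrite add0r.
have ep' : 0 < ep * H / C by rewrite divr_gt0// mulr_gt0.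
(* A radius of at least 2 r0 makes the cutoff equal to 1 on the support of eta. *)
have [r [d [rr0 r_gt0 d0 d1]]] := cutoff_bound hmu cM psi_ge0 psi_lip a_ge0 a_cont p0 H0 growth spec pw ler01 (loc_bounded_cst 0) (2 * r0) ep'.
rewrite mul0r addr0; set rho := cutoff g o r => hW.
have lr : Lip_c g rho by exact: cutoff_Lip_c.
have rho0 x : 0 <= rho x by exact: cutoff_ge0.
have lt := Lip_c_test psi_ge0 psi_lip p d0 lr.
have t0 x : 0 <= test d rho x by exact: test_ge0.
have z0 x : 0 <= C * test d rho x + (-1) * eta x.
  rewrite mulN1r subr_ge0; have [sx|/supp0 ->] := pselect (supp eta x); last by rewrite mulr_ge0// ltW.
  have rx : rho x = 1.
    apply: cutoff1 => //; rewrite ler_pdivlMr// mulrC; apply: le_trans rr0.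
    by rewrite ler_pM2l//; have := Hr0 x sx; exact: le_trans (ler_norm _).
  rewrite /test_fun /= rx !mul1r; apply: (@le_trans _ _ Be).
    by have := HBe x sx; exact: le_trans (ler_norm _).
  by rewrite /C -mulrA ler_peMr ?(ltW Be0)// mulrC ler_pdivlMr// mul1r Hm.
have := psi_sub (Lip_c_lin C (-1) lt le) z0.
rewrite (weak_form_lin hmu A psi_ge0 psi_lip a_cont) // mulN1r subr_ge0 => /le_trans; apply.
rewrite ler_pdivlMr// in hW.
by rewrite -(ler_pM2l H0) (mulrC C) mulrA (mulrC H ep).
Qed.

End Conclusion.

Theorem theorem4 (R : realType) (n : nat) (M : ptopologicalType)
    (g : riemannian_manifold R n M)
    (mu : {measure set (borelType M) -> \bar R}) (hmu : is_volume g mu)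
    (hcomplete : rm_complete g)
    (psi a : M -> R) (A H p0 p1 p : R) (o : M)
    (psi_ge0 : forall x, 0 <= psi x) (psi_lip : Lip_loc g psi)
    (a_ge0 : forall x, 0 <= a x) (a_cont : continuous a)
    (psi_sub : distributional_subsolution g mu a A psi)
    (H_ge : A + 1 <= H) (A1_gt0 : 0 < A + 1)
    (hspec : schroedinger_nonneg g mu (fun x => H * a x))
    (hroots : forall q : R,
       q ^+ 2 - 2 * H * q + H * (A + 1) = 0 <-> q = p0 \/ q = p1)
    (p0_le : p0 <= H) (p1_ge : H <= p1)
    (hp0 : p0 <= p) (hp1 : p <= p1)
    (hgrowth : forall eps : R, 0 < eps -> \forall r \near +oo_R,
       (\int[mu]_(x in geodesic_ball g o r) (psi x `^ (2 * p))%:E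
          <= (eps * r ^+ 2)%:E)%E) :
  (A + 1 < H -> p0 < p -> p < p1 -> exists c : R, forall x, psi x = c) /\
  (H = A + 1 ->
     distributional_equality_on g mu [set x | (0 < extpow (psi x) A)%E] a A psi
     /\ (A <= 0 -> distributional_equality_on g mu setT a A psi)).
Proof.
have H0 : 0 < H by exact: lt_le_trans H_ge.
have D0 : p0 ^+ 2 - 2 * H * p0 + H * (A + 1) = 0 by apply/hroots; left.
have D1 : p1 ^+ 2 - 2 * H * p1 + H * (A + 1) = 0 by apply/hroots; right.
split=> [_ p0p pp1|HA].
  (* Vieta's formula, by subtracting the two equations; the roots are distinct because p lies
     strictly between them. *)
  have sum : p0 + p1 = 2 * H.
    have p01 : p0 - p1 != 0 by rewrite subr_eq0 lt_eqF// (lt_trans p0p).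
    by apply: (mulfI p01); move: D0 D1; lra.
  have DE : disc A H p = (p - p0) * (p - p1).
    by rewrite /disc; move: D0 sum => + /(canRL (addKr _)) -> ; lra.
  have Dn : disc A H p < 0 by rewrite DE nmulr_llt0 ?subr_lt0// subr_gt0.
  (* From D < 0 one has 2 H p > p^2 + H (A + 1) > 0. *)
  have p_gt0 : 0 < p.
    rewrite -(pmulr_rgt0 _ (mulr_gt0 (ltr0n R 2) H0)).
    move: Dn; rewrite /disc; have := sqr_ge0 p; have := mulr_gt0 H0 A1_gt0; lra.
  exact: (constant_case hmu hcomplete psi_ge0 psi_lip a_ge0 a_cont p_gt0 H0 hgrowth hspec psi_sub Dn).
(* For H = A + 1 the discriminant vanishes, so p0 = p1 = H and p is squeezed between them. *)
have sq q : q ^+ 2 - 2 * H * q + H * (A + 1) = (q - H) ^+ 2 by rewrite -HA; ring.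
have rootH q : q ^+ 2 - 2 * H * q + H * (A + 1) = 0 -> q = H.
  by rewrite sq => /eqP; rewrite sqrf_eq0 subr_eq0 => /eqP.
have pH : p = H by apply/le_anti; rewrite -{1}(rootH _ D1) hp1 -(rootH _ D0) hp0.
have p_gt0 : 0 < p by rewrite pH.
have eqc := equality_case hmu hcomplete psi_ge0 psi_lip a_ge0 a_cont p_gt0 H0 hgrowth hspec psi_sub pH HA.
split=> [eta le e0 sO|A0 eta le e0 _]; last by apply: eqc => //; left.
apply: eqc => //; have [A0|A0] := leP A 0; [by left|right => x /sO].
(* For A > 0 the infinite branch of [extpow] is excluded, and 0 to the power A is 0, so Omega is the
   set where psi > 0. *)
have nA : (A < 0) = false by apply/negbTE; rewrite -leNgt ltW.
rewrite /= /extpow nA andbF lte_fin => px.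
rewrite lt_neqAle psi_ge0 andbT eq_sym; apply: contraTneq px => ->.
by rewrite powR0 ?gt_eqF// ltxx.
Qed.
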